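(* Let $(A_j)_{j\in\mathbb N}$ be a decreasing sequence of quasiclosed subsets of $\mathbb R^n$ with intersection $A$, and let $c_*(A_{j_0})<\infty$ for some $j_0\in\mathbb N$. Let $f=\psi+U^\vartheta+U^\omega$ be an external field on $\overline{A_1}$ satisfying $\psi\in\Phi(\overline{A_1})$, $\vartheta\in\mathcal E$, $\omega\in\mathfrak M$ bounded with $\inf_{x\in S(\omega),\,y\in A_1}|x-y|>0$, and $c_*(\{x\in A:\psi(x)<\infty\})>0$. Then the minimizers $\lambda_{A_j,f}$, $j\ge j_0$, and $\lambda_{A,f}$ exist, and, as $j\to\infty$, $$w_f(A_j)\uparrow w_f(A),$$ $$\lambda_{A_j,f}\to\lambda_{A,f}\ \text{ strongly and vaguely in }\mathcal E^+,\qquad c_{A_j,f}\to c_{A,f}.$$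
   Context: Fix $n\ge 2$ and $0<\alpha<n$. $\mathfrak M$ is the space of real-valued (signed) Radon measures $\mu$ on $\mathbb R^n$, always assumed to satisfy $\int_{|y|>1}|y|^{\alpha-n}\,d|\mu|(y)<\infty$, with the vague topology (pointwise convergence on continuous functions of compact support); $\mathfrak M^+$ is the cone of positive ones; $\mu$ is bounded if $|\mu|(\mathbb R^n)<\infty$; $S(\mu)$ is the support. $U^\mu(x)=\int|x-y|^{\alpha-n}\,d\mu(y)$, $I(\mu,\nu)=\iint|x-y|^{\alpha-n}\,d\mu(x)\,d\nu(y)$, $I(\mu)=I(\mu,\mu)$. $\mathcal E$ is the pre-Hilbert space of all $\mu\in\mathfrak M$ of finite energy, with inner product $I(\mu,\nu)$ and norm $\|\mu\|=\sqrt{I(\mu)}$; the norm topology is called strong; $\mathcal E^+=\mathcal E\cap\mathfrak M^+$. For $Q\subset\mathbb R^n$: $\mathfrak M^+(Q)$ is the set of $\mu\in\mathfrak M^+$ concentrated on $Q$ (i.e. $\mathbb R^n\setminus Q$ is $\mu$-negligible); $\mathcal E^+(Q)=\mathcal E\cap\mathfrak M^+(Q)$; $\breve{\mathcal E}^+(Q)=\{\mu\in\mathcal E^+(Q):\mu(\mathbb R^n)=1\}$. Inner capacity: $c_*(Q)=1/\inf\{I(\mu):\mu\in\breve{\mathcal E}^+(Q)\}$ (with $\inf\varnothing=+\infty$, $1/(+\infty)=0$); outer capacity $c^*(Q)=\inf\{c_*(G):G\supset Q\text{ open}\}$. $Q$ is quasiclosed if $\inf\{c^*(Q\bigtriangleup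 F):F\subset\mathbb R^n\text{ closed}\}=0$, $\bigtriangleup$ being the symmetric difference. For closed $F$, $\Phi(F)$ is the class of lower semicontinuous functions $g:F\to(-\infty,\infty]$ that are $\ge0$ unless $F$ is compact. For $\omega=0$ the distance from $S(\omega)=\varnothing$ to any set is $+\infty$. The field $f$ is well defined outside a set of zero outer capacity. $\mathcal E^+_f(Q)$ is the set of $\mu\in\mathcal E^+(Q)$ for which $f$ is $\mu$-integrable, $\breve{\mathcal E}^+_f(Q)=\mathcal E^+_f(Q)\cap\breve{\mathcal E}^+(Q)$, $I_f(\mu)=I(\mu)+2\int f\,d\mu$, $w_f(Q)=\inf_{\mu\in\breve{\mathcal E}^+_f(Q)}I_f(\mu)$. The minimizer $\lambda_{Q,f}$ is the measure in $\breve{\mathcal E}^+_f(Q)$ with $I_f(\lambda_{Q,f})=w_f(Q)$ (unique if it exists), and $c_{Q,f}:=\int(U^{\lambda_{Q,f}}+f)\,d\lambda_{Q,f}=w_f(Q)-\int f\,d\lambda_{Q,f}$. *)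

(* Defs.v *)
From HB Require Import structures.
From mathcomp Require Import all_boot all_order all_algebra.
From mathcomp Require Import all_classical all_reals all_analysis.

Set Implicit Arguments.
Unset Strict Implicit.
Unset Printing Implicit Defensive.

Import Order.TTheory GRing.Theory Num.Theory.
Import numFieldNormedType.Exports.

Local Open Scope classical_set_scope.
Local Open Scope ring_scope.

(* The carrier of borel R n is 'rV[R]_n; only the measurable structure differs. *)
Definition borel (R : realType) (n : nat) :=
  g_sigma_algebraType (@open 'rV[R]_n).

Notation posmeasure R n := {measure set (borel R n) -> \bar R}.

(* The library norm on 'rV[R]_n is the sup norm (same topology). *)
Definition enorm (R : realType) (n : nat) (x : 'rV[R]_n) : R :=
  Num.sqrt (\sum_(i < n) x ord0 i ^+ 2).

(* powR sends 0 to 0 for nonzero exponents, hence the explicit diagonal. *)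
Definition riesz_kernel (R : realType) (n : nat) (alpha : R)
    (x y : 'rV[R]_n) : \bar R :=
  if x == y then +oo%E else (enorm (x - y) `^ (alpha - n%:R))%:E.

Section positive_measures.
Context {R : realType} {n : nat}.
Variable alpha : R.
Local Open Scope ereal_scope.

(* On R^n a locally finite Borel measure is automatically Radon. *)
Definition Mplus (mu : posmeasure R n) : Prop :=
  (forall K : set 'rV[R]_n, compact K -> mu K < +oo) /\
  \int[mu]_(y in [set y : 'rV[R]_n | (1 < enorm y)%R])
     (enorm y `^ (alpha - n%:R))%:E < +oo.

Definition potential (mu : posmeasure R n) (x : 'rV[R]_n) : \bar R :=
  \int[mu]_y riesz_kernel alpha x y.

Definition mutual_energy (mu nu : posmeasure R n) : \bar R :=
  \int[mu]_x \int[nu]_y riesz_kernel alpha x y.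

Definition energy (mu : posmeasure R n) : \bar R := mutual_energy mu mu.

(* I(mu - nu), expanded by bilinearity. It is finite exactly when all four
   mutual energies are, that is, when the kernel is integrable against
   (mu - nu) (x) (mu - nu) for this decomposition. *)
Definition energy_sub (mu nu : posmeasure R n) : \bar R :=
  (energy mu + energy nu) - (mutual_energy mu nu + mutual_energy nu mu).

Definition strong_dist (mu nu : posmeasure R n) : \bar R :=
  sqrte (energy_sub mu nu).

Definition Eplus (mu : posmeasure R n) : Prop :=
  Mplus mu /\ energy mu \is a fin_num.

(* Q need not be Borel: negligible means contained in a Borel null set. *)
Definition concentrated (mu : posmeasure R n) (Q : set 'rV[R]_n) : Prop :=
  mu.-negligible (~` Q).

Definition Eplus_on (Q : set 'rV[R]_n) : set (posmeasure R n) :=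
  [set mu | Eplus mu /\ concentrated mu Q].

Definition Eplus1_on (Q : set 'rV[R]_n) : set (posmeasure R n) :=
  [set mu | Eplus_on Q mu /\ mu setT = 1].

(* Extended inverse: +oo^-1 = 0 and 0^-1 = +oo. *)
Definition inner_capacity (Q : set 'rV[R]_n) : \bar R :=
  (ereal_inf [set energy mu | mu in Eplus1_on Q])^-1.

Definition outer_capacity (Q : set 'rV[R]_n) : \bar R :=
  ereal_inf [set inner_capacity G | G in [set G | open G /\ Q `<=` G]].

Definition quasiclosed (Q : set 'rV[R]_n) : Prop :=
  ereal_inf [set outer_capacity ((Q `\` F) `|` (F `\` Q)) |
             F in [set F : set 'rV[R]_n | closed F]] = 0.

End positive_measures.

(* A signed Radon measure is given by its Jordan decomposition. *)
Record signed_measure (R : realType) (n : nat) := SignedMeasure {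
  pos_part : posmeasure R n;
  neg_part : posmeasure R n;
  parts_singular : exists P : set (borel R n),
    [/\ measurable P, pos_part (~` P) = 0%E & neg_part P = 0%E] }.

Section signed_measures.
Context {R : realType} {n : nat}.
Variable alpha : R.
Implicit Types mu : signed_measure R n.
Local Open Scope ereal_scope.

Definition abs_measure mu : posmeasure R n :=
  measure_add (pos_part mu) (neg_part mu).

Definition signed_M mu : Prop := Mplus alpha (abs_measure mu).

Definition signed_E mu : Prop :=
  signed_M mu /\ energy_sub alpha (pos_part mu) (neg_part mu) \is a fin_num.

Definition bounded_measure mu : Prop := abs_measure mu setT < +oo.

Definition msupport mu : set 'rV[R]_n :=
  ~` \bigcup_(V in [set V | open V /\ abs_measure mu V = 0]) V.

(* Meaningful where the two potentials are not both infinite. *)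
Definition signed_potential mu (x : 'rV[R]_n) : \bar R :=
  potential alpha (pos_part mu) x - potential alpha (neg_part mu) x.

(* inf of |x - y| over x in S(mu) and y in Q, +oo if either set is empty *)
Definition dist_support mu (Q : set 'rV[R]_n) : \bar R :=
  ereal_inf [set (enorm (x - y))%:E | x in msupport mu & y in Q].

End signed_measures.

(* Functions on a closed set F are total functions whose values off F are
   irrelevant: in subspace F every point outside F is isolated. *)
Definition Phi (R : realType) (n : nat) (F : set 'rV[R]_n)
    (g : 'rV[R]_n -> \bar R) : Prop :=
  [/\ lower_semicontinuous (g : subspace F -> \bar R),
      forall x, F x -> (-oo < g x)%E
    & compact F \/ forall x, F x -> (0 <= g x)%E].

(* Where the sum is undefined, which happens only on a subset of zero outer
   capacity of the domain, it takes a junk value; measures of finite energy do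
   not see such sets. *)
Definition external_field (R : realType) (n : nat) (alpha : R)
    (psi : 'rV[R]_n -> \bar R) (theta omega : signed_measure R n)
    (x : 'rV[R]_n) : \bar R :=
  (psi x + signed_potential alpha theta x + signed_potential alpha omega x)%E.

Section gauss_variational_problem.
Context {R : realType} {n : nat}.
Variables (alpha : R).
(* D is the closed domain on which the field f is given; Q ranges over its
   subsets. *)
Variables (D : set 'rV[R]_n) (f : 'rV[R]_n -> \bar R).
Local Open Scope ereal_scope.

Definition Eplus1_f (Q : set 'rV[R]_n) : set (posmeasure R n) :=
  [set mu | Eplus1_on alpha Q mu /\ mu.-integrable D f].

Definition energy_f (mu : posmeasure R n) : \bar R :=
  energy alpha mu + 2%:E * \int[mu]_(x in D) f x.

Definition w_f (Q : set 'rV[R]_n) : \bar R :=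
  ereal_inf [set energy_f mu | mu in Eplus1_f Q].

Definition minimizer (Q : set 'rV[R]_n) (lam : posmeasure R n) : Prop :=
  Eplus1_f Q lam /\ energy_f lam = w_f Q.

Definition eq_constant (lam : posmeasure R n) : \bar R :=
  \int[lam]_(x in D) (potential alpha lam x + f x).

End gauss_variational_problem.

Section convergence.
Context {R : realType} {n : nat}.

Definition strong_cvg (alpha : R) (mu : nat -> posmeasure R n)
    (nu : posmeasure R n) : Prop :=
  strong_dist alpha (mu j) nu @[j --> \oo] --> (0 : \bar R).

Definition vague_cvg (mu : nat -> posmeasure R n)
    (nu : posmeasure R n) : Prop :=
  forall phi : 'rV[R]_n -> R, continuous phi ->
    compact (closure [set x | phi x != 0]) ->
    (\int[mu j]_x (phi x)%:E)%E @[j --> \oo] --> (\int[nu]_x (phi x)%:E)%E.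

End convergence.

(* Main.v *)
(* The Riesz kernel is a superposition of Gaussians,
   |x - y|^(alpha - n) = C^-1 int_R e^(a v) exp(- e^v |x - y|^2) dv with
   a = (n - alpha) / 2, hence positive definite; truncating the integral yields
   bounded kernels that increase to it.

   If mu_k is an energy-minimizing sequence on the sets A_k, the parallelogram
   law makes it Cauchy in energy. Along an ultrafilter it has a vague limit mu,
   and the truncated kernels show that mu_k -> mu strongly. Since the A_k are
   quasiclosed, mu is concentrated on their intersection; since A_(j0) has
   finite capacity, mass lost at infinity would cost energy, so mu has mass 1.
   The field is, up to a constant and the potential of theta, a nonnegative
   lower semicontinuous density, so mu minimizes the weighted energy on the
   intersection. Constant sequences of sets give existence on each A_j.

   Vague convergence holds along every ultrafilter because the limit is unique:
   two probability measures at energy distance zero have the same integrals of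
   all Gaussians, therefore of all their polynomials, therefore the same values
   on finite intersections of balls. *)
Require Import Defs.
From HB Require Import structures.
From mathcomp Require Import all_boot all_order all_algebra.
From mathcomp Require Import all_classical all_reals all_analysis.
From mathcomp Require Import ring lra.

Set Implicit Arguments.
Unset Strict Implicit.
Unset Printing Implicit Defensive.

Import Order.TTheory GRing.Theory Num.Theory.
Import numFieldNormedType.Exports.
Import measurable_realfun.

Local Open Scope classical_set_scope.
Local Open Scope ring_scope.

(** * Vague limits along an ultrafilter *)

(** Under vague limits mutual energies are only lower semicontinuous, but the squared distance
    contains one with a minus sign. The truncated potentials of finite measures are continuous and
    vanish at infinity, so their integrals pass to the limit in both directions; a Cauchy bound then
    survives, for each truncation and hence for the kernel itself. No prior completeness of the
    positive cone is assumed. Concentration on a quasiclosed set survives because the squared mass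
    of an open set is at most its capacity times the energy: under a common energy bound a set of
    small capacity has uniformly small mass, and outside such a set a quasiclosed set coincides with
    a closed one. The terms of the field pass to the limit for different reasons. The potential of
    theta has no sign, but its integral is a difference of mutual energies, continuous for the
    energy distance. On the closure of the first set the potentials of the two parts of omega are
    bounded and continuous, so a constant minus the negative one is again nonnegative and lower
    semicontinuous. Competitors have mass one, so added constants only shift the functional. *)

Section ultrafilter_limit.
Context {R : realType} (U : set_system nat) {UU : UltraFilter U}.
Implicit Types x y : nat -> R.

(** Along an ultrafilter the supremum of the eventual lower bounds of a bounded sequence is its
    limit; [lt_ulim] and [ulim_lt] are the two halves of this. *)
Definition ulim x : R := sup [set a | \forall k \near U, a <= x k].

Let bdd x := forall k, 0 <= x k <= 1.

Let has_sup_ulim x : bdd x -> has_sup [set a | \forall k \near U, a <= x k].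
Proof.
move=> xb; split.
  by exists 0; apply: filterE => k; case/andP: (xb k).
exists 1 => a /= ax; have [k ak] := filter_ex ax.
by apply: (le_trans ak); case/andP: (xb k).
Qed.

Lemma lt_ulim x a : bdd x -> a < ulim x -> \forall k \near U, a < x k.
Proof.
move=> xb /(sup_gt (has_sup_ulim xb).1)[b /= bx ab].
by apply: filterS bx => k; exact: lt_le_trans.
Qed.

Lemma ulim_lt x a : bdd x -> ulim x < a -> \forall k \near U, x k < a.
Proof.
(* This half needs [U] to be maximal: either the set where [a <= x k] or its complement belongs to
   [U]. *)
move=> xb xa; have [H|H] := in_ultra_setVsetC [set k | a <= x k] UU.
  have : a <= ulim x by apply: ub_le_sup H; exact: (has_sup_ulim xb).2.
  by rewrite leNgt xa.
by apply: filterS H => k /= /negP; rewrite -ltNge.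
Qed.

Lemma ulim_ge0 x : bdd x -> 0 <= ulim x.
Proof.
move=> xb; rewrite leNgt; apply/negP => /(ulim_lt xb) H.
by have [k] := filter_ex H; rewrite ltNge; case/andP: (xb k) => ->.
Qed.

Lemma le_ulim x y : bdd x -> bdd y -> (forall k, x k <= y k) -> ulim x <= ulim y.
Proof.
move=> xb yb xy; rewrite leNgt; apply/negP => yx.
pose c := (ulim x + ulim y) / 2.
have : \forall k \near U, c < x k /\ y k < c.
  apply: filterI; [apply: lt_ulim|apply: ulim_lt] => //; rewrite /c; lra.
move=> /filter_ex[k [xc yc]]; have := xy k; lra.
Qed.

Lemma ulimD_le x y z : bdd x -> bdd y -> bdd z ->
  (forall k, x k <= y k + z k) -> ulim x <= ulim y + ulim z.
Proof.
move=> xb yb zb xyz; rewrite leNgt; apply/negP => yx.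
pose e := (ulim x - (ulim y + ulim z)) / 3.
have : \forall k \near U, [/\ ulim x - e < x k, y k < ulim y + e & z k < ulim z + e].
  near=> k; split; near: k; [apply: lt_ulim|apply: ulim_lt|apply: ulim_lt] => //.
  1-3: rewrite /e; lra.
move=> /filter_ex[k [+ + +]]; have := xyz k; rewrite /e => *; lra.
Unshelve. all: by end_near. Qed.

Lemma ulimD_ge x y z : bdd x -> bdd y -> bdd z ->
  (forall k, x k + y k <= z k) -> ulim x + ulim y <= ulim z.
Proof.
move=> xb yb zb xyz; rewrite leNgt; apply/negP => yx.
pose e := (ulim x + ulim y - ulim z) / 3.
have : \forall k \near U, [/\ ulim x - e < x k, ulim y - e < y k & z k < ulim z + e].
  near=> k; split; near: k; [apply: lt_ulim|apply: lt_ulim|apply: ulim_lt] => //.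
  1-3: rewrite /e; lra.
move=> /filter_ex[k [+ + +]]; have := xyz k; rewrite /e => *; lra.
Unshelve. all: by end_near. Qed.

End ultrafilter_limit.

Section borel_sets.
Context {R : realType} {n : nat}.
Local Notation X := 'rV[R]_n.
Implicit Types G K F : set X.

Lemma open_borel G : open G -> measurable (G : set (borel R n)).
Proof. by move=> oG; exact: sub_sigma_algebra. Qed.

Lemma closed_borel F : closed F -> measurable (F : set (borel R n)).
Proof.
by move=> /closed_openC/open_borel/measurableC; rewrite setCK.
Qed.

Lemma compact_closed_rV K : compact K -> closed K.
Proof. by apply: compact_closed; exact: norm_hausdorff. Qed.

Lemma compact_borel K : compact K -> measurable (K : set (borel R n)).
Proof. by move=> /compact_closed_rV; exact: closed_borel. Qed.

(** The closed sets [K \ G1] and [K \ G2] are disjoint, so normality separates them by open sets;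
    removing one or the other from [K] gives the two pieces. Subadditivity of the inner content on
    open sets rests on this. *)
Lemma compact_split G1 G2 K : open G1 -> open G2 -> compact K ->
  K `<=` G1 `|` G2 ->
  exists K1 K2, [/\ compact K1, compact K2, K1 `<=` G1, K2 `<=` G2
    & K `<=` K1 `|` K2].
Proof.
move=> oG1 oG2 cK KG; have clK := compact_closed_rV cK.
have clD G : open G -> closed (K `\` G).
  by move=> oG; rewrite setDE; apply: closedI => //; exact: open_closedC.
have dis : (K `\` G1) `&` (K `\` G2) = set0.
  by rewrite -subset0 => x /= [[Kx nG1] [_ nG2]]; have [] := KG _ Kx.
have /(@normal_openP R) nrm := @pseudometric_normal R X.
have [V1 [V2 [oV1 oV2 KV1 KV2 V12]]] := nrm _ _ (clD _ oG1) (clD _ oG2) dis.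
exists (K `\` V1), (K `\` V2); split.
- by rewrite setDE; apply: compact_closedI => //; exact: open_closedC.
- by rewrite setDE; apply: compact_closedI => //; exact: open_closedC.
- by move=> x [Kx nV]; apply: contrapT => nG; apply: nV; exact: KV1.
- by move=> x [Kx nV]; apply: contrapT => nG; apply: nV; exact: KV2.
- move=> x Kx; have [Vx|nV] := pselect (V1 x); last by left.
  right; split => // V2x.
  by have : (V1 `&` V2) x by []; rewrite V12.
Qed.

Lemma compact_bigcup (G : nat -> set X) K : (forall i, open (G i)) ->
  compact K -> K `<=` \bigcup_i G i -> exists N, K `<=` \bigcup_(i < N) G i.
Proof.
rewrite compact_cover => oG cK KG.
have [D _ KD] := cK nat setT G (fun i _ => oG i) KG.
exists (\max_(i <- finmap.enum_fset D) i.+1)%N => x /KD [i /= iD Gx].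
exists i => //=.
exact: (@leq_bigmax_seq _ (finmap.enum_fset D) xpredT (fun i => i.+1)).
Qed.

End borel_sets.

(* For probability measures [mu k] and an ultrafilter [U], the set function
   [E |-> lim_U mu k E] is finitely additive; regularizing it from inside by
   compact sets and then from outside by open sets gives a measure, which is
   the vague limit along [U]. *)
Section vague_limit.
Context {R : realType} {n : nat}.
Variables (U : set_system nat) (mu : nat -> posmeasure R n).
Context {UU : UltraFilter U}.
Hypothesis mu1 : forall k, mu k setT = 1%E.
Local Notation X := 'rV[R]_n.
Implicit Types G K E : set X.

Let L E : R := ulim U (fun k => fine (mu k E)).

Lemma prob_le1 k E : measurable (E : set (borel R n)) -> (mu k E <= 1)%E.
Proof. by move=> mE; rewrite -(mu1 k); apply: le_measure; rewrite ?inE. Qed.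

Lemma prob_fin k E : measurable (E : set (borel R n)) -> mu k E \is a fin_num.
Proof.
move=> mE; rewrite ge0_fin_numE ?measure_ge0//.
by rewrite (le_lt_trans (prob_le1 k mE))// ltry.
Qed.

Lemma fine_prob k E : measurable (E : set (borel R n)) ->
  0 <= fine (mu k E) <= 1.
Proof.
move=> mE; rewrite fine_ge0 ?measure_ge0//=.
by rewrite -lee_fin fineK ?prob_fin// prob_le1.
Qed.

Let L_ge0 E : measurable (E : set (borel R n)) -> 0 <= L E.
Proof. by move=> mE; apply: ulim_ge0 => k; exact: fine_prob. Qed.

Let L_mono E F : measurable (E : set (borel R n)) ->
  measurable (F : set (borel R n)) -> E `<=` F -> L E <= L F.
Proof.
move=> mE mF EF; apply: le_ulim => k; rewrite ?fine_prob//.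
by apply: fine_le; rewrite ?prob_fin//; apply: le_measure; rewrite ?inE.
Qed.

Let LU_le E F G : measurable (E : set (borel R n)) ->
  measurable (F : set (borel R n)) -> measurable (G : set (borel R n)) ->
  G `<=` E `|` F -> L G <= L E + L F.
Proof.
move=> mE mF mG GEF; apply: ulimD_le => k; rewrite ?fine_prob//.
rewrite -fineD ?prob_fin//; apply: fine_le; rewrite ?fin_numD ?prob_fin//.
apply: (le_trans _ (measureU2 _ mE mF)).
by apply: le_measure; rewrite ?inE//; exact: measurableU.
Qed.

Let LU_ge E F G : measurable (E : set (borel R n)) ->
  measurable (F : set (borel R n)) -> measurable (G : set (borel R n)) ->
  E `|` F `<=` G -> E `&` F = set0 -> L E + L F <= L G.
Proof.
move=> mE mF mG EFG EF0; apply: ulimD_ge => k; rewrite ?fine_prob//.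
rewrite -fineD ?prob_fin//; apply: fine_le; rewrite ?fin_numD ?prob_fin//.
have := @measureU _ _ _ (mu k) _ _ mE mF EF0; rewrite /= => <-.
by apply: le_measure; rewrite ?inE//; exact: measurableU.
Qed.

Let Lam G : \bar R :=
  ereal_sup [set (L K)%:E | K in [set K | compact K /\ K `<=` G]].

Let Lam_ub G K : compact K -> K `<=` G -> ((L K)%:E <= Lam G)%E.
Proof. by move=> cK KG; apply: ereal_sup_ubound; exists K. Qed.

Let Lam_ge0 G : (0 <= Lam G)%E.
Proof.
apply: (@le_trans _ _ (L set0)%:E); last by apply: Lam_ub => //; exact: compact0.
by rewrite lee_fin L_ge0//; apply: compact_borel; exact: compact0.
Qed.

Let LamU G1 G2 : open G1 -> open G2 ->
  (Lam (G1 `|` G2) <= Lam G1 + Lam G2)%E.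
Proof.
move=> o1 o2; apply: ge_ereal_sup => _ [K [cK KG] <-].
have [K1 [K2 [c1 c2 s1 s2 KK]]] := compact_split o1 o2 cK KG.
apply: (@le_trans _ _ ((L K1)%:E + (L K2)%:E)%E).
  by rewrite -EFinD lee_fin; apply: LU_le => //; exact: compact_borel.
by apply: leeD; exact: Lam_ub.
Qed.

Let Lam0 : Lam set0 = 0%E.
Proof.
apply/eqP; rewrite eq_le Lam_ge0 andbT.
apply: ge_ereal_sup => _ [K [_ K0] <-]; rewrite (_ : K = set0); last by rewrite -subset0.
have := @LU_ge set0 set0 set0 measurable0 measurable0 measurable0.
rewrite setU0 setI0 => /(_ (@subset_refl _ _) erefl).
by rewrite lee_fin; lra.
Qed.

Let Lam_bigcup (G : nat -> set X) : (forall i, open (G i)) ->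
  (Lam (\bigcup_i G i) <= \sum_(i <oo) Lam (G i))%E.
Proof.
move=> oG; apply: ge_ereal_sup => _ [K [cK KG] <-].
have [N KN] := compact_bigcup oG cK KG.
apply: (le_trans (Lam_ub cK KN)).
apply: (@le_trans _ _ (\sum_(0 <= i < N) Lam (G i))%E); last first.
  exact: nneseries_lim_ge.
elim: N {KN} => [|N IH]; first by rewrite II0 bigcup_set0 big_nil Lam0.
rewrite big_nat_recr//= IIS bigcup_setU bigcup_set1.
apply: (le_trans (LamU _ (oG N))); last by rewrite leeD2r.
by apply: bigcup_open => i _.
Qed.

Definition vlim E : \bar R :=
  ereal_inf [set ereal_sup [set (ulim U (fun k => fine (mu k K)))%:E
                           | K in [set K | compact K /\ K `<=` G]]
            | G in [set G | open G /\ E `<=` G]].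

Let vlim_lb E G : open G -> E `<=` G -> (vlim E <= Lam G)%E.
Proof. by move=> oG EG; apply: ereal_inf_lbound; exists G. Qed.

Let vlim0 : vlim set0 = 0%E.
Proof.
apply/eqP; rewrite eq_le; apply/andP; split.
  by rewrite -[leRHS]Lam0; apply: vlim_lb => //; exact: open0.
by apply: le_ereal_inf_tmp => _ [G [oG _] <-]; exact: Lam_ge0.
Qed.

Let vlim_ge0 E : (0 <= vlim E)%E.
Proof. by apply: le_ereal_inf_tmp => _ [G [oG _] <-]; exact: Lam_ge0. Qed.

Let le_vlim : {homo vlim : A B / A `<=` B >-> (A <= B)%E}.
Proof.
move=> A B AB; apply: le_ereal_inf_tmp => _ [G [oG BG] <-].
by apply: vlim_lb => //; exact: subset_trans BG.
Qed.

Let Lam_le1 G : (Lam G <= 1)%E.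
Proof.
apply: ge_ereal_sup => _ [K [cK KG] <-]; rewrite lee_fin leNgt.
have mK := compact_borel cK; apply/negP.
move=> /(lt_ulim (fun k => fine_prob k mK))/filter_ex[k].
by rewrite ltNge; case/andP: (fine_prob k mK) => _ ->.
Qed.

Let vlim_le1 E : (vlim E <= 1)%E.
Proof. by apply: (le_trans (@vlim_lb E setT openT _)). Qed.

Let vlim_fin E : vlim E \is a fin_num.
Proof. by rewrite ge0_fin_numE// (le_lt_trans (vlim_le1 E))// ltry. Qed.

Let vlim_sub : sigma_subadditive vlim.
Proof.
move=> F; apply/lee_addgt0Pr => e e0.
have e2 i : 0 < e / (2 ^ i.+1)%:R by rewrite divr_gt0// ltr0n expn_gt0.
have /choice[G HG] i : exists G, [/\ open G, F i `<=` G &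
    (Lam G <= vlim (F i) + (e / (2 ^ i.+1)%:R)%:E)%E].
  have : (vlim (F i) < vlim (F i) + (e / (2 ^ i.+1)%:R)%:E)%E.
    by rewrite lteDl// lte_fin.
  by move=> /ereal_inf_lt[_ [G [oG FG] <-]] /ltW; exists G.
apply: (@le_trans _ _ (Lam (\bigcup_i G i))).
  apply: vlim_lb; first by apply: bigcup_open => i _; case: (HG i).
  by apply: subset_bigcup => i _; case: (HG i).
apply: (le_trans (Lam_bigcup (fun i => let: And3 o _ _ := HG i in o))).
apply: le_trans (epsilon_trick xpredT _ (ltW e0)) => //.
by apply: lee_nneseries => // i _; case: (HG i).
Qed.

HB.instance Definition _ := isOuterMeasure.Build R X vlim vlim0 vlim_ge0 le_vlim vlim_sub.

(** For an open [V] containing the test set, take a compact [K] inside [V] and [G], then a compact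
    [K'] inside [V] minus [K]. The two are disjoint, so their limit masses add up to at most
    [Lam V]. *)
Let open_caratheodory G : open G -> caratheodory_measurable vlim G.
Proof.
move=> oG; apply: le_caratheodory_measurable => E.
apply: le_ereal_inf_tmp => _ [V [oV EV] <-].
rewrite -leeBrDr//; apply: (@le_trans _ _ (Lam (V `&` G))).
  by apply: vlim_lb; [exact: openI|exact: setSI].
apply: ge_ereal_sup => _ [K [cK KVG] <-].
rewrite leeBrDr// -leeBrDl//.
apply: (@le_trans _ _ (Lam (V `\` K))).
  apply: vlim_lb; first by rewrite setDE; apply: openI => //;
    apply: closed_openC; exact: compact_closed_rV.
  by move=> x [/EV Vx nG]; split=> // /KVG[].
apply: ge_ereal_sup => _ [K' [cK' KVK] <-].
rewrite leeBrDl// -EFinD.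
have KK : compact (K `|` K') by exact: compactU.
apply: (@le_trans _ _ (L (K `|` K'))%:E); last apply: Lam_ub => //.
  rewrite lee_fin; apply: LU_ge => //; try exact: compact_borel.
  by rewrite -subset0 => x [Kx /KVK[]].
by rewrite subUset; split => x; [move=> /KVG[]|move=> /KVK[]].
Qed.

Let borel_caratheodory E : measurable (E : set (borel R n)) ->
  measurable (E : set (caratheodory_type vlim)).
Proof.
apply: smallest_sub; last by move=> G; exact: open_caratheodory.
by split => //; [move=> A mA; rewrite setTD; exact: measurableC
                |move=> A mA; exact: bigcupT_measurable].
Qed.

Definition vlim_measure : set (borel R n) -> \bar R := vlim.

Let vlim_measure0 : vlim_measure set0 = 0%E. Proof. exact: vlim0. Qed.

Let vlim_measure_ge0 E : (0 <= vlim_measure E)%E. Proof. exact: vlim_ge0. Qed.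

Let vlim_measure_sigma_additive : semi_sigma_additive vlim_measure.
Proof.
move=> F mF tF mUF; apply: caratheodory_measure_sigma_additive => //.
  by move=> i; exact: borel_caratheodory.
exact: borel_caratheodory.
Qed.

HB.instance Definition _ := isMeasure.Build _ _ _ vlim_measure
  vlim_measure0 vlim_measure_ge0 vlim_measure_sigma_additive.

Definition vague_limit : posmeasure R n := vlim_measure.

Lemma vague_limit_le1 : (vague_limit setT <= 1)%E.
Proof. exact: vlim_le1. Qed.

(** Portmanteau inequalities, here for open and below for compact sets: the inner regularization
    lies below the limit of the masses on open sets, the outer one above it on compact sets. *)
Lemma vague_limit_open G eta : open G -> 0 < eta ->
  \forall k \near U, (vague_limit G <= mu k G + eta%:E)%E.
Proof.
move=> oG eta0; have mG := open_borel oG.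
have H : (vague_limit G <= (L G)%:E)%E.
  apply: (le_trans (vlim_lb oG (@subset_refl _ _))).
  apply: ge_ereal_sup => _ [K [cK KG] <-]; rewrite lee_fin L_mono//.
  exact: compact_borel.
have : L G - eta < L G by rewrite ltrBlDr ltrDl.
move=> /(lt_ulim (fun k => fine_prob k mG)); apply: filterS => k Hk.
apply: (le_trans H); rewrite -(fineK (prob_fin k mG)) -EFinD lee_fin; lra.
Qed.

Lemma vague_limit_compact K eta : compact K -> 0 < eta ->
  \forall k \near U, (mu k K <= vague_limit K + eta%:E)%E.
Proof.
move=> cK eta0; have mK := compact_borel cK.
have H : ((L K)%:E <= vague_limit K)%E.
  apply: le_ereal_inf_tmp => _ [G [oG KG] <-]; exact: Lam_ub.
have : L K < L K + eta by rewrite ltrDl.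
move=> /(ulim_lt (fun k => fine_prob k mK)); apply: filterS => k Hk.
rewrite -(fineK (prob_fin k mK)).
apply: le_trans (leeD2r _ H); rewrite -EFinD lee_fin; lra.
Qed.

End vague_limit.

Section layers.
Context d (T : measurableType d) (R : realType).
Variables (h : T -> \bar R) (delta : R) (G : nat -> set T).
Hypothesis h0 : forall x, (0 <= h x)%E.
Hypothesis mh : measurable_fun setT h.
Hypothesis delta0 : 0 < delta.
Hypothesis mG : forall i, measurable (G i).
(** Both inequalities are weak, so that [G i] may be the set where [h] exceeds [(i + 1) * delta] or
    the one where it is at least that. Lower bounds along [U] use the former, which are open; upper
    bounds use the latter, which are compact. *)
Hypothesis Gh : forall i x, G i x -> ((i.+1%:R * delta)%:E <= h x)%E.
Hypothesis hG : forall i x, ~ G i x -> (h x <= (i.+1%:R * delta)%:E)%E.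

Let S N x : R := \sum_(i < N) delta * \1_(G i) x.

Let SS N x : S N.+1 x = S N x + delta * \1_(G N) x.
Proof. by rewrite /S big_ord_recr. Qed.

Let S_ge0 N x : 0 <= S N x.
Proof. by apply: sumr_ge0 => i _; rewrite mulr_ge0// ltW. Qed.

Let S_le N x : S N x <= N%:R * delta.
Proof.
elim: N => [|N IH]; first by rewrite /S big_ord0 mul0r.
rewrite SS -natr1 mulrDl mul1r lerD// ler_piMr ?(ltW delta0)//.
Qed.

Let S_leh N x : ((S N x)%:E <= h x)%E.
Proof.
elim: N => [|N IH]; first by rewrite /S big_ord0.
have [Gx|nG] := pselect (G N x).
  by apply: le_trans (Gh Gx); rewrite lee_fin S_le.
by rewrite SS indicE memNset// mulr0 addr0.
Qed.

(** Either the first [N] layers are all full at [x], or some layer misses [x] and already bounds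
    [h x]. *)
Let h_leS N x : (mine (h x) (N%:R * delta)%:E <= (delta + S N x)%:E)%E.
Proof.
have [->|H] : S N x = N%:R * delta \/ (h x <= (delta + S N x)%:E)%E.
  elim: N => [|N [IH|IH]]; first by left; rewrite /S big_ord0 mul0r.
    have [Gx|nG] := pselect (G N x).
      by left; rewrite SS IH indicE mem_set// mulr1 -natr1 mulrDl mul1r.
    right; apply: (le_trans (hG nG)); rewrite lee_fin SS indicE memNset//.
    by rewrite IH mulr0 addr0 -natr1 mulrDl mul1r addrC.
  right; apply: (le_trans IH); rewrite lee_fin SS addrA lerDl.
  by rewrite mulr_ge0// ltW.
  by rewrite ge_min; apply/orP; right; rewrite lee_fin lerDr ltW.
by rewrite ge_min H.
Qed.

Let mS N : measurable_fun setT (fun x => (S N x)%:E).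
Proof.
apply/measurable_EFinP; apply: measurable_sum => i.
by apply: measurable_funM => //; exact: measurable_indic.
Qed.

Let intS (mu : {measure set T -> \bar R}) N :
  (\int[mu]_x (S N x)%:E = \sum_(i < N) delta%:E * mu (G i))%E.
Proof.
under eq_integral do rewrite /S -sumEFin.
rewrite ge0_integral_sum//.
- apply: eq_bigr => i _; under eq_integral do rewrite EFinM.
  rewrite ge0_integralZl//.
  + by rewrite integral_indic// setIT.
  + by apply/measurable_EFinP; exact: measurable_indic.
  + by rewrite lee_fin ltW.
- move=> i; apply/measurable_EFinP.
  by apply: measurable_funM => //; exact: measurable_indic.
- by move=> i x _; rewrite lee_fin mulr_ge0// ltW.
Qed.

Lemma sum_layer_le_integral (mu : {measure set T -> \bar R}) N :
  (\sum_(i < N) delta%:E * mu (G i) <= \int[mu]_x h x)%E.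
Proof.
by rewrite -intS; apply: ge0_le_integral => // x _; rewrite lee_fin.
Qed.

Lemma integral_le_sum_layer (mu : {measure set T -> \bar R}) N :
  (\int[mu]_x mine (h x) (N%:R * delta)%:E <=
   delta%:E * mu setT + \sum_(i < N) delta%:E * mu (G i))%E.
Proof.
have -> : (delta%:E * mu setT = \int[mu]_x (cst delta%:E) x)%E.
  by rewrite integral_cst.
rewrite -intS -ge0_integralD//; first last.
- by move=> x _; rewrite lee_fin.
- by move=> x _; rewrite lee_fin ltW.
apply: ge0_le_integral => //.
- by move=> x _; rewrite le_min h0/= lee_fin mulr_ge0// ltW.
- exact: measurable_mine.
- by apply: emeasurable_funD => //; exact: mS.
Qed.

End layers.

Section semicontinuity.
Context {R : realType} {n : nat}.
Variables (U : set_system nat) (mu : nat -> posmeasure R n).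
Context {UU : UltraFilter U}.
Hypothesis mu1 : forall k, mu k setT = 1%E.
Local Notation X := 'rV[R]_n.
Local Notation lambda := (@vague_limit R n U mu UU mu1).

Let lambda1 : (lambda setT <= 1)%E := vague_limit_le1 _.

Lemma lsc_measurable (h : borel R n -> \bar R) :
  (forall c, open [set x : X | (c%:E < h x)%E]) -> measurable_fun setT h.
Proof.
move=> oh; apply: (measurability _ (ErealGenOInfty.measurableE R)).
move=> /= _ [_ [a ->]] <-; rewrite setTI; apply: open_borel.
by rewrite preimage_itvoy; exact: oh.
Qed.

(** Cut [h] at a height that keeps the integral above [b], then slice it into finitely many open
    layers, whose masses can only drop in the limit. *)
Lemma vague_limit_lsc (h : borel R n -> \bar R) (b : R) :
  (forall x, (0 <= h x)%E) ->
  (forall c, open [set x : X | (c%:E < h x)%E]) ->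
  (b%:E < \int[lambda]_x h x)%E -> \forall k \near U, (b%:E < \int[mu k]_x h x)%E.
Proof.
move=> h0 oh bh; have mh := lsc_measurable oh.
pose hm N x := mine (h x) (N%:R)%:E.
have hm0 N x : (0 <= hm N x)%E by rewrite /hm le_min h0 lee_fin ler0n.
have mhm N : measurable_fun setT (hm N) by exact: measurable_mine.
have hmnd x : {homo hm^~ x : N M / (N <= M)%N >-> (N <= M)%E}.
  by move=> N M NM; apply: le_min2 => //; rewrite lee_fin ler_nat.
have hmlim x : limn (hm^~ x) = h x.
  apply/cvg_lim => //; have [hoo|hoo] := eqVneq (h x) +oo%E.
    rewrite hoo; apply/cvgeyPge => A; near=> N.
    rewrite /hm hoo min_r ?leey// lee_fin; near: N.
    exact: nbhs_infty_ger.
  apply: cvg_near_cst; near=> N; rewrite /hm min_l//.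
  have hfin : h x \is a fin_num by rewrite ge0_fin_numE// ltey.
  rewrite -(fineK hfin) lee_fin; near: N; exact: nbhs_infty_ger.
have := @cvg_monotone_convergence _ _ _ lambda setT measurableT hm mhm
  (fun N x _ => hm0 N x) (fun x _ => hmnd x).
under eq_integral do rewrite hmlim.
move=> /(_ [set z | (b%:E < z)%E]) [].
  by apply: open_nbhs_nbhs; split => //; exact: open_ereal_gt_ereal.
move=> M _ /(_ M (leqnn M)) /= bM.
have iM : (\int[lambda]_x hm M x)%E \is a fin_num.
  rewrite ge0_fin_numE ?integral_ge0//.
  apply: (@le_lt_trans _ _ (\int[lambda]_x (cst (M%:R)%:E) x)%E).
    apply: ge0_le_integral => // x _; rewrite ?lee_fin//.
    by rewrite /hm ge_min lexx orbT.
  rewrite integral_cst// (@le_lt_trans _ _ ((M%:R)%:E * 1)%E) ?lee_wpmul2l ?lee_fin//.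
  by rewrite mule1 ltry.
pose c := fine (\int[lambda]_x hm M x)%E.
have bc : b < c by rewrite -lte_fin fineK.
(* Slicing costs [delta], the errors on the layers cost at most another [delta], and the third part
   keeps the inequality strict. *)
pose delta := (c - b) / 3; have d0 : 0 < delta by rewrite /delta; lra.
have [N HN] : exists N, M%:R <= N%:R * delta.
  exists (Num.truncn (M%:R / delta)).+1; rewrite -ler_pdivrMr//.
  exact/ltW/truncnS_gt.
pose G i := [set x : X | ((i.+1%:R * delta)%:E < h x)%E].
have mG i : measurable (G i : set (borel R n)) by apply: open_borel; exact: oh.
have Gh i x : G i x -> ((i.+1%:R * delta)%:E <= h x)%E by move=> /ltW.
have hG i x : ~ G i x -> (h x <= (i.+1%:R * delta)%:E)%E.
  by move=> /negP; rewrite -leNgt.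
(* With this error on each of the [N] layers of height [delta], the total error stays below
   [delta]. *)
have eta0 : 0 < N.+1%:R^-1 :> R by [].
have H : \forall k \near U, forall i : 'I_N,
    (lambda (G i) <= mu k (G i) + (N.+1%:R^-1)%:E)%E.
  by apply: filter_forall => i; apply: vague_limit_open => //; exact: oh.
apply: filterS H => k Hk.
have lsum : (c%:E <= (delta + delta)%:E + \int[mu k]_x h x)%E.
  rewrite fineK//; apply: (@le_trans _ _
      (\int[lambda]_x mine (h x) (N%:R * delta)%:E)%E).
    apply: ge0_le_integral => //; first exact: measurable_mine.
    by move=> x _; apply: le_min2 => //; rewrite lee_fin.
  apply: (le_trans (integral_le_sum_layer h0 mh d0 mG hG _ _)).
  rewrite EFinD -addeA; apply: leeD.
    by rewrite -[leRHS]mule1 lee_wpmul2l// lee_fin ltW.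
  apply: le_trans (leeD2l _ (sum_layer_le_integral h0 mh d0 mG Gh (mu k) N)).
  apply: (@le_trans _ _ (\sum_(i < N) (delta%:E * mu k (G i) +
      delta%:E * (N.+1%:R^-1)%:E))%E).
    apply: lee_sum => i _; rewrite -ge0_muleDr ?lee_fin//.
    by apply: lee_wpmul2l => //; rewrite lee_fin ltW.
  rewrite big_split/= addeC leeD2r// sumEFin -[leLHS]/(_%:E).
  rewrite lee_fin sumr_const card_ord -[_ *+ N]mulr_natr -mulrA ger_pMr//.
  by rewrite mulrC ler_pdivrMr// mul1r ler_nat.
have [->|ioo] := eqVneq (\int[mu k]_x h x)%E +oo%E; first by rewrite ltry.
have ifin : (\int[mu k]_x h x)%E \is a fin_num.
  by rewrite ge0_fin_numE ?ltey// integral_ge0.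
move: lsum; rewrite -(fineK ifin) -EFinD lee_fin lte_fin /delta; lra.
Unshelve. all: by end_near. Qed.

(** Masses can only grow in the limit on compact sets, hence the compact superlevel sets; the bound
    [M] leaves finitely many layers. The part of [h] below [delta] is paid for by the total mass
    one. *)
Lemma vague_limit_usc (h : borel R n -> \bar R) (b M : R) :
  (forall x, (0 <= h x <= M%:E)%E) -> measurable_fun setT h ->
  (forall c, 0 < c -> compact [set x : X | (c%:E <= h x)%E]) ->
  (\int[lambda]_x h x < b%:E)%E -> \forall k \near U, (\int[mu k]_x h x < b%:E)%E.
Proof.
move=> h0M mh ch hb.
have h0 x : (0 <= h x)%E by case/andP: (h0M x).
have ifin : (\int[lambda]_x h x)%E \is a fin_num.
  by rewrite ge0_fin_numE ?integral_ge0// (lt_trans hb)// ltry.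
pose c := fine (\int[lambda]_x h x)%E.
have bc : c < b by rewrite -lte_fin fineK.
pose delta := (b - c) / 3; have d0 : 0 < delta by rewrite /delta; lra.
have [N HN] : exists N, M <= N%:R * delta.
  exists (Num.truncn (M / delta)).+1; rewrite -ler_pdivrMr//.
  exact/ltW/truncnS_gt.
pose G i := [set x : X | ((i.+1%:R * delta)%:E <= h x)%E].
have cG i : compact (G i) by apply: ch; rewrite mulr_gt0.
have mG i : measurable (G i : set (borel R n)) by apply: compact_borel.
have Gh i x : G i x -> ((i.+1%:R * delta)%:E <= h x)%E by [].
have hG i x : ~ G i x -> (h x <= (i.+1%:R * delta)%:E)%E.
  by move=> /negP; rewrite -ltNge => /ltW.
have eta0 : 0 < N.+1%:R^-1 :> R by [].
have H : \forall k \near U, forall i : 'I_N,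
    (mu k (G i) <= lambda (G i) + (N.+1%:R^-1)%:E)%E.
  by apply: filter_forall => i; exact: vague_limit_compact.
apply: filterS H => k Hk.
apply: (@le_lt_trans _ _ ((delta + delta)%:E + c%:E)%E); last first.
  by rewrite -EFinD lte_fin /delta; lra.
rewrite fineK//; apply: (@le_trans _ _
    (\int[mu k]_x mine (h x) (N%:R * delta)%:E)%E).
  apply: ge0_le_integral => //; first exact: measurable_mine.
  move=> x _; rewrite le_min lexx/=; case/andP: (h0M x) => _ /le_trans; apply.
  by rewrite lee_fin.
apply: (le_trans (integral_le_sum_layer h0 mh d0 mG hG _ _)).
rewrite EFinD -addeA mu1 mule1; apply: leeD2l.
apply: le_trans (leeD2l _ (sum_layer_le_integral h0 mh d0 mG Gh lambda N)).
apply: (@le_trans _ _ (\sum_(i < N) (delta%:E * lambda (G i) +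
    delta%:E * (N.+1%:R^-1)%:E))%E).
  apply: lee_sum => i _; rewrite -ge0_muleDr ?lee_fin//.
  by apply: lee_wpmul2l => //; rewrite lee_fin ltW.
rewrite big_split/= addeC leeD2r// sumEFin -[leLHS]/(_%:E).
rewrite lee_fin sumr_const card_ord -[_ *+ N]mulr_natr -mulrA ger_pMr//.
by rewrite mulrC ler_pdivrMr// mul1r ler_nat.
Qed.

End semicontinuity.

(** * Gaussian and Riesz kernels *)

Section positive_definite.
Context d (T : measurableType d) (R : realType).
Local Notation smeasure := {sigma_finite_measure set T -> \bar R}.
Implicit Types mu nu : smeasure.
Local Open Scope ereal_scope.

Definition dbl (h : T -> T -> \bar R) (mu nu : {measure set T -> \bar R}) :=
  \int[mu]_x \int[nu]_y h x y.

(** Nonnegativity of the form at [mu - nu], with the mixed terms on the other side because the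
    integrals may be infinite. *)
Definition posdef (h : T -> T -> \bar R) := forall mu nu,
  dbl h mu nu + dbl h nu mu <= dbl h mu mu + dbl h nu nu.

Definition nnkernel (h : T -> T -> \bar R) :=
  measurable_fun setT (fun z : T * T => h z.1 z.2) /\ forall x y, 0 <= h x y.

Lemma nnkernel_measurable h x : nnkernel h -> measurable_fun setT (h x).
Proof. by move=> [mh _]; exact: (measurableT_comp mh (pair1_measurable x)). Qed.

Lemma nnkernel_int_measurable h nu : nnkernel h ->
  measurable_fun setT (fun x => \int[nu]_y h x y).
Proof.
move=> [mh h0].
exact: (measurable_fun_fubini_tonelli_F (m2 := nu) (fun z : T * T => h z.1 z.2)).
Qed.

Lemma dbl_ge0 h mu nu : nnkernel h -> 0 <= dbl h mu nu.
Proof. by move=> [_ h0]; apply: integral_ge0 => x _; exact: integral_ge0. Qed.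

Lemma dblC h mu nu : nnkernel h -> (forall x y, h x y = h y x) ->
  dbl h mu nu = dbl h nu mu.
Proof.
move=> [mh h0] hC; rewrite /dbl.
have := fubini_tonelli (m1 := mu) (m2 := nu) (fun z : T * T => h z.1 z.2) mh (fun z => h0 _ _).
move=> ->; apply: eq_integral => y _; apply: eq_integral => x _; exact: hC.
Qed.

Lemma dblD h h' mu nu : nnkernel h -> nnkernel h' ->
  dbl (fun x y => h x y + h' x y) mu nu = dbl h mu nu + dbl h' mu nu.
Proof.
move=> kh kh'; rewrite /dbl -ge0_integralD//.
- apply: eq_integral => x _; rewrite ge0_integralD//.
  + by move=> y _; exact: kh.2.
  + exact: nnkernel_measurable.
  + by move=> y _; exact: kh'.2.
  + exact: nnkernel_measurable.
- by move=> x _; apply: integral_ge0 => y _; exact: kh.2.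
- exact: nnkernel_int_measurable.
- by move=> x _; apply: integral_ge0 => y _; exact: kh'.2.
- exact: nnkernel_int_measurable.
Qed.

Lemma nnkernelD h h' : nnkernel h -> nnkernel h' ->
  nnkernel (fun x y => h x y + h' x y).
Proof.
move=> [mh h0] [mh' h'0]; split; first exact: emeasurable_funD.
by move=> x y; rewrite adde_ge0.
Qed.

Lemma posdefD h h' : nnkernel h -> nnkernel h' -> posdef h -> posdef h' ->
  posdef (fun x y => h x y + h' x y).
Proof.
move=> kh kh' ph ph' mu nu; rewrite !dblD//.
rewrite addeACA [leRHS]addeACA; apply: leeD; [exact: ph|exact: ph'].
Qed.

Lemma dbl_cvg (h : nat -> T -> T -> \bar R) mu nu :
  (forall N, nnkernel (h N)) ->
  (forall x y, {homo (fun N => h N x y) : N M / (N <= M)%N >-> N <= M}) ->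
  dbl (h N) mu nu @[N --> \oo] --> dbl (fun x y => limn (fun N => h N x y)) mu nu.
Proof.
move=> kh ndh; pose I N x := \int[nu]_y h N x y.
have -> : dbl (fun x y => limn (fun N => h N x y)) mu nu =
    \int[mu]_x limn (I^~ x).
  apply: eq_integral => x _; apply/esym/cvg_lim => //.
  apply: (@cvg_monotone_convergence _ _ _ nu setT measurableT (fun N => h N x)).
  - by move=> N; exact: nnkernel_measurable.
  - by move=> N y _; exact: (kh N).2.
  - by move=> y _; exact: ndh.
apply: (@cvg_monotone_convergence _ _ _ mu setT measurableT I).
- by move=> N; exact: nnkernel_int_measurable.
- by move=> N x _; apply: integral_ge0 => y _; exact: (kh N).2.
- move=> x _ N M NM; apply: ge0_le_integral => //.
  + by move=> y _; exact: (kh N).2.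
  + exact: nnkernel_measurable.
  + exact: nnkernel_measurable.
  + by move=> y _; exact: ndh.
Qed.

Lemma nnkernel_lim (h : nat -> T -> T -> \bar R) : (forall N, nnkernel (h N)) ->
  (forall x y, {homo (fun N => h N x y) : N M / (N <= M)%N >-> N <= M}) ->
  nnkernel (fun x y => limn (fun N => h N x y)).
Proof.
move=> kh ndh; split.
  apply: (emeasurable_fun_cvg (fun N (z : T * T) => h N z.1 z.2)).
    by move=> N; exact: (kh N).1.
  by move=> z _; apply: ereal_nondecreasing_is_cvgn; exact: ndh.
move=> x y; apply: lime_ge; first by apply: ereal_nondecreasing_is_cvgn; exact: ndh.
by apply: nearW => N; exact: (kh N).2.
Qed.

Lemma posdef_lim (h : nat -> T -> T -> \bar R) : (forall N, nnkernel (h N)) ->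
  (forall x y, {homo (fun N => h N x y) : N M / (N <= M)%N >-> N <= M}) ->
  (forall N, posdef (h N)) -> posdef (fun x y => limn (fun N => h N x y)).
Proof.
move=> kh ndh ph mu nu; have cv (m1 m2 : smeasure) := @dbl_cvg h m1 m2 kh ndh.
have kl := nnkernel_lim kh ndh.
have dc (m1 m2 m3 m4 : smeasure) : dbl (h N) m1 m2 + dbl (h N) m3 m4 @[N --> \oo] -->
   dbl (fun x y => limn (fun N => h N x y)) m1 m2 +
   dbl (fun x y => limn (fun N => h N x y)) m3 m4.
  apply: (cvgeD _ (cv m1 m2) (cv m3 m4)).
  by apply: ge0_adde_def; rewrite inE; exact: dbl_ge0.
have e1 := cvg_lim (@ereal_hausdorff R) (dc mu nu nu mu).
have e2 := cvg_lim (@ereal_hausdorff R) (dc mu mu nu nu).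
rewrite -e1 -e2; apply: lee_lim.
- by apply/cvg_ex; eexists; exact: dc.
- by apply/cvg_ex; eexists; exact: dc.
- by apply: nearW => N; exact: ph.
Qed.

Lemma amgm_ereal (a b : \bar R) : 0 <= a -> 0 <= b -> a * b + b * a <= a * a + b * b.
Proof.
move=> a0 b0; have [->|aoo] := eqVneq a +oo.
  by rewrite [+oo * +oo]mulyy addye ?leey// gt_eqF// (lt_le_trans _ (mule_ge0 b0 b0))// ltNyr.
have [->|boo] := eqVneq b +oo.
  by rewrite [+oo * +oo]mulyy addey ?leey// gt_eqF// (lt_le_trans _ (mule_ge0 a0 a0))// ltNyr.
have af : a \is a fin_num by rewrite ge0_fin_numE// ltey.
have bf : b \is a fin_num by rewrite ge0_fin_numE// ltey.
rewrite -(fineK af) -(fineK bf) -!EFinM -!EFinD lee_fin.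
by have := sqr_ge0 (fine a - fine b)%R; rewrite expr2; lra.
Qed.

Lemma posdef_rank1 (phi : T -> R) : measurable_fun setT phi ->
  (forall x, (0 <= phi x)%R) -> posdef (fun x y => (phi x * phi y)%:E).
Proof.
move=> mphi phi0 mu nu.
have mp : measurable_fun setT (EFin \o phi) by exact/measurable_EFinP.
have E m1 m2 : dbl (fun x y => (phi x * phi y)%:E) m1 m2 =
    (\int[m1]_x (phi x)%:E) * (\int[m2]_x (phi x)%:E).
  rewrite /dbl muleC -ge0_integralZl//; last 2 first.
    by move=> x _; rewrite lee_fin.
    by apply: integral_ge0 => x _; rewrite lee_fin.
  apply: eq_integral => x _; rewrite muleC -ge0_integralZl//; last 2 first.
  - by move=> y _; rewrite lee_fin.
  - by rewrite lee_fin.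
by rewrite !E amgm_ereal// integral_ge0// => x _; rewrite lee_fin.
Qed.

(* [sos] is closed under products (Schur), which makes the powers, and hence
   the exponential, of such kernels positive definite. *)
Inductive sos : (T -> T -> R) -> Prop :=
| sos0 : sos (fun _ _ => 0%R)
| sos_rank1 (phi : T -> R) : measurable_fun setT phi -> (forall x, (0 <= phi x)%R) ->
    sos (fun x y => (phi x * phi y)%R)
| sosD h h' : sos h -> sos h' -> sos (fun x y => (h x y + h' x y)%R).

Lemma sos_nnkernel h : sos h -> nnkernel (fun x y => (h x y)%:E).
Proof.
elim=> [|phi mphi phi0|f g _ kf _ kg]; first by split.
  split; last by move=> x y; rewrite lee_fin mulr_ge0.
  apply/measurable_EFinP; apply: measurable_funM.
    exact: (measurableT_comp mphi).
  exact: (measurableT_comp mphi).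
exact: (nnkernelD kf kg).
Qed.

Lemma sos_posdef h : sos h -> posdef (fun x y => (h x y)%:E).
Proof.
elim=> [mu nu|phi mphi phi0|f g sf pf sg pg]; last 2 first.
- exact: posdef_rank1.
- exact: (posdefD (sos_nnkernel sf) (sos_nnkernel sg) pf pg).
have Z (m1 m2 : smeasure) : dbl (fun _ _ => 0%:E) m1 m2 = 0.
  by rewrite /dbl integral0_eq// => x _; rewrite integral0.
by rewrite !Z.
Qed.

Lemma sosM h h' : sos h -> sos h' -> sos (fun x y => (h x y * h' x y)%R).
Proof.
move=> + sh'; elim=> [|phi mphi phi0|f g _ IHf _ IHg].
- by under eq2_fun do rewrite mul0r; exact: sos0.
- elim: sh' => [|psi mpsi psi0|f g _ IHf _ IHg].
  + by under eq2_fun do rewrite mulr0; exact: sos0.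
  + under eq2_fun do rewrite mulrACA.
    apply: (@sos_rank1 (fun x => (phi x * psi x)%R)).
      exact: measurable_funM.
    by move=> x; rewrite mulr_ge0.
  + by under eq2_fun do rewrite mulrDr; exact: sosD.
- by under eq2_fun do rewrite mulrDl; exact: sosD.
Qed.

Lemma sosZ (c : R) h : (0 <= c)%R -> sos h -> sos (fun x y => (c * h x y)%R).
Proof.
move=> c0; apply: sosM.
have -> : (fun _ _ : T => c) = (fun _ _ : T => (Num.sqrt c * Num.sqrt c)%R).
  by apply/funext => x; apply/funext => y; rewrite -expr2 sqr_sqrtr.
by apply: sos_rank1 => // x; exact: sqrtr_ge0.
Qed.

Lemma sos_sum I (s : seq I) (h : I -> T -> T -> R) : (forall i, sos (h i)) ->
  sos (fun x y => (\sum_(i <- s) h i x y)%R).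
Proof.
move=> sh; elim: s => [|i s IH].
  by under eq2_fun do rewrite big_nil; exact: sos0.
by under eq2_fun do rewrite big_cons; exact: sosD.
Qed.

Lemma sosX h k : sos h -> sos (fun x y => (h x y ^+ k)%R).
Proof.
move=> sh; elim: k => [|k IH].
  have -> : (fun x y => (h x y ^+ 0)%R) = (fun _ _ : T => (1 * 1)%R : R).
    by apply/funext => x; apply/funext => y; rewrite expr0 mulr1.
  exact: (@sos_rank1 (cst 1%R)).
by under eq2_fun do rewrite exprS; exact: sosM.
Qed.

End positive_definite.

Section gaussian_kernel.
Context {R : realType} {n : nat}.
Local Notation T := (borel R n).
Implicit Types x y : 'rV[R]_n.

Lemma continuous_borel (f : 'rV[R]_n -> R) : continuous f ->
  measurable_fun setT (f : T -> R).
Proof.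
move=> cf; apply/measurable_EFinP; apply: lsc_measurable => c.
rewrite (_ : [set x | _] = f @^-1` [set r | c < r]); last first.
  by apply/seteqP; split => x /=; rewrite lte_fin.
by apply: open_comp => [x _|]; [exact: cf|exact: open_gt].
Qed.

Lemma measurable_coord i : measurable_fun setT (fun x : T => (x : 'rV[R]_n) ord0 i).
Proof. by apply: (@continuous_borel (fun x => x ord0 i)); exact: coord_continuous. Qed.

Definition d2 x y : R := \sum_i (x ord0 i - y ord0 i) ^+ 2.

Lemma d2C x y : d2 x y = d2 y x.
Proof. by apply: eq_bigr => i _; rewrite -sqrrN opprB. Qed.

Lemma d2_ge0 x y : 0 <= d2 x y.
Proof. by apply: sumr_ge0 => i _; exact: sqr_ge0. Qed.

Lemma measurable_d2 : measurable_fun setT (fun z : T * T => d2 z.1 z.2).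
Proof.
apply: measurable_sum => i; apply: measurable_funX; apply: measurable_funB.
- exact: (measurableT_comp (measurable_coord i)).
- exact: (measurableT_comp (measurable_coord i)).
Qed.

Definition gauss (t : R) x y : R := expR (- (t * d2 x y)).

Lemma gaussC t x y : gauss t x y = gauss t y x.
Proof. by rewrite /gauss d2C. Qed.

Lemma gauss_nnkernel t : nnkernel (T := T) (fun x y => (gauss t x y)%:E).
Proof.
split; last by move=> x y; rewrite lee_fin expR_ge0.
apply/measurable_EFinP; apply: measurableT_comp => //.
by apply: measurableT_comp => //; apply: measurable_funM => //; exact: measurable_d2.
Qed.

Section approximation.
Variable t : R.
Hypothesis t0 : 0 <= t.

(** Shifting every coordinate by [m] leaves distances unchanged and makes the coordinates
    nonnegative on the orthant [B m]. The Gaussian is then the product of a function of x, the same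
    function of y and the exponential of 2t times a scalar product with nonnegative entries, whose
    Taylor polynomials are of the form [sos]. *)
Let B (m : nat) : set 'rV[R]_n := [set x | forall i, 0 <= x ord0 i + m%:R].

Let mB m : measurable (B m : set T).
Proof.
apply: closed_borel.
rewrite (_ : B m = \bigcap_(i in setT)
    ((fun x : 'rV[R]_n => x ord0 i) @^-1` [set r | - m%:R <= r])); last first.
  apply/seteqP; split => [x Bx i _|x Bx i]; first by rewrite /= -subr_ge0 opprK; exact: Bx.
  by have := Bx i I; rewrite /= -subr_ge0 opprK.
apply: closed_bigI => i _; apply: closed_comp => [x _|]; last exact: closed_ge.
exact: coord_continuous.
Qed.

Let u m i x : R := Num.max 0 (x ord0 i + m%:R).

Let w m x : R := \1_(B m) x * expR (- (t * \sum_i (x ord0 i + m%:R) ^+ 2)).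

Let z m x y : R := 2 * t * \sum_i u m i x * u m i y.

Let z_ge0 m x y : 0 <= z m x y.
Proof.
rewrite /z mulr_ge0 ?mulr_ge0// sumr_ge0// => i _.
by rewrite mulr_ge0// le_max lexx.
Qed.

Let w_ge0 m x : 0 <= w m x.
Proof. by rewrite mulr_ge0// expR_ge0. Qed.

Let h m N x y : R := w m x * w m y * series (exp_coeff (z m x y)) N.

Let mu_ m i : measurable_fun setT (u m i : T -> R).
Proof.
apply: measurable_maxr => //; apply: measurable_funD => //.
exact: measurable_coord.
Qed.

Let mw m : measurable_fun setT (w m : T -> R).
Proof.
apply: measurable_funM; first exact: measurable_indic.
apply: measurableT_comp => //; apply: measurableT_comp => //.
apply: measurable_funM => //; apply: measurable_sum => i.
apply: measurable_funX; apply: measurable_funD => //.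
exact: measurable_coord.
Qed.

Let sos_h m N : sos (T := T) (h m N).
Proof.
apply: sosM; first by apply: sos_rank1 => //; exact: mw.
rewrite /series/= /exp_coeff/=; under eq2_fun do under eq_bigr do rewrite mulrC.
apply: sos_sum => k; apply: sosZ; first by rewrite invr_ge0.
apply: sosX; apply: sosZ; first by rewrite mulr_ge0.
by apply: sos_sum => i; apply: sos_rank1 => // x; rewrite le_max lexx.
Qed.

Let h_lim m x y : limn (fun N => (h m N x y)%:E) =
  (\1_(B m) x * \1_(B m) y * gauss t x y)%:E.
Proof.
apply/cvg_lim => //; apply/cvg_EFin; first by apply: nearW.
rewrite (_ : _ * _ * _ = w m x * w m y * expR (z m x y)).
  by apply: cvgMr; exact: is_cvg_series_exp_coeff.
rewrite /w mulrACA -[RHS]mulrA -!expRD.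
have [Bx|nBx] := pselect (B m x); last by rewrite !(indicE, memNset nBx) !mul0r.
have [By|nBy] := pselect (B m y); last by rewrite !(indicE, memNset nBy) !(mulr0, mul0r).
congr (_ * expR _); rewrite /z.
have -> : \sum_i u m i x * u m i y = \sum_i (x ord0 i + m%:R) * (y ord0 i + m%:R).
  by apply: eq_bigr => i _; rewrite /u !max_r.
have -> : d2 x y = \sum_i (x ord0 i + m%:R) ^+ 2 + \sum_i (y ord0 i + m%:R) ^+ 2
    - 2 * \sum_i (x ord0 i + m%:R) * (y ord0 i + m%:R).
  rewrite mulr_sumr -sumrN -!big_split/=.
  by apply: eq_bigr => i _; ring.
ring.
Qed.

Let hnd m x y : {homo (fun N => (h m N x y)%:E) : N M / (N <= M)%N >-> (N <= M)%E}.
Proof.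
move=> N M NM; rewrite lee_fin ler_wpM2l ?mulr_ge0//.
apply: nondecreasing_series => // k _ _; exact: exp_coeff_ge0.
Qed.

(** Two monotone limits: the partial sums of the exponential series, then the orthants [B m] growing
    to the whole space. *)
Lemma gauss_posdef : posdef (T := T) (fun x y => (gauss t x y)%:E).
Proof.
pose g m x y : \bar R := (\1_(B m) x * \1_(B m) y * gauss t x y)%:E.
have hk m N : nnkernel (T := T) (fun x y => (h m N x y)%:E) by exact: sos_nnkernel.
have gE m : g m = fun x y => limn (fun N => (h m N x y)%:E).
  by apply/funext => x; apply/funext => y; rewrite h_lim.
have gk m : nnkernel (T := T) (g m) by rewrite gE; exact: nnkernel_lim.
have gp m : posdef (T := T) (g m).
  by rewrite gE; apply: posdef_lim => // N; exact: sos_posdef.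
have Bnd x m M : (m <= M)%N -> \1_(B m) x <= \1_(B M) x :> R.
  move=> mM; rewrite !indicE; have [Bx|nBx] := pselect (B m x).
    rewrite !mem_set// => i; apply: (le_trans (Bx i)).
    by rewrite lerD2l ler_nat.
  by rewrite (memNset nBx).
have gnd x y : {homo (fun m => g m x y) : m M / (m <= M)%N >-> (m <= M)%E}.
  move=> m M mM; rewrite lee_fin ler_wpM2r ?expR_ge0// ler_pM//.
  - exact: Bnd.
  - exact: Bnd.
rewrite (_ : (fun x y => _) = fun x y => limn (fun m => g m x y)).
  exact: posdef_lim.
apply/funext => x; apply/funext => y; apply/esym/cvg_lim => //.
have B1 x' : \forall m \near \oo, \1_(B m) x' = 1 :> R.
  have : \forall m \near \oo, forall i : 'I_n, 0 <= x' ord0 i + m%:R.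
    apply: filter_forall => i; near=> m.
    rewrite -lerBlDl sub0r; near: m; exact: nbhs_infty_ger.
  by apply: filterS => m Bm; rewrite indicE mem_set.
apply: cvg_near_cst; near=> m; rewrite /g.
have -> : \1_(B m) x = 1 :> R by near: m; exact: B1.
have -> : \1_(B m) y = 1 :> R by near: m; exact: B1.
by rewrite !mul1r.
Unshelve. all: by end_near. Qed.

End approximation.
End gaussian_kernel.

Section gaussian_mixture.
Context {R : realType} {n : nat}.
Local Notation T := (borel R n).
Local Notation leb := (@lebesgue_measure R).
Local Notation smeasure := {sigma_finite_measure set T -> \bar R}.
Implicit Types (rho : R -> R) (mu nu : smeasure).
Local Open Scope ereal_scope.

Definition gker rho (x y : T) : \bar R :=
  \int[leb]_v (rho v * gauss (expR v) x y)%:E.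

Definition weight rho := measurable_fun setT rho /\ forall v, (0 <= rho v)%R.

Let mix rho (z : T * T) (v : R) : \bar R := (rho v * gauss (expR v) z.1 z.2)%:E.

Let mix_ge0 rho z v : weight rho -> 0 <= mix rho z v.
Proof. by move=> [_ r0]; rewrite lee_fin mulr_ge0// expR_ge0. Qed.

Let measurable_mix rho : weight rho ->
  measurable_fun setT (fun zv : (T * T) * R => mix rho zv.1 zv.2).
Proof.
move=> [mr _]; apply/measurable_EFinP; apply: measurable_funM.
  exact: (measurableT_comp mr).
apply: measurableT_comp => //; apply: measurableT_comp => //.
apply: measurable_funM.
  exact: (measurableT_comp (@measurable_expR R)).
exact: (measurableT_comp (@measurable_d2 R n)).
Qed.

Lemma gker_nnkernel rho : weight rho -> nnkernel (T := T) (gker rho).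
Proof.
move=> wr; split; last by move=> x y; apply: integral_ge0 => v _; exact: (mix_ge0 (x, y)).
exact: (measurable_fun_fubini_tonelli_F (m2 := leb)
  (fun zv : (T * T) * R => mix rho zv.1 zv.2) (measurable_mix wr)
  (fun zv => mix_ge0 _ _ wr)).
Qed.

Lemma gkerC rho x y : gker rho x y = gker rho y x.
Proof. by apply: eq_integral => v _; rewrite gaussC. Qed.

Let inner rho nu (z : T * R) := \int[nu]_y mix rho (z.1, y) z.2.

Let measurable_inner rho nu : weight rho -> measurable_fun setT (inner rho nu).
Proof.
move=> wr.
apply: (measurable_fun_fubini_tonelli_F (m2 := nu)
  (fun zy : (T * R) * T => mix rho (zy.1.1, zy.2) zy.1.2)).
  apply: (measurableT_comp (measurable_mix wr)
    (g := fun zy : (T * R) * T => ((zy.1.1, zy.2), zy.1.2))).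
  apply: measurable_fun_pair; last exact: (measurableT_comp measurable_snd measurable_fst).
  apply: measurable_fun_pair; last exact: measurable_snd.
  exact: (measurableT_comp measurable_fst measurable_fst).
by move=> zy; exact: mix_ge0.
Qed.

Let innerE rho nu x v : weight rho ->
  inner rho nu (x, v) = (rho v)%:E * \int[nu]_y (gauss (expR v) x y)%:E.
Proof.
move=> [mr r0]; rewrite /inner/= /mix/= -ge0_integralZl//.
- exact: (nnkernel_measurable x (gauss_nnkernel (expR v))).
- by move=> y _; rewrite lee_fin expR_ge0.
- by rewrite lee_fin.
Qed.

Let outerE rho mu nu v : weight rho ->
  \int[mu]_x inner rho nu (x, v) =
  (rho v)%:E * dbl (fun x y : T => (gauss (expR v) x y)%:E) mu nu.
Proof.
move=> wr; under eq_integral do rewrite innerE//.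
rewrite ge0_integralZl//.
- exact: (nnkernel_int_measurable nu (gauss_nnkernel (expR v))).
- by move=> x _; apply: integral_ge0 => y _; rewrite lee_fin expR_ge0.
- by rewrite lee_fin; exact: wr.2.
Qed.

Lemma dbl_gker rho mu nu : weight rho -> dbl (gker rho) mu nu =
  \int[leb]_v ((rho v)%:E * dbl (fun x y : T => (gauss (expR v) x y)%:E) mu nu).
Proof.
move=> wr.
have -> : dbl (gker rho) mu nu = \int[mu]_x \int[leb]_v inner rho nu (x, v).
  apply: eq_integral => x _.
  apply: (fubini_tonelli (m1 := nu) (m2 := leb)
    (fun yv : T * R => mix rho (x, yv.1) yv.2)).
    apply: (measurableT_comp (measurable_mix wr)
    (g := fun yv : T * R => ((x, yv.1), yv.2))).
    apply: measurable_fun_pair; last exact: measurable_snd.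
    by apply: measurable_fun_pair; [exact: measurable_cst|exact: measurable_fst].
  by move=> z; exact: mix_ge0.
rewrite (fubini_tonelli (m1 := mu) (m2 := leb)); last 2 first.
- exact: measurable_inner.
- by move=> z; apply: integral_ge0 => y _; exact: mix_ge0.
by apply: eq_integral => v _; rewrite outerE.
Qed.

Lemma measurable_dbl_gauss mu nu : measurable_fun setT
  (fun v => dbl (fun x y : T => (gauss (expR v) x y)%:E) mu nu).
Proof.
have w1 : weight (fun=> 1%R) by split.
have -> : (fun v => dbl (fun x y : T => (gauss (expR v) x y)%:E) mu nu) =
    fun v => \int[mu]_x inner (fun=> 1%R) nu (x, v).
  by apply/funext => v; rewrite outerE// mul1e.
apply: (measurable_fun_fubini_tonelli_G (m1 := mu)).
  exact: measurable_inner.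
by move=> z; apply: integral_ge0 => y _; exact: mix_ge0.
Qed.

Lemma dbl_gauss_ge0 t mu nu : 0 <= dbl (fun x y : T => (gauss t x y)%:E) mu nu.
Proof. exact: (dbl_ge0 _ _ (gauss_nnkernel t)). Qed.

Lemma measurable_weight_dbl rho mu nu : weight rho -> measurable_fun setT
  (fun v => (rho v)%:E * dbl (fun x y : T => (gauss (expR v) x y)%:E) mu nu).
Proof.
move=> [mr _]; apply: emeasurable_funM; first exact/measurable_EFinP.
exact: measurable_dbl_gauss.
Qed.

Let eq_le2 (a b c e : \bar R) : a = b -> c = e -> b <= e -> a <= c.
Proof. by move=> -> ->. Qed.

Lemma gker_posdef rho : weight rho -> posdef (T := T) (gker rho).
Proof.
move=> wr mu nu.
pose G (m1 m2 : smeasure) v := (rho v)%:E * dbl (fun x y : T => (gauss (expR v) x y)%:E) m1 m2.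
have g0 (m1 m2 : smeasure) v : 0 <= G m1 m2 v.
  by rewrite mule_ge0 ?dbl_gauss_ge0// lee_fin; exact: wr.2.
have mG (m1 m2 : smeasure) : measurable_fun setT (G m1 m2) by exact: measurable_weight_dbl.
have D (m1 m2 m3 m4 : smeasure) : dbl (gker rho) m1 m2 + dbl (gker rho) m3 m4 =
    \int[leb]_v (G m1 m2 v + G m3 m4 v).
  rewrite (dbl_gker m1 m2 wr) (dbl_gker m3 m4 wr) -/(G m1 m2) -/(G m3 m4).
  by rewrite ge0_integralD//; [exact: mG|exact: mG].
apply: (eq_le2 (D mu nu nu mu) (D mu mu nu nu)).
apply: ge0_le_integral => //.
- by move=> v _; rewrite adde_ge0.
- by apply: emeasurable_funD; exact: mG.
- by apply: emeasurable_funD; exact: mG.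
move=> v _; rewrite /G -!ge0_muleDr ?dbl_gauss_ge0//.
apply: lee_wpmul2l; first by rewrite lee_fin; exact: wr.2.
by apply: gauss_posdef; exact: expR_ge0.
Qed.

Lemma gkerD rho rho' x y : weight rho -> weight rho' ->
  gker (fun v => rho v + rho' v)%R x y = gker rho x y + gker rho' x y.
Proof.
move=> wr wr'; rewrite /gker -ge0_integralD//.
- by apply: eq_integral => v _; rewrite mulrDl EFinD.
- by move=> v _; exact: (mix_ge0 (x, y) v wr).
- exact: (measurableT_comp (measurable_mix wr) (pair1_measurable (x, y))).
- by move=> v _; exact: (mix_ge0 (x, y) v wr').
- exact: (measurableT_comp (measurable_mix wr') (pair1_measurable (x, y))).
Qed.

End gaussian_mixture.

Section sequential.
Context {R : realType} {n : nat}.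
Local Notation X := 'rV[R]_n.

Lemma closed_seq (F : set X) : (forall (u : nat -> X) x, (forall i, F (u i)) ->
  u @ \oo --> x -> F x) -> closed F.
Proof.
move=> H x clFx.
have /choice[u Hu] i : exists y, F y /\ ball x (i.+1%:R^-1) y.
  by apply: clFx; apply: nbhsx_ballx.
apply: (H u) => [i|]; first by case: (Hu i).
apply/cvg_ballP => e e0; near=> i.
have [_ /= B] := Hu i; apply: le_ball B.
by apply: ltW; near: i; exact: (near_infty_natSinv_lt (PosNum e0)).
Unshelve. all: by end_near. Qed.

Context d (T : measurableType d).

Lemma lte_between (x y : \bar R) : (x < y)%E -> exists z : R, (x < z%:E < y)%E.
Proof.
case: x y => [x| |] [y| |]//= xy.
- by exists ((x + y) / 2); move: xy; rewrite !lte_fin => xy; apply/andP; split; lra.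
- by exists (x + 1); rewrite ltry andbT lte_fin ltrDl ltr01.
- by exists (y - 1); rewrite ltNyr lte_fin gtrBl ltr01.
- by exists 0; rewrite ltNyr ltry.
Qed.

(** The complement is sequentially closed by Fatou's lemma, the integrand being lower semicontinuous
    in [x] for each [y]. *)
Lemma lsc_integral (mu : {measure set T -> \bar R}) (phi : X -> T -> \bar R) :
  (forall x y, (0 <= phi x y)%E) ->
  (forall x, measurable_fun setT (phi x)) ->
  (forall c y, open [set x | (c%:E < phi x y)%E]) ->
  forall c, open [set x | (c%:E < \int[mu]_y phi x y)%E].
Proof.
move=> p0 mp op c; rewrite -[X in open X]setCK; apply: closed_openC.
apply: closed_seq => u x Hu ux /= H; rewrite ltNge in H; move: H => /negP; apply.
have {}Hu i : (\int[mu]_y phi (u i) y <= c%:E)%E.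
  by have /= := Hu i => /negP; rewrite -leNgt.
apply: (@le_trans _ _ (\int[mu]_y limn_einf (fun i => phi (u i) y))%E).
  apply: ge0_le_integral => //.
  - apply: (emeasurable_fun_cvg (fun N y => einfs (fun i => phi (u i) y) N)).
      by move=> N; apply: measurable_fun_einfs => i; exact: mp.
    by move=> y _; rewrite limn_einf_lim; exact: is_cvg_einfs.
  move=> y _; rewrite limn_einf_lim.
  rewrite leNgt; apply/negP => lt.
  have [z /andP[z1 z2]] : exists z : R, (limn (einfs (fun i => phi (u i) y)) < z%:E < phi x y)%E.
    exact: lte_between.
  have : \forall i \near \oo, (z%:E < phi (u i) y)%E.
    apply: (ux [set x' | (z%:E < phi x' y)%E]).
    by apply: open_nbhs_nbhs; split => //; exact: op.
  move=> [N _ HN].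
  have : (z%:E <= einfs (fun i => phi (u i) y) N)%E.
    by apply: le_ereal_inf_tmp => _ [k /= Nk <-]; apply: ltW; exact: HN.
  apply/negP; rewrite -ltNge; apply: le_lt_trans z1.
  rewrite (cvg_lim _ (@cvg_einfs_sup _ _))//.
  by apply: ereal_sup_ubound; exists N.
apply: (le_trans (fatou mu measurableT (fun i => mp (u i)) (fun i y _ => p0 (u i) y))).
rewrite limn_einf_lim; apply: lime_le; first exact: is_cvg_einfs.
apply: nearW => N; apply: (le_trans _ (Hu N)).
by apply: ereal_inf_lbound; exists N => /=.
Qed.

End sequential.

Section riesz_mixture.
Context {R : realType}.
Local Notation leb := (@lebesgue_measure R).
Variable a : R.
Hypothesis a0 : 0 < a.
Local Open Scope ereal_scope.

Let G (v : R) : R := expR (a * v - expR v).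

Let G0 v : (0 <= G v)%R. Proof. exact: expR_ge0. Qed.

Let cG : continuous G.
Proof.
move=> v; apply: continuous_comp; last exact: continuous_expR.
apply: cvgB; last exact: continuous_expR.
by apply: cvgM; [exact: cvg_cst|exact: cvg_id].
Qed.

Let mG (D : set R) : measurable_fun D (EFin \o G).
Proof.
apply/measurable_EFinP; apply: measurable_funTS.
exact: continuous_measurable_fun.
Qed.

Let int_pos : \int[leb]_(v in `[0%R, +oo[) (G v)%:E < +oo.
Proof.
(* At [c] the exponential has slope [a + 1]; its tangent line there bounds [expR v] from below and
   leaves [a * v - expR v] at most [- v] plus the constant in [K]. *)
pose c := ln (a + 1); have a1 : (0 < a + 1)%R by rewrite addr_gt0.
pose K := expR ((a + 1) * (c - 1)).
apply: (@le_lt_trans _ _ (\int[leb]_v (K%:E * (exponential_pdf 1 v)%:E))).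
  rewrite [leLHS]integral_mkcond; apply: ge0_le_integral => //.
  - by move=> v _; rewrite patchE; case: ifP => // _; rewrite lee_fin.
  - by apply/(measurable_restrictT (fun v => (G v)%:E) (measurable_itv `[0%R, +oo[)); exact: mG.
  - apply: measurable_funeM; apply/measurable_EFinP.
    exact: measurable_exponential_pdf.
  move=> v _; rewrite patchE; case: ifPn => [|_]; last first.
    by rewrite -EFinM lee_fin mulr_ge0 ?expR_ge0// exponential_pdf_ge0.
  rewrite inE/= in_itv/= andbT => v0.
  rewrite exponential_pdfE// mul1r mulN1r -EFinM -expRD lee_fin ler_expR.
  have := expR_ge1Dx (v - c); rewrite expRD expRN /c lnK ?posrE//.
  rewrite ler_pdivlMr// => H; move: H; rewrite -/c => H; lra.
rewrite ge0_integralZl ?lee_fin ?expR_ge0//.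
- by rewrite integral_exponential_pdf// mule1 ltry.
- by apply/measurable_EFinP; exact: measurable_exponential_pdf.
- by move=> v _; rewrite lee_fin exponential_pdf_ge0.
Qed.

Let int_neg : \int[leb]_(v in `]-oo, 0%R]) (G v)%:E < +oo.
Proof.
rewrite -[X in `]-oo, X]]oppr0 ge0_integration_by_substitutionNy; last 2 first.
- exact: continuous_subspaceT.
- by [].
apply: (@le_lt_trans _ _ (\int[leb]_v (a^-1%:E * (exponential_pdf a v)%:E))).
  rewrite [leLHS]integral_mkcond; apply: ge0_le_integral => //.
  - by move=> v _; rewrite patchE; case: ifP => // _; rewrite lee_fin; exact: G0.
  - apply/(measurable_restrictT (fun v => ((G \o -%R) v)%:E) (measurable_itv `[0%R, +oo[)).
    apply/measurable_EFinP; apply: measurable_funTS; apply: continuous_measurable_fun => v.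
    by apply: continuous_comp; [exact: oppr_continuous|exact: cG].
  - apply: measurable_funeM; apply/measurable_EFinP.
    exact: measurable_exponential_pdf.
  move=> v _; rewrite patchE; case: ifPn => [|_]; last first.
    by rewrite -EFinM lee_fin mulr_ge0 ?invr_ge0 ?(ltW a0)// exponential_pdf_ge0// ltW.
  rewrite inE/= in_itv/= andbT => v0.
  rewrite exponential_pdfE// -EFinM mulrA mulVf ?gt_eqF// mul1r.
  rewrite lee_fin /G/= ler_expR mulrN mulNr gerDl oppr_le0 expR_ge0//.
rewrite ge0_integralZl ?lee_fin ?invr_ge0 ?(ltW a0)//.
- by rewrite integral_exponential_pdf// mule1 ltry.
- by apply/measurable_EFinP; exact: measurable_exponential_pdf.
- by move=> v _; rewrite lee_fin exponential_pdf_ge0// ltW.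
Qed.

(** This is Gamma(a), written in the variable v = ln t. *)
Definition riesz_cst : R := fine (\int[leb]_v (G v)%:E).

Let int_lty : \int[leb]_v (G v)%:E < +oo.
Proof.
have -> : [set: R] = `]-oo, 0%R]%classic `|` `]0%R, +oo[%classic.
  by apply/seteqP; split => // v _; rewrite /= !in_itv/= andbT; case: (leP v 0%R); [left|right].
rewrite ge0_integral_setU//=.
- apply: lte_add_pinfty => //; apply: le_lt_trans int_pos.
  apply: ge0_subset_integral => //; first exact: mG.
    by move=> v _; rewrite lee_fin.
  by apply: subset_itvr; rewrite bnd_simp.
- exact: mG.
- by move=> v _; rewrite lee_fin.
- rewrite disj_set2E; apply/eqP; rewrite -subset0 => v /= [].
  by rewrite !in_itv/= andbT => /le_lt_trans /[apply]; rewrite ltxx.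
Qed.

Lemma riesz_cst_gt0 : (0 < riesz_cst)%R.
Proof.
rewrite fine_gt0// int_lty andbT.
apply: (@lt_le_trans _ _ (\int[leb]_(v in `[0%R, 1%R]) (expR (- expR 1))%:E)).
  by rewrite integral_cst//= lebesgue_measure_itv/= lte_fin ltr01 oppr0 adde0 mule1
    lte_fin expR_gt0.
rewrite [leLHS]integral_mkcond; apply: ge0_le_integral => //.
- by move=> v _; rewrite patchE; case: ifP => // _; rewrite lee_fin expR_ge0.
- by apply/(measurable_restrictT (cst (expR (- expR 1))%:E) (measurable_itv `[0%R, 1%R]));
    exact: measurable_cst.
- exact: mG.
move=> v _; rewrite patchE; case: ifPn => [|_]; last by rewrite lee_fin.
rewrite inE/= in_itv/= => /andP[v0 v1]; rewrite lee_fin ler_expR.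
rewrite -[leLHS]add0r lerD ?mulr_ge0 ?(ltW a0)// lerN2 ler_expR//.
Qed.

Lemma riesz_cstE : \int[leb]_v (G v)%:E = riesz_cst%:E.
Proof. by rewrite fineK// ge0_fin_numE// integral_ge0// => v _; rewrite lee_fin. Qed.

Definition riesz_weight (v : R) : R := (riesz_cst^-1 * expR (a * v))%R.

Lemma riesz_weight_ge0 v : (0 <= riesz_weight v)%R.
Proof. by rewrite mulr_ge0 ?expR_ge0// invr_ge0 ltW// riesz_cst_gt0. Qed.

Lemma continuous_riesz_weight : continuous riesz_weight.
Proof.
move=> v; apply: cvgM; first exact: cvg_cst.
apply: continuous_comp; last exact: continuous_expR.
by apply: cvgM; [exact: cvg_cst|exact: cvg_id].
Qed.

Lemma weight_riesz : weight riesz_weight.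
Proof.
split; last exact: riesz_weight_ge0.
by apply: continuous_measurable_fun; exact: continuous_riesz_weight.
Qed.

(** Translating v by [ln D] turns e^v D into e^v and releases the factor D^(-a); the remaining
    integral is [riesz_cst]. *)
Lemma riesz_mixture D : (0 < D)%R ->
  \int[leb]_v (riesz_weight v * expR (- (expR v * D)))%:E = (expR (- (a * ln D)))%:E.
Proof.
move=> D0.
have dF : (fun v : R => v + ln D)%R^`()%classic = cst 1%R.
  apply/funext => v; rewrite derive1E deriveD//.
  by rewrite derive_id derive_cst addr0.
have := @increasing_ge0_integration_by_substitutionT R (fun v => v + ln D)%R G.
rewrite dF => H.
have E : (\int[leb]_v (G v)%:E = \int[leb]_v ((G \o (fun v => v + ln D)%R) v)%:E).
  rewrite H//.
  - by apply: eq_integral => v _; rewrite /= mulr1.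
  - by move=> u v uv; rewrite ltrD2r.
  - by move=> v; exact: cvg_cst.
  - exact: is_cvg_cst.
  - exact: is_cvg_cst.
  - exact: cvg_addrr_Ny.
  - exact: cvg_addrr.
have cN : riesz_cst != 0%R by apply: lt0r_neq0; exact: riesz_cst_gt0.
transitivity (\int[leb]_v ((riesz_cst^-1 * expR (- (a * ln D)))%:E *
    ((G \o (fun v => v + ln D)%R) v)%:E)).
  apply: eq_integral => v _; rewrite -EFinM; congr EFin.
  rewrite /riesz_weight /G/= -!mulrA; congr (_ * _)%R.
  rewrite -!expRD; congr expR.
  have -> : expR (v + ln D) = (expR v * D)%R by rewrite expRD lnK// posrE.
  rewrite mulrDr; move: (a * v)%R (a * ln D)%R (expR v * D)%R => q p r; ring.
rewrite ge0_integralZl; last 4 first.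
- exact: measurableT.
- apply/measurable_EFinP; apply: continuous_measurable_fun => v.
  apply: continuous_comp; last exact: cG.
  by apply: cvgD; [exact: cvg_id|exact: cvg_cst].
- by move=> v _; rewrite lee_fin; exact: G0.
- rewrite lee_fin; apply: mulr_ge0; last exact: expR_ge0.
  by rewrite invr_ge0; apply: ltW; exact: riesz_cst_gt0.
by rewrite -E riesz_cstE -EFinM mulrAC (mulVf cN) mul1r.
Qed.

(** On the diagonal the Gaussian is 1 and the mixture reduces to this integral, in agreement with
    the value [+oo] of [riesz_kernel] there. *)
Lemma riesz_weight_int : \int[leb]_v (riesz_weight v)%:E = +oo.
Proof.
apply/eqP; rewrite -leye_eq.
apply: (@le_trans _ _ (\int[leb]_(v in `[0%R, +oo[) (riesz_cst^-1)%:E)).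
  rewrite integral_cst//= lebesgue_measure_itv/= ltry addye//.
  by rewrite gt0_muley// lte_fin invr_gt0 riesz_cst_gt0.
apply: (@le_trans _ _ (\int[leb]_(v in `[0%R, +oo[) (riesz_weight v)%:E)).
  apply: ge0_le_integral => //.
  - by move=> v _; rewrite lee_fin invr_ge0 ltW// riesz_cst_gt0.
  - by apply/measurable_EFinP; apply: measurable_funTS; exact: weight_riesz.1.
  move=> v /=; rewrite in_itv/= andbT lee_fin => v0.
  rewrite ler_peMr ?invr_ge0 ?(ltW riesz_cst_gt0)//.
  by rewrite -expR0 ler_expR mulr_ge0// ltW.
apply: ge0_subset_integral => //.
- by apply/measurable_EFinP; exact: weight_riesz.1.
- by move=> v _; rewrite lee_fin riesz_weight_ge0.
Qed.

End riesz_mixture.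

Section truncated_kernel.
Context {R : realType} {n : nat}.
Local Notation T := (borel R n).
Local Notation X := 'rV[R]_n.
Local Notation leb := (@lebesgue_measure R).
Local Notation smeasure := {sigma_finite_measure set T -> \bar R}.
Local Open Scope ereal_scope.

Lemma continuous_coordB (y : X) i : continuous (fun x : X => x ord0 i - y ord0 i)%R.
Proof.
have c : continuous (fun x : X => x ord0 i) by exact: coord_continuous.
by move=> x; exact: (cvgB (c x) (cvg_cst _)).
Qed.

Lemma continuous_d2 (y : X) : continuous (d2^~ y).
Proof.
rewrite /d2; apply: continuous_big => [|i _]; first exact: add_continuous.
move=> x; rewrite /continuous_at expr2; under eq_cvg do rewrite expr2.
by have c := @continuous_coordB y i x; exact: (cvgM c c).
Qed.

Lemma continuous_gauss t (y : X) : continuous (gauss t ^~ y).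
Proof.
move=> x; apply: continuous_comp; last exact: continuous_expR.
exact: (cvgN (cvgM (cvg_cst t) (@continuous_d2 y x))).
Qed.

Lemma gauss_le1 t (x y : X) : (0 <= t)%R -> (gauss t x y <= 1)%R.
Proof. by move=> t0; rewrite -expR0 ler_expR oppr_le0 mulr_ge0// d2_ge0. Qed.

Lemma enorm_sqrt (x y : X) : enorm (x - y) = Num.sqrt (d2 x y).
Proof. by rewrite /enorm /d2; under eq_bigr do rewrite !mxE. Qed.

Lemma d2_gt0 (x y : X) : x != y -> (0 < d2 x y)%R.
Proof.
move=> xy; rewrite lt_neqAle d2_ge0 andbT eq_sym; apply: contra xy.
rewrite psumr_eq0 => [/allP H|i _]; last exact: sqr_ge0.
apply/eqP/rowP => i; apply/eqP; rewrite -subr_eq0 -sqrf_eq0.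
by apply: H; rewrite mem_index_enum.
Qed.

Lemma d2xx (x : X) : d2 x x = 0%R.
Proof. by rewrite /d2 big1// => i _; rewrite subrr expr0n. Qed.

Lemma riesz_kernel_neq alpha (x y : X) : x != y -> riesz_kernel alpha x y =
  (expR (- ((n%:R - alpha) / 2 * ln (d2 x y))))%:E.
Proof.
move=> xy; have d0 := d2_gt0 xy.
rewrite /riesz_kernel (negbTE xy) enorm_sqrt -powR12_sqrt ?d2_ge0// -powRrM.
rewrite /powR gt_eqF//; congr (expR _)%:E.
by move: (ln _) => l; field.
Qed.

Lemma riesz_kernelE alpha (x y : X) : (alpha < n%:R)%R ->
  riesz_kernel alpha x y = gker (riesz_weight ((n%:R - alpha) / 2)) x y.
Proof.
move=> an; have a0 : (0 < (n%:R - alpha) / 2)%R by rewrite divr_gt0// subr_gt0.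
have [->|xy] := eqVneq x y.
  rewrite /riesz_kernel eqxx /gker -(riesz_weight_int a0).
  by apply: eq_integral => v _; rewrite /gauss d2xx mulr0 oppr0 expR0 mulr1.
by rewrite riesz_kernel_neq// -(riesz_mixture a0 (d2_gt0 xy)).
Qed.

Variable rho : R -> R.
Hypothesis wrho : weight rho.

Let measurable_rho_gauss (x y : X) :
  measurable_fun setT (fun v => rho v * gauss (expR v) x y)%R.
Proof.
apply: measurable_funM; first exact: wrho.1.
apply: measurableT_comp => //; apply: measurableT_comp => //.
by apply: measurable_funM.
Qed.

Let open_gt_gauss c (y : X) v :
  open [set x : X | c%:E < (rho v * gauss (expR v) x y)%:E].
Proof.
rewrite (_ : [set x | _] =
    (fun x => rho v * gauss (expR v) x y)%R @^-1` [set r | (c < r)%R]); last first.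
  by apply/seteqP; split => x /=; rewrite lte_fin.
apply: open_comp => [x _|]; last exact: open_gt.
exact: (cvgM (cvg_cst (rho v)) (@continuous_gauss (expR v) y x)).
Qed.

Lemma gker_lsc c (y : X) : open [set x : X | c%:E < gker rho x y].
Proof.
apply: (@lsc_integral _ _ _ _ leb (fun x v => (rho v * gauss (expR v) x y)%:E)).
- by move=> x v; rewrite lee_fin mulr_ge0 ?expR_ge0//; exact: wrho.2.
- move=> x; apply/measurable_EFinP; exact: measurable_rho_gauss.
move=> {}c v; exact: open_gt_gauss.
Qed.

(* The truncated kernel [gker (tw m)] is bounded and continuous, unlike the
   Riesz kernel, to which it increases. *)
Definition tw (m : nat) v : R := (rho v * \1_(`[- m%:R, m%:R]) v)%R.
Definition cw (m : nat) v : R := (rho v * \1_(~` `[- m%:R, m%:R]) v)%R.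

Lemma weight_tw m : weight (tw m).
Proof.
split; last by move=> v; rewrite mulr_ge0// wrho.2.
by apply: measurable_funM; [exact: wrho.1|exact: measurable_indic].
Qed.

Lemma weight_cw m : weight (cw m).
Proof.
split; last by move=> v; rewrite mulr_ge0// wrho.2.
apply: measurable_funM; first exact: wrho.1.
by apply: measurable_indic; exact: measurableC.
Qed.

Lemma gker_split m (x y : T) : gker rho x y = gker (tw m) x y + gker (cw m) x y.
Proof.
rewrite -gkerD; [|exact: weight_tw|exact: weight_cw].
congr (gker _ x y); apply/funext => v.
by rewrite /tw /cw !indicE in_setC; case: (_ \in _); rewrite /= mulr1 mulr0 ?addr0 ?add0r.
Qed.

Lemma dbl_tw_cvg (mu nu : smeasure) :
  dbl (gker (tw m)) mu nu @[m --> \oo] --> dbl (gker rho) mu nu.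
Proof.
pose D v := dbl (fun x y : T => (gauss (expR v) x y)%:E) mu nu.
have D0 v : 0 <= D v by exact: dbl_gauss_ge0.
have -> : dbl (gker rho) mu nu = \int[leb]_v limn (fun m => (tw m v)%:E * D v).
  rewrite dbl_gker//; apply: eq_integral => v _; apply/esym/cvg_lim => //.
  apply: cvg_near_cst; near=> m; congr (_%:E * _).
  rewrite /tw indicE mem_set ?mulr1//= in_itv/= -ler_norml.
  by near: m; exact: nbhs_infty_ger.
under eq_cvg do rewrite (dbl_gker _ _ (weight_tw _)).
apply: (@cvg_monotone_convergence _ _ _ leb setT measurableT (fun m v => (tw m v)%:E * D v)).
- by move=> m; apply: measurable_weight_dbl; exact: weight_tw.
- by move=> m v _; rewrite mule_ge0// lee_fin; exact: (weight_tw m).2.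
move=> v _ m M mM; apply: lee_wpmul2r => //; rewrite lee_fin /tw ler_wpM2l ?wrho.2//.
rewrite !indicE; case: (boolP (v \in _)) => // vm.
rewrite mem_set//=; move: vm; rewrite inE/= !in_itv/= -!ler_norml => /le_trans; apply.
by rewrite ler_nat.
Unshelve. all: by end_near. Qed.

End truncated_kernel.

Section truncated_potential.
Context {R : realType} {n : nat}.
Local Notation T := (borel R n).
Local Notation X := 'rV[R]_n.
Local Notation leb := (@lebesgue_measure R).
Local Open Scope ereal_scope.
Variables (tau : R -> R) (B m : R) (nu : posmeasure R n).
Hypothesis wtau : weight tau.
Hypothesis tauB : \int[leb]_v (tau v)%:E = B%:E.
Hypothesis tau_supp : forall v, (v < m)%R -> tau v = 0%R.
Hypothesis nuoo : nu setT < +oo.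

Let mtau : measurable_fun setT (EFin \o tau).
Proof. by apply/measurable_EFinP; exact: wtau.1. Qed.

Let B0 : (0 <= B)%R.
Proof. by rewrite -lee_fin -tauB; apply: integral_ge0 => v _; rewrite lee_fin wtau.2. Qed.

Let mgauss (x y : X) : measurable_fun setT (fun v => gauss (expR v) x y).
Proof.
apply: measurableT_comp => //; apply: measurableT_comp => //.
by apply: measurable_funM.
Qed.

Let gauss_le v (x y : X) : (m <= v)%R -> (gauss (expR v) x y <= gauss (expR m) x y)%R.
Proof. by move=> mv; rewrite ler_expR lerN2 ler_wpM2r ?d2_ge0// ler_expR. Qed.

(** Gaussians decrease as v grows and [tau] vanishes below [m], so the widest one dominates. This is
    where the lower end of the truncation gives decay at infinity. *)
Let gker_le_gauss (x y : X) : gker tau x y <= (B * gauss (expR m) x y)%:E.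
Proof.
apply: (@le_trans _ _ (\int[leb]_v ((tau v)%:E * (gauss (expR m) x y)%:E))).
  apply: ge0_le_integral.
  - exact: measurableT.
  - by move=> v _; rewrite lee_fin mulr_ge0 ?expR_ge0// wtau.2.
  - by apply/measurable_EFinP; apply: measurable_funM; [exact: wtau.1|exact: mgauss].
  - by apply: emeasurable_funM.
  move=> v _; rewrite -EFinM lee_fin; case: (leP m v) => mv.
    by rewrite ler_wpM2l ?wtau.2// gauss_le.
  by rewrite tau_supp// !mul0r.
rewrite ge0_integralZr.
- by rewrite tauB EFinM.
- exact: measurableT.
- exact: mtau.
- by move=> v _; rewrite lee_fin wtau.2.
- by rewrite lee_fin expR_ge0.
Qed.

Lemma trunc_gker_le (x y : X) : gker tau x y <= B%:E.
Proof.
apply: (le_trans (gker_le_gauss x y)); rewrite lee_fin ler_piMr//.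
by rewrite gauss_le1// expR_ge0.
Qed.

Let U (x : X) := \int[nu]_y gker tau x y.

Let mgk (x : X) : measurable_fun setT (gker tau x : T -> \bar R).
Proof. exact: (nnkernel_measurable (x : T) (gker_nnkernel wtau)). Qed.

Let gk0 (x y : X) : 0 <= gker tau x y.
Proof. exact: (gker_nnkernel wtau).2. Qed.

Let intB : \int[nu]_(y in [set: T]) B%:E = B%:E * nu setT.
Proof. by rewrite integral_cst. Qed.

Lemma trunc_pot_le (x : X) : \int[nu]_y gker tau x y <= B%:E * nu setT.
Proof.
by rewrite -intB; apply: ge0_le_integral => // y _; exact: trunc_gker_le.
Qed.

(** The kernel subtracted from its bound [B]. It is again a nonnegative mixture of functions
    continuous in x, so its potential is lower semicontinuous too, which makes the potential of
    [gker tau] upper semicontinuous. *)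
Let cogker (x y : X) := \int[leb]_v (tau v * (1 - gauss (expR v) x y))%:E.

Let tau_co v (x y : X) : (0 <= tau v * (1 - gauss (expR v) x y))%R.
Proof. by rewrite mulr_ge0 ?wtau.2// subr_ge0 gauss_le1// expR_ge0. Qed.

Let mco (x y : X) : measurable_fun setT (fun v => (tau v * (1 - gauss (expR v) x y))%:E).
Proof.
apply/measurable_EFinP; apply: measurable_funM; first exact: wtau.1.
exact: measurable_funB.
Qed.

Let cogker0 (x y : X) : 0 <= cogker x y.
Proof. by apply: integral_ge0 => v _; rewrite lee_fin. Qed.

Let cogkerD (x y : X) : cogker x y + gker tau x y = B%:E.
Proof.
rewrite -tauB /cogker /gker -ge0_integralD.
- by apply: eq_integral => v _; rewrite -EFinD -mulrDr subrK mulr1.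
- exact: measurableT.
- by move=> v _; rewrite lee_fin.
- exact: mco.
- by move=> v _; rewrite lee_fin mulr_ge0 ?expR_ge0// wtau.2.
- by apply/measurable_EFinP; apply: measurable_funM; [exact: wtau.1|exact: mgauss].
Qed.

Let gker_fin (x y : X) : gker tau x y \is a fin_num.
Proof. by rewrite ge0_fin_numE// (le_lt_trans (trunc_gker_le x y))// ltry. Qed.

Let cogkerE (x y : X) : cogker x y = B%:E - gker tau x y.
Proof. by rewrite -(cogkerD x y) addeK. Qed.

Let mcogker (x : X) : measurable_fun setT (cogker x : T -> \bar R).
Proof.
rewrite (_ : cogker x = fun y => B%:E - gker tau x y); last first.
  by apply/funext => y; rewrite cogkerE.
by apply: emeasurable_funB => //; exact: mgk.
Qed.

Let cogker_lsc c (y : X) : open [set x : X | c%:E < cogker x y].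
Proof.
apply: (@lsc_integral _ _ _ _ leb (fun x v => (tau v * (1 - gauss (expR v) x y))%:E)).
- by move=> x v; rewrite lee_fin.
- by move=> x; exact: mco.
move=> {}c v; rewrite (_ : [set x | _] =
    (fun x => tau v * (1 - gauss (expR v) x y))%R @^-1` [set r | (c < r)%R]); last first.
  by apply/seteqP; split => x /=; rewrite lte_fin.
apply: open_comp => [x _|]; last exact: open_gt.
pose one : R := 1%R.
have H := cvgB (cvg_cst one) (@continuous_gauss R n (expR v) y x).
exact: (cvgM (cvg_cst (tau v)) (H _ _)).
Qed.

Let closed_U c : closed [set x : X | c%:E <= U x].
Proof.
have fin : B%:E * nu setT \is a fin_num.
  by rewrite fin_numM// ge0_fin_numE.
rewrite (_ : [set x | _] = ~` [set x : X | (fine (B%:E * nu setT) - c)%:E <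
    \int[nu]_y cogker x y]).
  apply: open_closedC; apply: (@lsc_integral _ _ _ _ nu cogker) => //.
have H x : \int[nu]_y cogker x y + U x = B%:E * nu setT.
  rewrite -intB -ge0_integralD.
  - by apply: eq_integral => y _; rewrite cogkerD.
  - exact: measurableT.
  - by [].
  - exact: mcogker.
  - by move=> y _; exact: gk0.
  - exact: mgk.
apply/seteqP; split => x /=.
  move=> cU; apply/negP; rewrite -leNgt EFinB fineK// leeBrDr//.
  by rewrite -(H x) leeD2l.
move=> /negP; rewrite -leNgt EFinB fineK// leeBrDr// -(H x).
rewrite leeD2lE//.
have I0 : 0 <= \int[nu]_y cogker x y by apply: integral_ge0.
have U0 : 0 <= U x by apply: integral_ge0.
rewrite (ge0_fin_numE I0); apply: (@le_lt_trans _ _ (B%:E * nu setT)).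
  by rewrite -(H x); exact: leeDl.
by rewrite ltey_eq fin.
Qed.

(** Along a sequence of points going to infinity the kernel tends to 0 pointwise and stays below
    [B], so by dominated convergence the potential of the finite measure [nu] tends to 0. *)
Let bounded_U c : (0 < c)%R -> bounded_set [set x : X | c%:E <= U x].
Proof.
move=> c0; apply: contrapT => nb.
have /choice[u Hu] (i : nat) : exists x : X, (c%:E <= U x) /\ (i%:R < `|x|)%R.
  apply: contrapT => H; apply: nb; exists (i%:R : R); split=> // M iM x Ux.
  rewrite /=; apply: le_trans (ltW iM).
  by rewrite leNgt; apply/negP => xi; apply: H; exists x.
have ptw (y : X) : gker tau (u i) y @[i --> \oo] --> 0.
  have d2u A : \forall i \near \oo, (A <= d2 (u i) y)%R.
    apply: filterS (nbhs_infty_ger (`|y| + `|A| + 1)%R) => i Hi0; have [_ iu] := Hu i.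
    have /(@mx_norm_neq0 R)[[k j] /= Hj] : mx_norm (u i) != 0%R.
      by rewrite gt_eqF// (le_lt_trans _ iu).
    apply: (@le_trans _ _ ((u i ord0 j - y ord0 j) ^+ 2)%R); last first.
      rewrite /d2 (bigD1 j)//= lerDl; apply: sumr_ge0 => l _; exact: sqr_ge0.
    have Hi : (`|y ord0 j| + `|A| + 1 <= `|u i ord0 j|)%R.
      have -> : (`|u i ord0 j| = `|u i|)%R by rewrite [RHS]Hj (ord1 k).
      apply: le_trans (ltW iu).
      apply: le_trans Hi0; rewrite !lerD2r.
      rewrite [leRHS]mx_normrE; exact: (le_bigmax _ (fun ij => `|y ij.1 ij.2|%R) (ord0, j)).
    rewrite -real_normK ?num_real//.
    have : (`|A| + 1 <= `|u i ord0 j - y ord0 j|)%R.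
      have := ler_distD 0%R (u i ord0 j) (y ord0 j); rewrite subr0 sub0r normrN.
      have := ler_dist_dist (u i ord0 j) (y ord0 j).
      have := ler_norm (`|u i ord0 j| - `|y ord0 j|)%R; lra.
    have := ler_norm A; have := normr_ge0 A.
    move: `|A|%R `|_|%R => a z; nra.
  apply: (@squeeze_cvge _ _ _ _ (cst 0) _ (fun i => (B * gauss (expR m) (u i) y)%:E)).
  - by apply: nearW => i; rewrite gk0/= gker_le_gauss.
  - exact: cvg_cst.
  apply/cvg_EFin; first exact: nearW.
  apply/cvgrPdist_le => e e0.
  have t0 := expR_gt0 m.
  (* With z = e^m |u_i - y|^2 at least B / e, the inequality e^z >= z makes B e^(-z) at most [e]. *)
  apply: filterS (d2u (B / (e * expR m))%R) => i Hd.
  rewrite /= sub0r normrN ger0_norm; last by rewrite mulr_ge0// expR_ge0.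
  rewrite /gauss expRN ler_pdivrMr ?expR_gt0//.
  move: Hd; rewrite ler_pdivrMr ?mulr_gt0// => /le_trans; apply.
  rewrite mulrCA ler_pM2l// mulrC; apply: le_trans (expR_ge1Dx _).
  by rewrite lerDr.
have : \int[nu]_y gker tau (u i) y @[i --> \oo] --> \int[nu]_y (cst 0 y).
  have [] // := @dominated_convergence _ _ _ nu _ measurableT
    (fun i => gker tau (u i)) (cst 0) (cst B%:E).
  - by apply: aeW => y _; exact: ptw.
  - apply/integrableP; split => //.
    rewrite (_ : (fun x => `|cst B%:E x|) = cst B%:E); last first.
      by apply/funext => y; rewrite /= ger0_norm.
    by rewrite intB lte_mul_pinfty// lee_fin.
  - apply: aeW => y i _; rewrite gee0_abs//; exact: trunc_gker_le.
rewrite integral0_eq// => cv.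
have : \forall i \near \oo, U (u i) < c%:E.
  apply: (cv [set z | z < c%:E]); apply: open_nbhs_nbhs.
  by split; [exact: open_ereal_lt_ereal|rewrite /= lte_fin].
by move=> /filter_ex[i] /=; rewrite ltNge; have [Hc _] := Hu i; rewrite Hc.
Qed.

Lemma trunc_pot_compact c : (0 < c)%R ->
  compact [set x : X | c%:E <= \int[nu]_y gker tau x y].
Proof. by move=> c0; apply: bounded_closed_compact; [exact: bounded_U|exact: closed_U]. Qed.

End truncated_potential.

(** * The energy form *)

Section energy_form.
Context d (T : measurableType d) (R : realType).
Local Notation pmeasure := {measure set T -> \bar R}.
Local Notation smeasure := {sigma_finite_measure set T -> \bar R}.

Section sigma_finite_pack.
Variables (mu : pmeasure) (H : sigma_finite setT mu).

Definition sfin_of (_ : sigma_finite setT mu) : set T -> \bar R := mu.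

Let sfin0 : sfin_of H set0 = 0%E. Proof. exact: measure0. Qed.

Let sfin_ge0 A : (0 <= sfin_of H A)%E. Proof. exact: measure_ge0. Qed.

Let sfin_sadd : semi_sigma_additive (sfin_of H).
Proof. exact: (@measure_semi_sigma_additive _ _ _ mu). Qed.

HB.instance Definition _ := isMeasure.Build d T R (sfin_of H)
  sfin0 sfin_ge0 sfin_sadd.

HB.instance Definition _ := Measure_isSigmaFinite.Build d T R (sfin_of H) H.

(** Tonelli asks for the sigma-finite structure, which a plain measure does not carry. The packed
    copy equals the given measure, so results about the former transfer by rewriting. *)
Lemma sigma_finite_packE : exists s : smeasure, (s : pmeasure) = mu.
Proof. by exists (sfin_of H : smeasure); exact: eq_measure. Qed.

End sigma_finite_pack.

Variable E : nat -> set T.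
Hypothesis mE : forall i, measurable (E i).
Hypothesis ET : \bigcup_i E i = setT.

Definition locfin (mu : pmeasure) := forall i, (mu (E i) < +oo)%E.

Lemma locfin_sfin mu : locfin mu -> exists s : smeasure, (s : pmeasure) = mu.
Proof.
by move=> H; apply: sigma_finite_packE; exists E => // i; split.
Qed.

Lemma locfin_add (m1 m2 : pmeasure) : locfin m1 -> locfin m2 ->
  locfin (measure_add m1 m2).
Proof.
move=> H1 H2 i; suff: (m1 (E i) + m2 (E i) < +oo)%E by rewrite -measure_addE.
exact: lte_add_pinfty.
Qed.

Lemma locfin_scale (c : {nonneg R}) (m : pmeasure) : locfin m -> locfin (mscale c m).
Proof.
by move=> H i; suff: (c%:num%:E * m (E i) < +oo)%E by []; exact: lte_mul_pinfty.
Qed.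

Lemma locfin_finite (m : pmeasure) : (m setT < +oo)%E -> locfin m.
Proof. by move=> H i; apply: le_lt_trans H; apply: le_measure; rewrite ?inE. Qed.

Section form.
Local Open Scope ereal_scope.
Variable k : T -> T -> \bar R.
Hypothesis kk : nnkernel k.
Hypothesis kC : forall x y, k x y = k y x.
Hypothesis kp : posdef k.

Lemma dbl_locC mu nu : locfin mu -> locfin nu -> dbl k mu nu = dbl k nu mu.
Proof. by move=> /locfin_sfin[s <-] /locfin_sfin[t <-]; exact: dblC. Qed.

Lemma dbl_locDl m1 m2 nu : locfin nu ->
  dbl k (measure_add m1 m2) nu = dbl k m1 nu + dbl k m2 nu.
Proof.
move=> /locfin_sfin[s <-]; rewrite /dbl ge0_integral_measure_add//.
  by move=> x _; apply: integral_ge0 => y _; exact: kk.2.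
exact: nnkernel_int_measurable.
Qed.

Lemma dbl_locZl (c : {nonneg R}) m nu : locfin nu ->
  dbl k (mscale c m) nu = c%:num%:E * dbl k m nu.
Proof.
move=> /locfin_sfin[s <-]; rewrite /dbl ge0_integral_mscale//.
  exact: nnkernel_int_measurable.
by move=> x _; apply: integral_ge0 => y _; exact: kk.2.
Qed.

Lemma dbl_pos mu nu : 0 <= dbl k mu nu.
Proof. by apply: integral_ge0 => x _; apply: integral_ge0 => y _; exact: kk.2. Qed.

Lemma dbl_locpd mu nu : locfin mu -> locfin nu ->
  dbl k mu nu + dbl k mu nu <= dbl k mu mu + dbl k nu nu.
Proof.
move=> Hm Hn; rewrite {2}(dbl_locC Hm Hn).
by have [s <-] := locfin_sfin Hm; have [t <-] := locfin_sfin Hn; exact: kp.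
Qed.

Definition fine_energy mu := locfin mu /\ dbl k mu mu < +oo.

Definition eform mu nu : R := fine (dbl k mu nu).

(** Positive definiteness bounds twice the mutual energy by the sum of the two energies. *)
Lemma dbl_fin mu nu : fine_energy mu -> fine_energy nu ->
  dbl k mu nu \is a fin_num.
Proof.
move=> [lm em] [ln en]; rewrite ge0_fin_numE ?dbl_pos//.
apply: le_lt_trans (lte_add_pinfty em en).
by apply: le_trans (dbl_locpd lm ln); rewrite leeDl// dbl_pos.
Qed.

Lemma eformE mu nu : fine_energy mu -> fine_energy nu ->
  dbl k mu nu = (eform mu nu)%:E.
Proof. by move=> fm fn; rewrite fineK// dbl_fin. Qed.

Lemma eform_ge0 mu nu : (0 <= eform mu nu)%R.
Proof. by rewrite fine_ge0// dbl_pos. Qed.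

Lemma eformC mu nu : fine_energy mu -> fine_energy nu ->
  eform mu nu = eform nu mu.
Proof. by move=> [lm _] [ln _]; rewrite /eform (dbl_locC lm ln). Qed.

Lemma fine_energyD m1 m2 : fine_energy m1 -> fine_energy m2 ->
  fine_energy (measure_add m1 m2).
Proof.
move=> f1 f2; have l12 := locfin_add f1.1 f2.1; split => //.
rewrite (dbl_locDl m1 m2 l12) (dbl_locC f1.1 l12) (dbl_locDl m1 m2 f1.1).
rewrite (dbl_locC f2.1 l12) (dbl_locDl m1 m2 f2.1).
by rewrite !eformE// -!EFinD ltry.
Qed.

Lemma fine_energyZ (c : {nonneg R}) m : fine_energy m -> fine_energy (mscale c m).
Proof.
move=> f; have l := locfin_scale c f.1; split => //.
by rewrite (dbl_locZl c m l) (dbl_locC f.1 l) (dbl_locZl c m f.1) eformE// -!EFinM ltry.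
Qed.

Lemma eformDl m1 m2 nu : fine_energy m1 -> fine_energy m2 -> fine_energy nu ->
  eform (measure_add m1 m2) nu = (eform m1 nu + eform m2 nu)%R.
Proof.
by move=> f1 f2 f; rewrite /eform (dbl_locDl m1 m2 f.1) fineD ?dbl_fin.
Qed.

Lemma eformDr m1 m2 nu : fine_energy m1 -> fine_energy m2 -> fine_energy nu ->
  eform nu (measure_add m1 m2) = (eform nu m1 + eform nu m2)%R.
Proof.
move=> f1 f2 f; rewrite eformC ?eformDl//; last exact: fine_energyD.
by rewrite (eformC f1 f) (eformC f2 f).
Qed.

Lemma eformZl (c : {nonneg R}) m nu : fine_energy m -> fine_energy nu ->
  eform (mscale c m) nu = (c%:num * eform m nu)%R.
Proof. by move=> fm f; rewrite /eform (dbl_locZl c m f.1) fineM ?dbl_fin. Qed.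

Lemma eformZr (c : {nonneg R}) m nu : fine_energy m -> fine_energy nu ->
  eform nu (mscale c m) = (c%:num * eform nu m)%R.
Proof.
move=> fm f; rewrite eformC ?eformZl//; last exact: fine_energyZ.
by rewrite (eformC fm f).
Qed.

(** The squared energy distance, I(mu - nu) expanded, for measures of finite energy. *)
Definition qform mu nu : R := (eform mu mu + eform nu nu - 2 * eform mu nu)%R.

Lemma qform_ge0 mu nu : fine_energy mu -> fine_energy nu -> (0 <= qform mu nu)%R.
Proof.
move=> fm fn; have := dbl_locpd fm.1 fn.1.
by rewrite !eformE// -!EFinD lee_fin /qform; lra.
Qed.

Lemma qformC mu nu : fine_energy mu -> fine_energy nu -> qform mu nu = qform nu mu.
Proof. by move=> fm fn; rewrite /qform (eformC fm fn); lra. Qed.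

(* The discriminant form of Cauchy-Schwarz: [I(mu - nu + s theta) >= 0]. *)
Lemma eform_sub_le mu nu theta s : fine_energy mu -> fine_energy nu ->
  fine_energy theta -> (0 <= s)%R ->
  (2 * s * `|eform mu theta - eform nu theta| <=
    qform mu nu + s ^+ 2 * eform theta theta)%R.
Proof.
move=> fm fn ft s0; pose c := NngNum s0.
have fst := fine_energyZ c ft.
have H m1 m2 : fine_energy m1 -> fine_energy m2 ->
    (2 * s * (eform m2 theta - eform m1 theta) <=
     qform m1 m2 + s ^+ 2 * eform theta theta)%R.
  move=> f1 f2; have fa := fine_energyD f1 fst.
  have := qform_ge0 fa f2; rewrite /qform !eformDl// !eformDr// !eformZl// !eformZr//.
  by rewrite (eformC ft f1) (eformC ft f2)/=; lra.
have [h|h] := leP 0%R (eform mu theta - eform nu theta)%R.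
  by rewrite ger0_norm//; have := H nu mu fn fm; rewrite (qformC fn fm).
by rewrite ltr0_norm// opprB; exact: H.
Qed.

End form.
End energy_form.

Section exhaustion.
Context {R : realType} {n : nat}.

Definition cball (i : nat) : set (borel R n) := [set x : 'rV[R]_n | `|x| <= i%:R].

Lemma compact_cball i : compact (cball i : set 'rV[R]_n).
Proof.
apply: bounded_closed_compact.
  by exists (i%:R : R); split => // M iM x /= xi; exact: le_trans (ltW iM).
rewrite (_ : cball i = (@Num.norm R 'rV[R]_n) @^-1` [set r | r <= i%:R])//.
by apply: closed_comp => [x _|]; [exact: norm_continuous|exact: closed_le].
Qed.

Lemma measurable_cball i : measurable (cball i).
Proof. by apply: compact_borel; exact: compact_cball. Qed.

Lemma bigcup_cball : \bigcup_i cball i = setT.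
Proof.
apply/seteqP; split => // x _; exists (Num.truncn `|x : 'rV[R]_n|).+1 => //=.
exact/ltW/truncnS_gt.
Qed.

End exhaustion.

Lemma gkerE {R : realType} {n : nat} (rho : R -> R) (x y : borel R n) :
  gker rho x y = (\int[@lebesgue_measure R]_v (rho v * gauss (expR v) x y)%:E)%E.
Proof. by []. Qed.

(* Keeps unification from unfolding kernels that only differ by their weight. *)
#[global] Opaque gker eform.

Ltac lra_eform := rewrite /qform; repeat match goal with
  |- context [eform ?k ?m1 ?m2] => generalize (eform k m1 m2); intro end;
  intros; lra.

Section weight_split.
Context {R : realType} {n : nat}.
Local Notation T := (borel R n).
Variables rho tau tau' : R -> R.
Hypothesis wrho : weight rho.
Hypothesis wtau : weight tau.
Hypothesis wtau' : weight tau'.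
Hypothesis rhoE : forall x y : T, gker rho x y = (gker tau x y + gker tau' x y)%E.

Local Notation fineE := (fine_energy (@cball R n)).

Let kk := gker_nnkernel (n := n) wrho.
Let kp := gker_posdef (n := n) wrho.
Let kC := @gkerC R n rho.
Let kk1 := gker_nnkernel (n := n) wtau.
Let kp1 := gker_posdef (n := n) wtau.
Let kC1 := @gkerC R n tau.
Let kk2 := gker_nnkernel (n := n) wtau'.
Let kp2 := gker_posdef (n := n) wtau'.
Let kC2 := @gkerC R n tau'.

Lemma dbl_split (mu nu : posmeasure R n) : locfin (@cball R n) mu ->
  locfin (@cball R n) nu ->
  dbl (gker rho) mu nu = (dbl (gker tau) mu nu + dbl (gker tau') mu nu)%E.
Proof.
move=> /(locfin_sfin measurable_cball bigcup_cball)[s <-].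
move=> /(locfin_sfin measurable_cball bigcup_cball)[t <-].
rewrite -(dblD s t kk1 kk2); apply: eq_integral => x _.
by apply: eq_integral => y _; exact: rhoE.
Qed.

Lemma fineE_split mu : fineE (gker rho) mu ->
  fineE (gker tau) mu /\ fineE (gker tau') mu.
Proof.
move=> [lf ef]; split; (split; [exact: lf|apply: le_lt_trans ef]);
  rewrite [leRHS](dbl_split lf lf).
  by apply: leeDl; exact: (dbl_pos kk2).
by apply: leeDr; exact: (dbl_pos kk1).
Qed.

Lemma eform_split mu nu : fineE (gker rho) mu -> fineE (gker rho) nu ->
  eform (gker rho) mu nu = eform (gker tau) mu nu + eform (gker tau') mu nu.
Proof.
move=> fm fn; have [fm1 fm2] := fineE_split fm; have [fn1 fn2] := fineE_split fn.
have e1 := eformE measurable_cball bigcup_cball kk kC kp fm fn.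
have e2 := eformE measurable_cball bigcup_cball kk1 kC1 kp1 fm1 fn1.
have e3 := eformE measurable_cball bigcup_cball kk2 kC2 kp2 fm2 fn2.
have := dbl_split fm.1 fn.1; move: e1 e2 e3.
move: (dbl (gker rho) mu nu) (dbl (gker tau) mu nu) (dbl (gker tau') mu nu) => a b c.
by move=> -> -> -> [].
Qed.

Lemma eform_split_le mu nu : fineE (gker rho) mu -> fineE (gker rho) nu ->
  eform (gker tau) mu nu <= eform (gker rho) mu nu.
Proof.
by move=> fm fn; rewrite (eform_split fm fn) lerDl (eform_ge0 kk2).
Qed.

(** The squared distance is additive in the kernel, and the part coming from [tau'] is
    nonnegative. *)
Lemma qform_split_le mu nu : fineE (gker rho) mu -> fineE (gker rho) nu ->
  qform (gker tau) mu nu <= qform (gker rho) mu nu.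
Proof.
move=> fm fn.
rewrite /qform (eform_split fm fm) (eform_split fn fn) (eform_split fm fn).
have := qform_ge0 measurable_cball bigcup_cball kk2 kC2 kp2 (fineE_split fm).2 (fineE_split fn).2.
lra_eform.
Qed.

End weight_split.

Section strong_limit.
Context {R : realType} {n : nat}.
Local Notation T := (borel R n).
Local Notation X := 'rV[R]_n.
Local Notation leb := (@lebesgue_measure R).
Variable rho : R -> R.
Hypothesis wrho : weight rho.
Hypothesis tw_int : forall m, exists B : R, (\int[leb]_v (tw rho m v)%:E = B%:E)%E.

Local Notation k := (gker rho).
Local Notation km m := (gker (tw rho m)).
Local Notation fineE := (fine_energy (@cball R n)).

Let kk := gker_nnkernel (n := n) wrho.
Let kp := gker_posdef (n := n) wrho.
Let kC := @gkerC R n rho.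
Let kkm m := gker_nnkernel (n := n) (weight_tw wrho m).
Let kpm m := gker_posdef (n := n) (weight_tw wrho m).
Let kCm m := @gkerC R n (tw rho m).
Let wtm := weight_tw wrho.
Let wcm := weight_cw wrho.
Let spl m := gker_split (n := n) wrho m.

Let fineE_tw m mu (f : fineE k mu) : fineE (km m) mu :=
  (fineE_split (wtm m) (wcm m) (spl m) f).1.

Let eform_tw_le m mu nu (fm : fineE k mu) (fn : fineE k nu) :
    eform (km m) mu nu <= eform k mu nu :=
  eform_split_le wrho (wtm m) (wcm m) (spl m) fm fn.

Let qform_tw_le m mu nu (fm : fineE k mu) (fn : fineE k nu) :
    qform (km m) mu nu <= qform k mu nu :=
  qform_split_le wrho (wtm m) (wcm m) (spl m) fm fn.

Lemma eform_tw_cvg mu nu : fineE k mu -> fineE k nu ->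
  eform (km m) mu nu @[m --> \oo] --> eform k mu nu.
Proof.
move=> fm fn.
have [s sE] := locfin_sfin measurable_cball bigcup_cball fm.1.
have [t tE] := locfin_sfin measurable_cball bigcup_cball fn.1.
apply: fine_cvg; rewrite -(eformE measurable_cball bigcup_cball kk kC kp fm fn).
by rewrite -sE -tE; exact: dbl_tw_cvg.
Qed.

Lemma tw_supp m v : v < - m%:R -> tw rho m v = 0.
Proof. by move=> vm; rewrite /tw indicE memNset ?mulr0//= in_itv/= leNgt vm. Qed.

(** The truncated kernel is bounded, so finite mass suffices. This makes truncated energies of the
    vague limit available before its energy is known to be finite. *)
Lemma fineE_tw_finite m (mu : posmeasure R n) : (mu setT < +oo)%E -> fineE (km m) mu.
Proof.
move=> muoo; split; first exact: (locfin_finite measurable_cball).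
have [B HB] := tw_int m; have mf : mu setT \is a fin_num by rewrite ge0_fin_numE.
apply: (@le_lt_trans _ _ (\int[mu]_(x in setT) (cst (B%:E * mu setT) x))%E).
  apply: ge0_le_integral.
  - exact: measurableT.
  - by move=> x _; apply: integral_ge0 => y _; exact: (kkm m).2.
  - apply: lsc_measurable => c; apply: (@lsc_integral _ _ _ _ mu (km m)).
    + by move=> x y; exact: (kkm m).2.
    + by move=> x; exact: (nnkernel_measurable (x : T) (kkm m)).
    + by move=> {}c y; apply: gker_lsc; exact: weight_tw.
  - exact: measurable_cst.
  - by move=> x _; exact: (trunc_pot_le mu (weight_tw wrho m) HB (@tw_supp m)).
by rewrite (integral_cst mu measurableT) ltey_eq !fin_numM.
Qed.

Variables (U : set_system nat) (mu : nat -> posmeasure R n).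
Context {UU : UltraFilter U}.
Hypothesis mu1 : forall i, mu i setT = 1%E.
Hypothesis muf : forall i, fineE k (mu i).
Local Notation lambda := (@vague_limit R n U mu UU mu1).

Lemma gker_pot_lsc tau (nu : posmeasure R n) c : weight tau ->
  open [set x : X | (c%:E < \int[nu]_y gker tau x y)%E].
Proof.
move=> wt; apply: (@lsc_integral _ _ _ _ nu (gker tau)).
- by move=> x y; exact: (gker_nnkernel wt).2.
- by move=> x; exact: (nnkernel_measurable (x : T) (gker_nnkernel wt)).
- by move=> {}c y; exact: gker_lsc.
Qed.

Let lamoo : (lambda setT < +oo)%E.
Proof. by apply: le_lt_trans (vague_limit_le1 _) _; rewrite ltry. Qed.

Let eform_lsc m eta : 0 < eta ->
  \forall i \near U, eform (km m) lambda lambda - eta < eform (km m) (mu i) lambda.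
Proof.
move=> eta0; have fl := fineE_tw_finite m lamoo.
have := @vague_limit_lsc R n U mu UU mu1 (fun x => \int[lambda]_y (km m) x y)%E
  (eform (km m) lambda lambda - eta).
have P1 (x : T) : (0 <= \int[lambda]_y (km m) x y)%E.
  by apply: integral_ge0 => y _; exact: (kkm m).2.
have P2 c : open [set x : X | (c%:E < \int[lambda]_y (km m) x y)%E].
  by apply: gker_pot_lsc; exact: weight_tw.
move=> /(_ P1 P2).
rewrite -/(dbl (km m) lambda lambda).
rewrite (eformE measurable_cball bigcup_cball (kkm m) (kCm m) (@kpm m) fl fl) lte_fin ltrBlDr ltrDl.
move=> /(_ eta0); apply: filterS => i.
rewrite -/(dbl (km m) (mu i) lambda).
by rewrite (eformE measurable_cball bigcup_cball (kkm m) (kCm m) (@kpm m)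
  (fineE_tw m (muf i)) fl) lte_fin.
Qed.

(** The direction that the full kernel does not offer: the truncated potential of a finite measure
    is bounded, with compact superlevel sets at positive levels. *)
Let eform_usc m (nu : posmeasure R n) eta : 0 < eta -> (nu setT < +oo)%E ->
  \forall i \near U, eform (km m) (mu i) nu < eform (km m) lambda nu + eta.
Proof.
move=> eta0 nuoo; have fl := fineE_tw_finite m lamoo.
have fn := fineE_tw_finite m nuoo.
have [B HB] := tw_int m.
have P0 (x : T) : (0 <= \int[nu]_y (km m) x y)%E.
  by apply: integral_ge0 => y _; exact: (kkm m).2.
have P1 (x : T) : (0 <= \int[nu]_y (km m) x y <= (B * fine (nu setT))%:E)%E.
  rewrite P0/= EFinM fineK ?ge0_fin_numE//.
  exact: (trunc_pot_le nu (weight_tw wrho m) HB (@tw_supp m)).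
have P2 : measurable_fun setT (fun x : T => \int[nu]_y (km m) x y)%E.
  by apply: lsc_measurable => c; apply: gker_pot_lsc; exact: weight_tw.
have P3 c : 0 < c -> compact [set x : X | (c%:E <= \int[nu]_y (km m) x y)%E].
  exact: (trunc_pot_compact (weight_tw wrho m) HB (@tw_supp m)).
have := @vague_limit_usc R n U mu UU mu1 (fun x => \int[nu]_y (km m) x y)%E
  (eform (km m) lambda nu + eta) _ P1 P2 P3.
rewrite -/(dbl (km m) lambda nu).
rewrite (eformE measurable_cball bigcup_cball (kkm m) (kCm m) (@kpm m) fl fn) lte_fin ltrDl.
move=> /(_ eta0); apply: filterS => i.
rewrite -/(dbl (km m) (mu i) nu).
by rewrite (eformE measurable_cball bigcup_cball (kkm m) (kCm m) (@kpm m)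
  (fineE_tw m (muf i)) fn) lte_fin.
Qed.

(** The limit relation is linear in [mu i], so the energy of the limit is compared with its mutual
    energy with [mu i], which positivity of the form bounds by the mean of the two energies. The
    bound is uniform in the truncation and passes to the full kernel. *)
Lemma vague_limit_energy M : (forall i, eform k (mu i) (mu i) <= M) ->
  fineE k lambda.
Proof.
move=> HM; have fl m := fineE_tw_finite m lamoo.
have lf := (fl 0%N).1; split; first exact: lf.
have H m : eform (km m) lambda lambda <= M.
  apply/ler_addgt0Pr => e e0; have e2 : 0 < e / 2 by rewrite divr_gt0.
  have [i Hi] := filter_ex (eform_lsc m e2).
  have := qform_ge0 measurable_cball bigcup_cball (kkm m) (kCm m) (@kpm m)
  (fineE_tw m (muf i)) (fl m).
  have := eform_tw_le m (muf i) (muf i); have := HM i; move: Hi.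
  lra_eform.
have [s sE] := locfin_sfin measurable_cball bigcup_cball lf.
have := @dbl_tw_cvg R n rho wrho s s; rewrite sE => cv.
apply: (@le_lt_trans _ _ M%:E); last by rewrite ltry.
rewrite -(cvg_lim _ cv)//; apply: lime_le; first by apply/cvg_ex; eexists; exact: cv.
apply: nearW => m.
by rewrite (eformE measurable_cball bigcup_cball (kkm m) (kCm m) (@kpm m) (fl m) (fl m)) lee_fin.
Qed.

(** In each truncation, positivity of the distance between [mu i] and the limit bounds the energy of
    the limit by that of [mu i], up to an error; the mixed term with [mu j] is handled by
    [eform_usc]. Then the truncation is removed. *)
Lemma vague_limit_strong eps j (F : set nat) : fineE k lambda ->
  U F -> (forall i, F i -> qform k (mu i) (mu j) <= eps) ->
  qform k lambda (mu j) <= eps.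
Proof.
move=> fl UF Hq; have muoo : (mu j setT < +oo)%E by rewrite mu1 ltry.
have H m : qform (km m) lambda (mu j) <= eps.
  apply/ler_addgt0Pr => e e0; have e4 : 0 < e / 4 by rewrite divr_gt0.
  have : \forall i \near U, [/\ F i,
      eform (km m) lambda lambda - e / 4 < eform (km m) (mu i) lambda &
      eform (km m) (mu i) (mu j) < eform (km m) lambda (mu j) + e / 4].
    apply: filterS3 UF (eform_lsc m e4) (eform_usc m e4 muoo) => i; split => //.
  move=> /filter_ex[i [Fi h1 h2]].
  have := qform_ge0 measurable_cball bigcup_cball (kkm m) (kCm m) (@kpm m)
  (fineE_tw m (muf i)) (fineE_tw m fl).
  have := le_trans (qform_tw_le m (muf i) (muf j)) (Hq i Fi); move: h1 h2.
  lra_eform.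
have cv : qform (km m) lambda (mu j) @[m --> \oo] --> qform k lambda (mu j).
  apply: cvgB; first by apply: cvgD; exact: eform_tw_cvg.
  by apply: cvgM; [exact: cvg_cst|exact: eform_tw_cvg].
rewrite -(cvg_lim _ cv)//; apply: limr_le; first by apply/cvg_ex; eexists; exact: cv.
exact: nearW.
Qed.

End strong_limit.

Section restriction.
Context d (T : measurableType d) (R : realType).
Local Notation pmeasure := {measure set T -> \bar R}.
Variables (mu : pmeasure) (D : set T) (mD : measurable D).
Local Open Scope ereal_scope.

Definition restr : pmeasure := mrestr mu mD.

Lemma restrE A : restr A = mu (A `&` D).
Proof. by []. Qed.

Lemma ge0_integral_restr (f : T -> \bar R) : measurable_fun setT f ->
  (forall x, 0 <= f x) -> \int[restr]_x f x = \int[mu]_(x in D) f x.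
Proof.
move=> mf f0; rewrite (@ge0_negligible_integral _ _ _ restr setT (~` D))//.
- rewrite setTD setCK; apply: eq_measure_integral => A mA AD.
  by rewrite restrE (setIidl AD).
- exact: measurableC.
- by rewrite restrE setICl.
Qed.

End restriction.

Section riesz_energy.
Context {R : realType} {n : nat} (alpha : R).
Hypothesis alphan : alpha < n%:R.
Local Notation T := (borel R n).
Local Notation X := 'rV[R]_n.
Local Notation leb := (@lebesgue_measure R).
Local Notation pmeasure := (posmeasure R n).

Let a := (n%:R - alpha) / 2.

Lemma riesz_exp_gt0 : 0 < (n%:R - alpha) / 2.
Proof. by rewrite divr_gt0// subr_gt0. Qed.

Local Notation rho := (riesz_weight ((n%:R - alpha) / 2)).
Local Notation k := (@gker R n rho).
Local Notation fineE := (fine_energy (@cball R n) k).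

Lemma wrho : weight rho.
Proof. exact: (weight_riesz riesz_exp_gt0). Qed.

Lemma riesz_tw_int m : exists B : R, (\int[leb]_v (tw rho m v)%:E = B%:E)%E.
Proof.
(* The weight is increasing, so its value at the right end bounds it on the window. *)
pose M := rho m%:R; have M0 : 0 <= M by exact: wrho.2.
have H : (\int[leb]_v (tw rho m v)%:E < +oo)%E.
  apply: (@le_lt_trans _ _ (\int[leb]_v ((M%:E * (\1_(`[- m%:R, m%:R]) v)%:E)))%E).
    apply: ge0_le_integral => //.
    - by move=> v _; rewrite lee_fin; exact: (weight_tw wrho m).2.
    - by apply/measurable_EFinP; exact: (weight_tw wrho m).1.
    - by apply: measurable_funeM; apply/measurable_EFinP; exact: measurable_indic.
    move=> v _; rewrite -EFinM lee_fin /tw indicE.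
    case: (boolP (v \in _)) => [|_]; last by rewrite !mulr0.
    rewrite inE/= in_itv/= !mulr1 => /andP[_ vm].
    rewrite /M /riesz_weight ler_pM2l ?invr_gt0 ?(riesz_cst_gt0 riesz_exp_gt0)//.
    by rewrite ler_expR ler_pM2l// riesz_exp_gt0.
  rewrite ge0_integralZl; last 4 first.
  - exact: measurableT.
  - by apply/measurable_EFinP; exact: measurable_indic.
  - by move=> v _; rewrite lee_fin.
  - by rewrite lee_fin.
  rewrite integral_indic//= setIT lebesgue_measure_itv/=.
  by case: ifP => _; rewrite ?mule0 ?ltry// -EFinD -EFinM ltry.
exists (fine (\int[leb]_v (tw rho m v)%:E)%E); rewrite fineK// ge0_fin_numE//.
by apply: integral_ge0 => v _; rewrite lee_fin; exact: (weight_tw wrho m).2.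
Qed.

Lemma kk : nnkernel k. Proof. exact: (gker_nnkernel wrho). Qed.
Lemma kp : posdef k. Proof. exact: (gker_posdef wrho). Qed.
Lemma kC (x y : T) : k x y = k y x. Proof. exact: gkerC. Qed.

Lemma mutual_energyE (mu nu : pmeasure) : mutual_energy alpha mu nu = dbl k mu nu.
Proof.
by apply: eq_integral => x _; apply: eq_integral => y _; rewrite riesz_kernelE.
Qed.

Lemma energyE (mu : pmeasure) : energy alpha mu = dbl k mu mu.
Proof. exact: mutual_energyE. Qed.

Lemma potentialE (mu : pmeasure) x : potential alpha mu x = (\int[mu]_y k x y)%E.
Proof. by apply: eq_integral => y _; rewrite riesz_kernelE. Qed.

Lemma Mplus_locfin (mu : pmeasure) : Mplus alpha mu -> locfin (@cball R n) mu.
Proof. by move=> [H _] i; apply: H; exact: compact_cball. Qed.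

Lemma Mplus_finite (mu : pmeasure) : (mu setT < +oo)%E -> Mplus alpha mu.
Proof.
move=> muoo; split=> [K cK|].
  by apply: le_lt_trans muoo; apply: le_measure; rewrite ?inE//; exact: compact_borel.
have ce : continuous (fun y : X => enorm y).
  have -> : (fun y : X => enorm y) = (fun y : X => Num.sqrt (d2 y 0)).
    by apply/funext => y; rewrite -enorm_sqrt subr0.
  by move=> y; apply: continuous_comp; [exact: continuous_d2|exact: sqrt_continuous].
have mD : measurable ([set y : X | 1 < enorm y] : set T).
  apply: open_borel; apply: (@open_comp _ _ (fun y : X => enorm y) [set r | 1 < r]).
    by move=> y _; exact: ce.
  exact: open_gt.
set D := [set y : X | 1 < enorm y] in mD *.
apply: (@le_lt_trans _ _ (\int[mu]_(y in (D : set T)) (cst 1 y))%E).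
  apply: ge0_le_integral => //.
  - by move=> y _; rewrite lee_fin powR_ge0.
  - apply/measurable_EFinP; apply: measurable_funTS.
    apply: (measurableT_comp (measurable_powR _)).
    exact: continuous_borel.
  move=> y; rewrite /D/= => y1; rewrite lee_fin.
  apply: (@le_trans _ _ (enorm y `^ 0)); last by rewrite powRr0.
  by apply: ler_powR; [exact: ltW|rewrite subr_le0 ltW].
rewrite integral_cst// mul1e; apply: le_lt_trans muoo.
by apply: le_measure; rewrite ?inE.
Qed.

Lemma Eplus_fineE (mu : pmeasure) : Eplus alpha mu -> fineE mu.
Proof.
move=> [Mmu fmu]; split; first exact: Mplus_locfin.
by rewrite -energyE ltey_eq fmu.
Qed.

Lemma fineE_Eplus (mu : pmeasure) : (mu setT < +oo)%E -> fineE mu -> Eplus alpha mu.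
Proof.
move=> muoo [_ fmu]; split; first exact: Mplus_finite.
by rewrite energyE ge0_fin_numE// dbl_pos//; exact: kk.
Qed.

Lemma energy_eform (mu : pmeasure) : fineE mu -> energy alpha mu = (eform k mu mu)%:E.
Proof.
move=> f; rewrite energyE.
exact: (eformE measurable_cball bigcup_cball kk kC kp f f).
Qed.

Section restr.
Variables (mu : pmeasure) (D : set T) (mD : measurable D).

Lemma dbl_eq_measure (h : T -> T -> \bar R) (m1 m2 m1' m2' : pmeasure) :
  (forall A, measurable A -> m1 A = m1' A) ->
  (forall A, measurable A -> m2 A = m2' A) -> dbl h m1 m2 = dbl h m1' m2'.
Proof.
move=> H1 H2; rewrite /dbl (@eq_measure_integral _ _ _ setT m1'); last first.
  by move=> A mA _; exact: H1.
by apply: eq_integral => x _; apply: eq_measure_integral => A mA _; exact: H2.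
Qed.

Lemma restr_add A : measurable A ->
  mu A = measure_add (restr mu mD) (restr mu (measurableC mD)) A.
Proof.
move=> mA; rewrite measure_addE !restrE -measureU.
- by rewrite -setIUr setUv setIT.
- exact: measurableI.
- by apply: measurableI => //; exact: measurableC.
- by rewrite setIACA setICr setI0.
Qed.

Lemma locfin_restr : locfin (@cball R n) mu -> locfin (@cball R n) (restr mu mD).
Proof.
move=> lf i; apply: le_lt_trans (lf i); rewrite restrE; apply: le_measure; rewrite ?inE.
- by apply: measurableI => //; exact: measurable_cball.
- exact: measurable_cball.
- exact: subIsetl.
Qed.
End restr.

(** The four mutual energies of the two pieces add up to the whole, and the mixed ones are
    nonnegative. *)
Lemma fineE_restr mu D (mD : measurable D) : fineE mu ->
  fineE (restr mu mD) /\
  eform k (restr mu mD) (restr mu mD) +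
  eform k (restr mu (measurableC mD)) (restr mu (measurableC mD)) <= eform k mu mu.
Proof.
move=> [lm em].
pose m1 := restr mu mD; pose m2 := restr mu (measurableC mD).
have l1 : locfin (@cball R n) m1 by exact: locfin_restr.
have l2 : locfin (@cball R n) m2 by exact: locfin_restr.
have l12 := locfin_add l1 l2.
have E : dbl k mu mu = ((dbl k m1 m1 + dbl k m2 m1) + (dbl k m1 m2 + dbl k m2 m2))%E.
  rewrite (@dbl_eq_measure k mu mu (measure_add m1 m2) (measure_add m1 m2)); last 2 first.
    exact: restr_add.
    exact: restr_add.
  rewrite (dbl_locDl measurable_cball bigcup_cball kk m1 m2 l12).
  rewrite (dbl_locC measurable_cball bigcup_cball kk kC l1 l12).
  rewrite (dbl_locC measurable_cball bigcup_cball kk kC l2 l12).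
  rewrite (dbl_locDl measurable_cball bigcup_cball kk m1 m2 l1).
  by rewrite (dbl_locDl measurable_cball bigcup_cball kk m1 m2 l2).
have p11 : (0 <= dbl k m1 m1)%E := dbl_pos kk m1 m1.
have p12 : (0 <= dbl k m1 m2)%E := dbl_pos kk m1 m2.
have p21 : (0 <= dbl k m2 m1)%E := dbl_pos kk m2 m1.
have p22 : (0 <= dbl k m2 m2)%E := dbl_pos kk m2 m2.
have f1 : fineE m1.
  split; [exact: l1|apply: le_lt_trans em; rewrite [leRHS]E].
  by rewrite -addeA; apply: leeDl; apply: adde_ge0 => //; exact: adde_ge0.
have f2 : fineE m2.
  split; [exact: l2|apply: le_lt_trans em; rewrite [leRHS]E].
  by rewrite addeA; apply: leeDr; apply: adde_ge0 => //; exact: adde_ge0.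
split; first exact: f1.
rewrite -lee_fin EFinD.
rewrite -(eformE measurable_cball bigcup_cball kk kC kp f1 f1).
rewrite -(eformE measurable_cball bigcup_cball kk kC kp f2 f2).
rewrite -(eformE measurable_cball bigcup_cball kk kC kp (conj lm em) (conj lm em)).
rewrite [leRHS]E; apply: leeD; first exact: leeDl.
exact: leeDr.
Qed.

End riesz_energy.

(** * Capacity and vague limits *)

Section capacity.
Context {R : realType} {n : nat} (alpha : R).
Hypothesis alphan : alpha < n%:R.
Local Notation T := (borel R n).
Local Notation X := 'rV[R]_n.
Local Notation pmeasure := (posmeasure R n).
Local Notation rho := (riesz_weight ((n%:R - alpha) / 2)).
Local Notation k := (@gker R n rho).
Local Notation fineE := (fine_energy (@cball R n) k).

Let wr := wrho alphan.
Let kk := kk (n := n) alphan.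
Let kp := kp (n := n) alphan.
Let kC := @kC R n alpha.
Let eE m1 m2 f1 f2 := @eformE _ _ _ _ measurable_cball bigcup_cball k kk kC kp m1 m2 f1 f2.

(** The reciprocal of [inner_capacity]; a positive lower bound on it expresses finite capacity. *)
Definition min_energy (Q : set X) : \bar R :=
  ereal_inf [set energy alpha mu | mu in Eplus1_on alpha Q].

Lemma concentratedS (mu : pmeasure) (Q Q' : set X) : Q `<=` Q' ->
  concentrated mu Q -> concentrated mu Q'.
Proof. by move=> QQ; apply: negligibleS; exact: subsetC. Qed.

Lemma concentrated_scale (c : {nonneg R}) (mu : pmeasure) Q :
  concentrated mu Q -> concentrated (mscale c mu) Q.
Proof.
move=> [N [mN N0 QN]]; exists N; split => //.
by rewrite /= /mscale [X in (_ * X)%E]N0 mule0.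
Qed.

Lemma concentrated_restr (mu : pmeasure) (D : set T) (mD : measurable D) Q :
  concentrated mu Q -> concentrated (restr mu mD) Q.
Proof.
move=> [N [mN N0 QN]]; exists N; split => //.
apply/eqP; rewrite eq_le measure_ge0 andbT -N0 restrE.
by apply: le_measure; rewrite ?inE//; exact: measurableI.
Qed.

(** Rescale [tau] to mass one and use that the energy is quadratic. *)
Lemma min_energy_mass (Q : set X) (c : R) (tau : pmeasure) :
  (c%:E <= min_energy Q)%E -> fineE tau ->
  (tau setT < +oo)%E -> concentrated tau Q ->
  c * fine (tau setT) ^+ 2 <= eform k tau tau.
Proof.
move=> cQ ft toc ctau; set t := fine (tau setT).
have t0 : 0 <= t by rewrite fine_ge0.
have tE : tau setT = t%:E by rewrite fineK// ge0_fin_numE.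
have [->|tn0] := eqVneq t 0; first by rewrite expr0n mulr0 (eform_ge0 kk).
have tp : 0 < t by rewrite lt_neqAle eq_sym tn0.
have ti0 : 0 <= t^-1 by rewrite invr_ge0.
pose s : pmeasure := mscale (NngNum ti0) tau.
have fs : fineE s by exact: (fine_energyZ measurable_cball bigcup_cball kk kC kp).
have s1 : s setT = 1%E.
  by rewrite /s/= /mscale/= [X in (_ * X)%E]tE -EFinM mulVf.
have soo : (s setT < +oo)%E.
  by apply: le_lt_trans (ltry 1); rewrite le_eqVlt; apply/orP; left; apply/eqP; exact: s1.
have H : Eplus1_on alpha Q s.
  split; last exact: s1.
  split; last exact: concentrated_scale.
  exact: fineE_Eplus.
have lb : (min_energy Q <= energy alpha s)%E by apply: ereal_inf_lbound; exists s.
have := le_trans cQ lb.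
rewrite energy_eform// lee_fin /s.
rewrite (eformZl measurable_cball bigcup_cball kk kC kp)//.
rewrite (eformZr measurable_cball bigcup_cball kk kC kp)//=.
by rewrite mulrA -expr2 exprVn mulrC ler_pdivlMr// exprn_gt0.
Qed.

Lemma capacity_lt_min_energy (G : set X) eps : 0 < eps ->
  (inner_capacity alpha G < eps%:E)%E -> ((eps^-1)%:E <= min_energy G)%E.
Proof.
move=> e0 H; have mg : (0 <= min_energy G)%E.
  apply: le_ereal_inf_tmp => _ [mu [[Em _] _] <-].
  by rewrite energyE// dbl_pos.
rewrite -[leRHS]inveK ?inE//.
have -> : (eps^-1)%:E = (eps%:E)^-1%E by rewrite inver gt_eqF.
by rewrite lee_pV2 ?inE ?lee_fin ?inve_ge0// ltW.
Qed.

(** Apply [min_energy_mass] to the restriction of [nu] to [G], whose energy is no larger. The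
    estimate is uniform over all measures with energy at most [M]. *)
Lemma capacity_measure (G : set X) eps (nu : pmeasure) M : open G -> 0 < eps ->
  (inner_capacity alpha G < eps%:E)%E -> fineE nu -> (nu setT < +oo)%E ->
  eform k nu nu <= M -> fine (nu G) ^+ 2 <= eps * M.
Proof.
move=> oG e0 cG fn noo HM; have mG := open_borel oG.
have [fr frle] := fineE_restr alphan mG fn.
have yx : eform k (restr nu mG) (restr nu mG) <= M.
  by apply: le_trans HM; apply: le_trans frle; rewrite lerDl; exact: (eform_ge0 kk).
have cr : concentrated (restr nu mG) G.
  exists (~` G : set T); split => //; first exact: measurableC.
  by rewrite restrE setICl.
have rG : restr nu mG setT = nu G by rewrite restrE setTI.
have roo : (restr nu mG setT < +oo)%E.
  by rewrite rG; apply: le_lt_trans noo; apply: le_measure; rewrite ?inE.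
have := min_energy_mass (capacity_lt_min_energy e0 cG) fr roo cr.
rewrite rG mulrC ler_pdivrMr//.
move=> g2; apply: (le_trans g2); rewrite mulrC.
by apply: ler_wpM2l => //; exact: ltW.
Qed.

Lemma quasiclosed_approx (Q : set X) eps : quasiclosed alpha Q -> 0 < eps ->
  exists F G, [/\ closed F, open G, (Q `\` F) `|` (F `\` Q) `<=` G &
    (inner_capacity alpha G < eps%:E)%E].
Proof.
move=> qQ e0; have : (ereal_inf [set outer_capacity alpha ((Q `\` F) `|` (F `\` Q)) |
             F in [set F : set X | closed F]] < eps%:E)%E by rewrite qQ lte_fin.
move=> /ereal_inf_lt[_ [F cF <-]] /ereal_inf_lt[_ [G [oG QG] <-] cG].
by exists F, G; split.
Qed.

Section limit.
Variables (U : set_system nat) (mu : nat -> pmeasure).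
Context {UU : UltraFilter U}.
Hypothesis mu1 : forall i, mu i setT = 1%E.
Local Notation lambda := (@vague_limit R n U mu UU mu1).
Variable M : R.
Hypothesis muf : forall i, fineE (mu i).
Hypothesis muM : forall i, eform k (mu i) (mu i) <= M.

Let fl : fineE lambda := vague_limit_energy wr (riesz_tw_int alphan) mu1 muf muM.

(** With [F] closed and [G] open of small capacity covering the symmetric difference of [Q] and [F]:
    the complement of [F] is open, so its mass under the limit is controlled by that under some
    [mu i], which lies in [G] up to a null set; and [G] has small mass under both measures. *)
Lemma vague_limit_concentrated (Q : set X) (V : set nat) : quasiclosed alpha Q ->
  U V -> (forall i, V i -> concentrated (mu i) Q) -> concentrated lambda Q.
Proof.
move=> qQ UV cmu.
(* One nonnegative bound for the energies of all [mu i] and of the limit, so that the capacity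
   estimate applies to both. *)
pose M' := Num.max 0 (Num.max M (eform k lambda lambda)).
have e0 (j : nat) : 0 < j.+1%:R^-1 :> R by [].
have /choice[F /choice[G H]] j := quasiclosed_approx qQ (e0 j).
have oG j : open (G j) by case: (H j).
have cF j : closed (F j) by case: (H j).
(* A Borel set containing the complement of [Q], which itself need not be Borel. *)
pose N := \bigcap_j (~` F j `|` G j).
have mFG j : measurable (~` F j `|` G j : set T).
  by apply: measurableU; apply: open_borel => //; exact: closed_openC.
have mN : measurable (N : set T) by exact: bigcapT_measurable.
exists N; split => //; last first.
  move=> x nQ j _; have [Fx|nF] := pselect (F j x); last by left.
  by right; case: (H j) => _ _ + _; apply; right.
apply/eqP; rewrite eq_le measure_ge0 andbT; apply/lee_addgt0Pr => e egt0.
rewrite add0e.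
have e3 : 0 < e / 3 by rewrite divr_gt0.
have [j Hj] : exists j : nat, j.+1%:R^-1 * M' <= (e / 3) ^+ 2.
  have ee : 0 < (e / 3) ^+ 2 by rewrite exprn_gt0.
  exists (Num.truncn (M' / (e / 3) ^+ 2)); rewrite mulrC ler_pdivrMr//.
  by rewrite mulrC -ler_pdivrMr// ltW// truncnS_gt.
have small (nu : pmeasure) : fineE nu -> (nu setT < +oo)%E ->
    eform k nu nu <= M' -> (nu (G j) <= (e / 3)%:E)%E.
  move=> fnu noo nM; have cG : (inner_capacity alpha (G j) < (j.+1%:R^-1)%:E)%E by case: (H j).
  have h := le_trans (capacity_measure (oG j) (e0 j) cG fnu noo nM) Hj.
  have gfin : nu (G j) \is a fin_num.
    rewrite ge0_fin_numE//; apply: le_lt_trans noo; apply: le_measure; rewrite ?inE//.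
    exact: open_borel.
  rewrite -(fineK gfin) lee_fin.
  by rewrite -(@ler_pXn2r _ 2)// nnegrE ?fine_ge0// ltW.
have H1 := @vague_limit_open R n U mu UU mu1 (~` F j) (e / 3) (closed_openC (cF j)) e3.
have [i [Vi Hi]] : exists i, V i /\ (lambda (~` F j) <= mu i (~` F j) + (e / 3)%:E)%E.
  by have [i [h1 h2]] := filter_ex (filterI UV H1); exists i.
have mG := open_borel (oG j).
have mFc : measurable (~` F j : set T) by apply: open_borel; exact: closed_openC.
have l1 : (lambda N <= lambda (~` F j) + lambda (G j))%E.
  apply: (le_trans _ (measureU2 _ mFc mG)).
  by apply: le_measure; rewrite ?inE// => x; exact.
have l2 : (mu i (~` F j) <= mu i (G j))%E.
  have [B [mB B0 QB]] := cmu i Vi.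
  rewrite -[leRHS]adde0 -B0; apply: (le_trans _ (measureU2 _ mG mB)).
  apply: le_measure; rewrite ?inE//; first exact: measurableU.
  move=> x nF; have [Gx|nG] := pselect (G j x); [by left|right].
  apply: QB => Qx; apply: nG; case: (H j) => _ _ + _; apply; left; by split.
have M1 : eform k (mu i) (mu i) <= M' by rewrite !le_max muM orbT.
have M2 : eform k lambda lambda <= M' by rewrite !le_max lexx !orbT.
have s1 := small _ (muf i) _ M1; rewrite mu1 ltry in s1.
have s2 := small _ fl _ M2.
apply: (le_trans l1); have -> : e = (e / 3 + e / 3) + e / 3 by field.
rewrite !EFinD; apply: leeD.
  by apply: (le_trans Hi); rewrite leeD2r//; apply: (le_trans l2); exact: s1.
by apply: s2; apply: le_lt_trans (vague_limit_le1 mu1) _; rewrite ltry.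
Qed.

End limit.

End capacity.

Section no_mass_loss.
Context {R : realType} {n : nat} (alpha : R).
Hypothesis alphan : alpha < n%:R.
Local Notation T := (borel R n).
Local Notation X := 'rV[R]_n.
Local Notation pmeasure := (posmeasure R n).
Local Notation rho := (riesz_weight ((n%:R - alpha) / 2)).
Local Notation k := (@gker R n rho).
Local Notation fineE := (fine_energy (@cball R n) k).

Let wr := wrho alphan.
Let kk := kk (n := n) alphan.
Let kp := kp (n := n) alphan.
Let kC := @kC R n alpha.

Definition oball (j : nat) : set T := [set x : X | `|x| < j%:R].

Lemma open_oball j : open (oball j : set X).
Proof.
rewrite (_ : oball j = (@Num.norm R X) @^-1` [set r | r < j%:R])//.
by apply: open_comp => [x _|]; [exact: norm_continuous|exact: open_lt].
Qed.

Lemma measurable_oball j : measurable (oball j).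
Proof. by apply: open_borel; exact: open_oball. Qed.

Section exhaust.
Variable nu : pmeasure.
Hypothesis fn : fineE nu.
Let mB := measurable_oball.

Let h j (x y : T) : \bar R := (k x y * (\1_(oball j) x * \1_(oball j) y)%:E)%E.

Let mind j : measurable_fun setT (fun z : T * T => (\1_(oball j) z.1 * \1_(oball j) z.2 : R)).
Proof.
by apply: measurable_funM;
  apply: (measurableT_comp (measurable_indic (mB j))).
Qed.

Let hk j : nnkernel (h j).
Proof.
split.
  apply: emeasurable_funM; first exact: kk.1.
  by apply/measurable_EFinP; exact: mind.
by move=> x y; apply: mule_ge0; [exact: kk.2|rewrite lee_fin mulr_ge0].
Qed.

Let hE j : dbl (h j) nu nu = dbl k (restr nu (mB j)) (restr nu (mB j)).
Proof.
have mU : measurable_fun setT (fun x : T => (\int[restr nu (mB j)]_y k x y)%E).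
  have lr := locfin_restr (mB j) fn.1.
  have [s <-] := locfin_sfin measurable_cball bigcup_cball lr.
  exact: (nnkernel_int_measurable s kk).
rewrite [RHS]/dbl ge0_integral_restr; last 2 first.
- exact: mU.
- by move=> x; apply: integral_ge0 => y _; exact: kk.2.
rewrite [RHS]integral_mkcond; apply: eq_integral => x _.
rewrite patchE; have [xB|xB] := boolP (x \in oball j).
  rewrite ge0_integral_restr; last 2 first.
  - exact: (nnkernel_measurable x kk).
  - by move=> y; exact: kk.2.
  rewrite [RHS]integral_mkcond; apply: eq_integral => y _.
  rewrite patchE /h !indicE xB mul1r.
  by case: (_ \in _); rewrite ?mule1 ?mule0.
apply: integral0_eq => y _.
by rewrite /h !indicE (negbTE xB) mul0r mule0.
Qed.

(** The energy of the restriction is the energy for the kernel cut off by the indicator of the ball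
    in both variables; these kernels increase to [k]. *)
Lemma eform_restr_oball eta : 0 < eta ->
  exists j, eform k nu nu - eta <
    eform k (restr nu (measurable_oball j)) (restr nu (measurable_oball j)).
Proof.
move=> eta0; have [s sE] := locfin_sfin measurable_cball bigcup_cball fn.1.
have ind1 (x : T) : \forall j \near \oo, \1_(oball j) x = 1 :> R.
  near=> j; rewrite indicE mem_set//=.
  apply: (@lt_le_trans _ _ (`|x : X| + 1)); first by rewrite ltrDl.
  by near: j; exact: nbhs_infty_ger.
have indnd (x : T) (i j : nat) : (i <= j)%N -> \1_(oball i) x <= \1_(oball j) x :> R.
  move=> ij; rewrite !indicE; case: (boolP (x \in oball i)) => // /set_mem xi.
  by rewrite mem_set//; apply: (lt_le_trans xi); rewrite ler_nat.
have hnd x y : {homo (fun j => h j x y) : i j / (i <= j)%N >-> (i <= j)%E}.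
  move=> i j ij; apply: lee_wpmul2l; first exact: kk.2.
  by rewrite lee_fin; apply: ler_pM => //; exact: indnd.
have := @dbl_cvg _ _ _ h s s hk hnd; rewrite sE.
have -> : dbl (fun x y => limn (fun j => h j x y)) nu nu = dbl k nu nu.
  apply: eq_integral => x _; apply: eq_integral => y _.
  apply/cvg_lim => //; apply: cvg_near_cst; near=> j.
  rewrite /h; have -> : \1_(oball j) x = 1 :> R by near: j; exact: ind1.
  have -> : \1_(oball j) y = 1 :> R by near: j; exact: ind1.
  by rewrite mulr1 mule1.
have eE := eformE measurable_cball bigcup_cball kk kC kp fn fn.
have lt : ((eform k nu nu - eta)%:E < dbl k nu nu)%E.
  by rewrite eE lte_fin ltrBlDr ltrDl.
move=> cv; have : \forall j \near \oo, ((eform k nu nu - eta)%:E < dbl (h j) nu nu)%E.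
  apply: (cv [set z | ((eform k nu nu - eta)%:E < z)%E]); apply: open_nbhs_nbhs.
  by split; [exact: open_ereal_gt_ereal|exact: lt].
move=> /filter_ex[j Hj]; exists j.
have [fr _] := fineE_restr alphan (measurable_oball j) fn.
rewrite -lte_fin -(eformE measurable_cball bigcup_cball kk kC kp fr fr).
by move: Hj; rewrite hE.
Unshelve. all: by end_near. Qed.

End exhaust.

Section limit.
Variables (U : set_system nat) (mu : nat -> pmeasure).
Context {UU : UltraFilter U}.
Hypothesis mu1 : forall i, mu i setT = 1%E.
Local Notation lambda := (@vague_limit R n U mu UU mu1).
Hypothesis muf : forall i, fineE (mu i).
Hypothesis fl : fineE lambda.

(** Cutting a nonnegative lower semicontinuous potential to 0 outside an open ball keeps it lower
    semicontinuous, which is why the balls are open here. *)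
Let restr_lsc j (lamB := restr lambda (measurable_oball j)) eta : 0 < eta ->
  \forall i \near U, eform k lamB lamB - eta <
    eform k (restr (mu i) (measurable_oball j)) lamB.
Proof.
move=> eta0.
have [fB _] := fineE_restr alphan (measurable_oball j) fl.
pose P (x : T) := (\int[lamB]_y k x y)%E.
have P0 x : (0 <= P x)%E by apply: integral_ge0 => y _; exact: kk.2.
have Pl c : open [set x : X | (c%:E < P x)%E] by exact: gker_pot_lsc.
have mP : measurable_fun setT P by apply: lsc_measurable; exact: Pl.
pose h (x : T) := (P \_ (oball j)) x.
have h0 x : (0 <= h x)%E by rewrite /h patchE; case: ifP.
have hl c : open [set x : X | (c%:E < h x)%E].
  case: (ltP c 0) => c0.
    rewrite (_ : [set x | _] = setT); first exact: openT.
    by apply/seteqP; split => // x _ /=; apply: lt_le_trans (h0 x); rewrite lte_fin.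
  rewrite (_ : [set x | _] = oball j `&` [set x | (c%:E < P x)%E]).
    by apply: openI => //; exact: open_oball.
  apply/seteqP; split => x /=; rewrite /h patchE.
    by case: ifPn => [/set_mem|_] //; rewrite lte_fin ltNge c0.
  by move=> [xB cP]; rewrite mem_set.
have HI (m : pmeasure) : (\int[m]_x h x)%E = dbl k (restr m (measurable_oball j)) lamB.
  by rewrite /dbl ge0_integral_restr// [RHS]integral_mkcond.
have := @vague_limit_lsc R n U mu UU mu1 h (eform k lamB lamB - eta) h0 hl.
rewrite HI (eformE measurable_cball bigcup_cball kk kC kp fB fB) lte_fin ltrBlDr ltrDl.
move=> /(_ eta0); apply: filterS => i.
have [fi _] := fineE_restr alphan (measurable_oball j) (muf i).
by rewrite HI (eformE measurable_cball bigcup_cball kk kC kp fi fB) lte_fin.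
Qed.

(* Mass escaping to infinity would carry energy at least [c] times its square,
   which the strong limit does not see. *)
Lemma vague_limit_mass (Q : set X) (c : R) (V : set nat) :
  0 < c -> (c%:E <= min_energy alpha Q)%E ->
  U V -> (forall i, V i -> concentrated (mu i) Q) ->
  (forall eta, 0 < eta -> \forall i \near U,
     eform k (mu i) (mu i) <= eform k lambda lambda + eta) ->
  lambda setT = 1%E.
Proof.
move=> c0 cQ UV cmu strong.
have l1 := vague_limit_le1 mu1.
have loo : (lambda setT < +oo)%E by apply: le_lt_trans (vague_limit_le1 _) _; rewrite ltry.
have lfin : lambda setT \is a fin_num by rewrite ge0_fin_numE.
apply/eqP; rewrite eq_le l1/= leNgt; apply/negP => lt1.
pose m := fine (lambda setT).
have mE : lambda setT = m%:E by rewrite fineK.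
have m1 : m < 1 by rewrite -lte_fin -mE.
pose delta := 1 - m; have d0 : 0 < delta by rewrite subr_gt0.
(* The first bound leaves at least half of the missing mass outside the ball, with energy at least c
   delta^2 / 4. The errors in the energies add up to [4 * eta], by the second bound at most c
   delta^2 / 8, a contradiction. *)
pose eta := Num.min (delta / 2) (c * delta ^+ 2 / 32).
have eta0 : 0 < eta.
  by rewrite lt_min !divr_gt0// mulr_gt0// exprn_gt0.
have [j Hj] := eform_restr_oball fl eta0.
pose lamB := restr lambda (measurable_oball j).
have [fB _] := fineE_restr alphan (measurable_oball j) fl.
(* The upper bound on masses needs a compact ball; the closed one of the same radius contains the
   open one. *)
have H2 := @vague_limit_compact R n U mu UU mu1 (cball j) eta (@compact_cball R n j) eta0.
have : \forall i \near U, V i /\ [/\ eform k lamB lamB - eta <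
    eform k (restr (mu i) (measurable_oball j)) lamB,
    (mu i (cball j) <= lambda (cball j) + eta%:E)%E &
    eform k (mu i) (mu i) <= eform k lambda lambda + eta].
  apply: filterI UV _; apply: filterS3 (restr_lsc j eta0) H2 (strong _ eta0).
  by move=> i; split.
move=> /filter_ex[i [Vi [A1 A2 A3]]].
pose r := restr (mu i) (measurable_oball j).
pose t := restr (mu i) (measurableC (measurable_oball j)).
have [fr sum_le] := fineE_restr alphan (measurable_oball j) (muf i).
have [ft _] := fineE_restr alphan (measurableC (measurable_oball j)) (muf i).
have tE : t setT = mu i (~` oball j) by rewrite restrE setTI.
have mc := measurableC (measurable_oball j).
have tfin : t setT \is a fin_num by rewrite tE; apply: prob_fin.
have toc : (t setT < +oo)%E by rewrite ltey_eq tfin.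
have q := qform_ge0 measurable_cball bigcup_cball kk kC kp fr fB.
have et := min_energy_mass alphan cQ ft toc (concentrated_restr mc (cmu i Vi)).
have t_ge : delta / 2 <= fine (t setT).
  have mcb := @measurable_cball R n j.
  have cfin : mu i (cball j) \is a fin_num by exact: (prob_fin mu1 i mcb).
  have h1 : (1 <= t setT + mu i (cball j))%E.
    rewrite tE -(mu1 i); apply: (le_trans _ (measureU2 _ mc mcb)).
    apply: le_measure; rewrite ?inE//; first exact: measurableU.
    move=> x _; have [xo|] := pselect (oball j x); last by left.
    by right; exact: ltW.
  have h2 : (mu i (cball j) <= m%:E + eta%:E)%E.
    apply: (le_trans A2); rewrite -mE; apply: leeD2r.
    by apply: le_measure; rewrite ?inE.
  have etad : eta <= delta / 2 by rewrite ge_min lexx.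
  move: h1 h2 etad; rewrite -(fineK tfin) -(fineK cfin) -!EFinD !lee_fin /delta.
  by generalize (fine (t setT)) (fine (mu i (cball j))) eta; clear; intros; lra.
have t2 : c * (delta / 2) ^+ 2 <= c * fine (t setT) ^+ 2.
  have ft0 : 0 <= fine (t setT) by apply: fine_ge0; exact: measure_ge0.
  have dh : 0 <= delta / 2 by rewrite divr_ge0// ltW.
  by apply: ler_wpM2l; [exact: ltW|rewrite ler_pXn2r].
have eta1 : eta <= c * delta ^+ 2 / 32 by rewrite ge_min lexx orbT.
have D0 : 0 < c * delta ^+ 2 by rewrite mulr_gt0// exprn_gt0.
have e2 : c * (delta / 2) ^+ 2 = c * delta ^+ 2 / 4 by field.
have sum2 : eform k r r + eform k t t <= eform k (mu i) (mu i) := sum_le.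
have et2 : c * fine (t setT) ^+ 2 <= eform k t t := et.
have A1' : eform k lamB lamB - eta < eform k r lamB := A1.
have q2 : 0 <= eform k r r + eform k lamB lamB - 2 * eform k r lamB := q.
have Hj2 : eform k lambda lambda - eta < eform k lamB lamB := Hj.
move: D0 eta1 t2 Hj2 A1' A3 q2 et2 sum2; rewrite e2.
generalize (c * delta ^+ 2) (c * fine (t setT) ^+ 2) eta (eform k r r) (eform k t t)
  (eform k (mu i) (mu i)) (eform k lambda lambda) (eform k lamB lamB) (eform k r lamB).
by clear; intros; lra.
Qed.

End limit.
End no_mass_loss.

(** * The energy principle *)

Section energy_zero.
Context {R : realType} {n : nat} (alpha : R).
Hypothesis alphan : alpha < n%:R.
Local Notation T := (borel R n).
Local Notation X := 'rV[R]_n.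
Local Notation leb := (@lebesgue_measure R).
Local Notation pmeasure := (posmeasure R n).
Local Notation rho := (riesz_weight ((n%:R - alpha) / 2)).
Local Notation k := (@gker R n rho).
Local Notation fineE := (fine_energy (@cball R n)).
Variables (mu nu : pmeasure).
Hypothesis mu1 : mu setT = 1%E.
Hypothesis nu1 : nu setT = 1%E.
Hypothesis fmu : fineE k mu.
Hypothesis fnu : fineE k nu.
Hypothesis q0 : qform k mu nu <= 0.

Let wr := wrho alphan.

(* With the weight cut down to the window [v0, v0 + r] the kernel is
   comparable to a multiple of one Gaussian and bounded, so Dirac masses have
   finite energy and may be used as test measures. *)
Section window.
Variables v0 r : R.
Hypothesis r0 : 0 < r.

Let A : set R := `[v0, v0 + r]%classic.
Let mA : measurable A := measurable_itv _.
Let tau v : R := rho v * \1_A v.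
Let tau' v : R := rho v * \1_(~` A) v.

Let wtau : weight tau.
Proof.
split; last by move=> v; rewrite mulr_ge0// wr.2.
apply: measurable_funM; first exact: wr.1.
exact: measurable_indic mA.
Qed.

Let wtau' : weight tau'.
Proof.
split; last by move=> v; rewrite mulr_ge0// wr.2.
apply: measurable_funM; first exact: wr.1.
exact: measurable_indic (measurableC mA).
Qed.

Let spl (x y : T) : k x y = (gker tau x y + gker tau' x y)%E.
Proof.
rewrite -(gkerD x y wtau wtau'); congr (gker _ x y); apply/funext => v.
by rewrite /tau /tau' !indicE in_setC; case: (_ \in _); rewrite /= mulr1 mulr0 ?addr0 ?add0r.
Qed.

Let kk := gker_nnkernel (n := n) wtau.
Let kp := gker_posdef (n := n) wtau.
Let kC := @gkerC R n tau.

Let a0 := riesz_exp_gt0 alphan.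

Let tau_int : exists2 c : R, 0 < c & (\int[leb]_v (tau v)%:E = c%:E)%E.
Proof.
have rho_mono u v : u <= v -> rho u <= rho v.
  move=> uv; rewrite /riesz_weight ler_pM2l ?invr_gt0 ?(riesz_cst_gt0 a0)//.
  by rewrite ler_expR ler_pM2l.
have indE (c : R) : (\int[leb]_v ((c * \1_A v)%:E) = (c * r)%:E)%E \/ c < 0.
  have [c0|] := leP 0 c; [left|by right].
  under eq_integral do rewrite EFinM.
  rewrite ge0_integralZl; last 4 first.
  - exact: measurableT.
  - by apply/measurable_EFinP; exact: measurable_indic mA.
  - by move=> v _; rewrite lee_fin.
  - by rewrite lee_fin.
  rewrite integral_indic//= setIT lebesgue_measure_itv/= lte_fin ltrDl r0.
  by rewrite -EFinD [v0 + r]addrC addrK -EFinM.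
have rpos v : 0 < rho v.
  by rewrite /riesz_weight mulr_gt0 ?expR_gt0// invr_gt0 (riesz_cst_gt0 a0).
have mt : measurable_fun setT (EFin \o tau) by apply/measurable_EFinP; exact: wtau.1.
have mc (c : R) : measurable_fun setT (fun v => (c * \1_A v)%:E).
  by apply/measurable_EFinP; apply: measurable_funM => //; exact: measurable_indic mA.
have up : (\int[leb]_v (tau v)%:E <= (rho (v0 + r) * r)%:E)%E.
  have [<-|] := indE (rho (v0 + r)); last by rewrite ltNge (ltW (rpos _)).
  apply: ge0_le_integral.
  - exact: measurableT.
  - by move=> v _; rewrite lee_fin; exact: wtau.2.
  - exact: mt.
  - exact: mc.
  move=> v _; rewrite lee_fin /tau indicE; case: (boolP (v \in A)) => [|_].
    by rewrite inE /A/= in_itv/= => /andP[_ ?]; rewrite !mulr1 rho_mono.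
  by rewrite !mulr0.
have lo : ((rho v0 * r)%:E <= \int[leb]_v (tau v)%:E)%E.
  have [<-|] := indE (rho v0); last by rewrite ltNge (ltW (rpos _)).
  apply: ge0_le_integral.
  - exact: measurableT.
  - by move=> v _; rewrite lee_fin mulr_ge0// ltW.
  - exact: mc.
  - exact: mt.
  move=> v _; rewrite lee_fin /tau indicE; case: (boolP (v \in A)) => [|_].
    by rewrite inE /A/= in_itv/= => /andP[? _]; rewrite !mulr1 rho_mono.
  by rewrite !mulr0.
have fin : (\int[leb]_v (tau v)%:E)%E \is a fin_num.
  rewrite ge0_fin_numE; first by apply: le_lt_trans up _; rewrite ltry.
  by apply: integral_ge0 => v _; rewrite lee_fin; exact: wtau.2.
exists (fine (\int[leb]_v (tau v)%:E)%E); last by rewrite fineK.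
by rewrite -lte_fin fineK//; apply: lt_le_trans lo; rewrite lte_fin mulr_gt0.
Qed.

Let gker_bound c (x y : X) : (\int[leb]_v (tau v)%:E = c%:E)%E ->
  ((c * gauss (expR (v0 + r)) x y)%:E <= gker tau x y <= (c * gauss (expR v0) x y)%:E)%E.
Proof.
move=> tc.
have mg : measurable_fun setT (fun v => gauss (expR v) x y).
  apply: measurableT_comp => //; apply: measurableT_comp => //.
  by apply: measurable_funM.
have mt : measurable_fun setT (EFin \o tau) by apply/measurable_EFinP; exact: wtau.1.
have intc (b : R) : 0 <= b -> (\int[leb]_v ((tau v)%:E * b%:E) = (c * b)%:E)%E.
  move=> b0; rewrite ge0_integralZr; last 4 first.
  - exact: measurableT.
  - exact: mt.
  - by move=> v _; rewrite lee_fin; exact: wtau.2.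
  - by rewrite lee_fin.
  by rewrite tc.
have gm u v : u <= v -> gauss (expR v) x y <= gauss (expR u) x y.
  by move=> uv; rewrite ler_expR lerN2 ler_wpM2r ?d2_ge0// ler_expR.
have mm (b : R) : measurable_fun setT (fun v => ((tau v)%:E * b%:E)%E).
  by apply: emeasurable_funM.
have mk : measurable_fun setT (fun v => (tau v * gauss (expR v) x y)%:E).
  by apply/measurable_EFinP; apply: measurable_funM; [exact: wtau.1|].
have g0 t : 0 <= gauss t x y by exact: expR_ge0.
apply/andP; split.
- rewrite -(intc _ (g0 (expR (v0 + r)))) gkerE; apply: ge0_le_integral.
  + exact: measurableT.
  + by move=> v _; rewrite -EFinM lee_fin mulr_ge0 ?expR_ge0//; exact: wtau.2.
  + exact: mm.
  + exact: mk.
  move=> v _; rewrite -EFinM lee_fin /tau indicE; case: (boolP (v \in A)) => [|_].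
    rewrite inE /A/= in_itv/= => /andP[_ ?]; rewrite !mulr1 ler_wpM2l ?wr.2//.
    exact: gm.
  by rewrite !mulr0 !mul0r.
- rewrite -(intc _ (g0 (expR v0))) gkerE; apply: ge0_le_integral.
  + exact: measurableT.
  + by move=> v _; rewrite lee_fin mulr_ge0 ?expR_ge0//; exact: wtau.2.
  + exact: mk.
  + exact: mm.
  move=> v _; rewrite -EFinM lee_fin /tau indicE; case: (boolP (v \in A)) => [|_].
    rewrite inE /A/= in_itv/= => /andP[? _]; rewrite !mulr1 ler_wpM2l ?wr.2//.
    exact: gm.
  by rewrite !mulr0 !mul0r.
Qed.

(** Cauchy-Schwarz against the Dirac mass at [y]: the mutual energies with it are the values of the
    potentials at [y], and the distance for the window kernel is at most that for [k]. *)
Let pot_eq (y : X) : (\int[mu]_x gker tau x y = \int[nu]_x gker tau x y)%E.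
Proof.
have [c c0 tc] := tau_int.
have f1 := (fineE_split wtau wtau' spl fmu).1.
have f2 := (fineE_split wtau wtau' spl fnu).1.
pose D : pmeasure := dirac (y : T).
have mk1 x : measurable_fun setT (gker tau x) := nnkernel_measurable (x : T) kk.
have dE (m : pmeasure) : dbl (gker tau) m D = (\int[m]_x gker tau x y)%E.
  apply: eq_integral => x _; rewrite integral_dirac//.
  by rewrite diracT mul1e.
have fD : fineE (gker tau) D.
  split; first by apply: (locfin_finite measurable_cball); rewrite /D/= diracT ltry.
  rewrite dE integral_dirac//; last first.
    by apply: (eq_measurable_fun _ (fun x _ => kC y x)); exact: mk1.
  rewrite diracT mul1e; have /andP[_] := gker_bound y y tc.
  by move=> /le_lt_trans; apply; rewrite ltry.
have e1 := eformE measurable_cball bigcup_cball kk kC kp f1 fD.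
have e2 := eformE measurable_cball bigcup_cball kk kC kp f2 fD.
rewrite -!dE e1 e2; congr EFin.
have q1 : qform (gker tau) mu nu <= 0.
  by apply: le_trans q0; exact: (qform_split_le wr wtau wtau' spl).
apply/eqP; rewrite -subr_eq0 -normr_le0; apply/ler_addgt0Pr => e egt0; rewrite add0r.
pose E := eform (gker tau) D D.
have E0 : 0 <= E by exact: (eform_ge0 kk).
(* The free parameter of [eform_sub_le]: since the distance term is at most 0, dividing by it leaves
   twice the difference below s E, hence below [e]. The added 1 covers [E = 0]. *)
have s0 : 0 < e / (E + 1) by rewrite divr_gt0// ltr_wpDl.
have key (e' q z E' : R) : 0 < e' -> q <= 0 -> 0 <= E' -> 0 < e' / (E' + 1) ->
    2 * (e' / (E' + 1)) * z <= q + (e' / (E' + 1)) ^+ 2 * E' -> z <= e'.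
  move=> e'0 q0' E0' s0' H.
  have h2 : e' / (E' + 1) * (2 * z) <= e' / (E' + 1) * (e' / (E' + 1) * E').
    by move: H; set s := e' / (E' + 1); nra.
  move: h2; rewrite ler_pM2l// => h2.
  have h3 : e' / (E' + 1) * E' <= e'.
    by rewrite mulrAC ler_pdivrMr ?ltr_wpDl// ler_pM2l// lerDl.
  by move: e'0 (le_trans h2 h3); lra.
apply: (key _ _ _ E egt0 q1 E0 s0).
exact: (eform_sub_le measurable_cball bigcup_cball kk kC kp f1 f2 fD (ltW s0)).
Qed.

(** [gker_bound] squeezes the window kernel between multiples of two Gaussians, which differ by at
    most [expR r - 1] uniformly in both points. *)
Lemma gauss_window_le (y : X) :
  (\int[mu]_x (gauss (expR v0) x y)%:E <=
   \int[nu]_x (gauss (expR v0) x y)%:E + (expR r - 1)%:E)%E /\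
  (\int[nu]_x (gauss (expR v0) x y)%:E <=
   \int[mu]_x (gauss (expR v0) x y)%:E + (expR r - 1)%:E)%E.
Proof.
have [c c0 tc] := tau_int.
(* With z = e^v0 |x - y|^2 the difference is e^(-z) (1 - e^(-z (e^r - 1))), at most z e^(-z) (e^r -
   1), and z e^(-z) is at most 1. *)
have gd x : gauss (expR v0) x y <= gauss (expR (v0 + r)) x y + (expR r - 1).
  set D := d2 x y; have D0 : 0 <= D by exact: d2_ge0.
  rewrite /gauss expRD -/D; have := expR_gt0 v0; set t := expR v0; move=> t0.
  have t1 : 0 <= t * D by rewrite mulr_ge0// ltW.
  have g1 := expR_ge1Dx (t * D).
  have g2 := expR_ge1Dx (- (t * expR r * D - t * D)).
  have -> : expR (- (t * expR r * D)) = expR (- (t * D)) * expR (- (t * expR r * D - t * D)).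
    by rewrite -expRD; congr expR; ring.
  have r1 : 0 <= expR r - 1 by rewrite subr_ge0 -expR0 ler_expR ltW.
  have g3 : expR (- (t * D)) * (t * D) <= 1.
    rewrite expRN mulrC ler_pdivrMr ?expR_gt0// mul1r; lra.
  have g4 := expR_ge0 (- (t * D)).
  nra.
have mg t : measurable_fun setT (fun x : T => (gauss t x y)%:E).
  apply: (eq_measurable_fun (fun x : T => (gauss t y x)%:E)).
    by move=> x _; rewrite gaussC.
  exact: (nnkernel_measurable (y : T) (gauss_nnkernel t)).
have mk : measurable_fun setT (fun x : T => gker tau x y).
  apply: (eq_measurable_fun (fun x : T => gker tau y x)).
    by move=> x _; rewrite kC.
  exact: (nnkernel_measurable (y : T) kk).
have r1 : 0 <= expR r - 1 by rewrite subr_ge0 -expR0 ler_expR ltW.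
have H (m1 m2 : pmeasure) : m1 setT = 1%E ->
    (\int[m1]_x gker tau x y = \int[m2]_x gker tau x y)%E ->
   (\int[m1]_x (gauss (expR v0) x y)%:E <=
   \int[m2]_x (gauss (expR v0) x y)%:E + (expR r - 1)%:E)%E.
  move=> m11 E12.
  have -> : ((expR r - 1)%:E = \int[m1]_(x in setT) (cst (expR r - 1)%:E x))%E.
    by rewrite (integral_cst m1 measurableT) m11 mule1.
  apply: (@le_trans _ _ (\int[m1]_x ((gauss (expR (v0 + r)) x y)%:E + (cst (expR r - 1)%:E x)))%E).
    apply: ge0_le_integral.
    - exact: measurableT.
    - by move=> x _; rewrite lee_fin expR_ge0.
    - exact: mg.
    - by apply: emeasurable_funD; [exact: mg|exact: measurable_cst].
    - by move=> x _; rewrite -EFinD lee_fin.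
  rewrite ge0_integralD; last 5 first.
  - exact: measurableT.
  - by move=> x _; rewrite lee_fin expR_ge0.
  - exact: mg.
  - by move=> x _; rewrite lee_fin.
  - exact: measurable_cst.
  apply: leeD2r.
  have cE (m : pmeasure) t : (c%:E * \int[m]_x (gauss t x y)%:E = \int[m]_x (c * gauss t x y)%:E)%E.
    rewrite -ge0_integralZl//.
    - by move=> x _; rewrite lee_fin expR_ge0.
    - by rewrite lee_fin ltW.
  rewrite -(@lee_pmul2l _ c%:E)// !cE.
  apply: (@le_trans _ _ (\int[m1]_x gker tau x y)%E).
    apply: ge0_le_integral => //.
    - by move=> x _; rewrite lee_fin mulr_ge0 ?expR_ge0// ltW.
    - by under eq_fun do rewrite EFinM; exact: measurable_funeM.
    - by move=> x _; have /andP[] := gker_bound x y tc.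
  rewrite E12; apply: ge0_le_integral => //.
  - by move=> x _; exact: kk.2.
  - by under eq_fun do rewrite EFinM; exact: measurable_funeM.
  - by move=> x _; have /andP[] := gker_bound x y tc.
by split; apply: H => //; rewrite pot_eq.
Qed.

End window.

Lemma integral_gauss_eq v (y : X) :
  (\int[mu]_x (gauss (expR v) x y)%:E = \int[nu]_x (gauss (expR v) x y)%:E)%E.
Proof.
apply/eqP; rewrite eq_le; apply/andP; split; apply/lee_addgt0Pr => e e0.
  have r0 : 0 < ln (1 + e) by rewrite ln_gt0// ltrDl.
  have [+ _] := gauss_window_le v r0 y.
  by rewrite lnK ?posrE ?ltr_wpDl// [1 + e]addrC addrK.
have r0 : 0 < ln (1 + e) by rewrite ln_gt0// ltrDl.
have [_] := gauss_window_le v r0 y.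
by rewrite lnK ?posrE ?ltr_wpDl// [1 + e]addrC addrK.
Qed.

End energy_zero.

(** * Measures determined by their Gaussian integrals *)

Section ball_indicator.
Context {R : realType}.

Let mult (k : nat) : nat := ((Num.truncn (expR k%:R : R)).+1 * k)%N.

(* Here mult k is about k * e^k, so that (1 - u^k)^(mult k) behaves like
   exp(- k (e u)^k): as k grows, gbump u k tends to 1 if e u >= 1 and to 0
   otherwise. *)
Definition gbump (u : R) (k : nat) : R := 1 - (1 - u ^+ k) ^+ mult k.

Lemma bernoulli_ineq (u : R) m : 0 <= u <= 1 -> 1 - m%:R * u <= (1 - u) ^+ m.
Proof.
move=> /andP[u0 u1]; elim: m => [|m IH]; first by rewrite mul0r subr0 expr0.
rewrite exprS; apply: (@le_trans _ _ ((1 - u) * (1 - m%:R * u))).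
  have : 0 <= m%:R :> R by [].
  rewrite -natr1; move: (m%:R : R) => p p0; nra.
by rewrite ler_wpM2l// subr_ge0.
Qed.

Lemma gbump_itv u k : 0 <= u <= 1 -> 0 <= gbump u k <= 1.
Proof.
move=> /andP[u0 u1].
have uk : 0 <= 1 - u ^+ k by rewrite subr_ge0 exprn_ile1.
have uk1 : 1 - u ^+ k <= 1 by rewrite gerBl exprn_ge0.
by rewrite /gbump subr_ge0 exprn_ile1//= gerBl exprn_ge0.
Qed.

(** The product of [mult k] and u^k is about k e^(k (1 - D)). For D at most 1 it is at least k,
    thanks to the factor [k] in [mult] also at D = 1, so the limit is the indicator of a closed
    ball; for D above 1 Bernoulli's inequality bounds the bump by this product, which tends to 0. *)
Lemma gbump_cvg (D : R) : 0 <= D ->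
  gbump (expR (- D)) k @[k --> \oo] --> ((D <= 1)%R%:R : R).
Proof.
move=> D0; have uE k : expR (- D) ^+ k = expR (- (k%:R * D)).
  by rewrite -expRM_natl mulrN.
have uitv k : 0 <= expR (- D) ^+ k <= 1.
  rewrite exprn_ge0 ?expR_ge0//= exprn_ile1 ?expR_ge0//.
  by rewrite -expR0 ler_expR oppr_le0.
have Mlo k : k%:R * expR k%:R <= (mult k)%:R :> R.
  by rewrite natrM mulrC ler_wpM2r//; exact/ltW/truncnS_gt.
have Mhi k : (mult k)%:R <= 2 * (k%:R * expR k%:R) :> R.
  rewrite natrM -natr1.
  have : (Num.truncn (expR k%:R : R))%:R <= expR k%:R :> R.
    by rewrite truncn_le// expR_ge0.
  have : 1 <= expR k%:R :> R by rewrite -expR0 ler_expR.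
  have : 0 <= k%:R :> R by [].
  by move: (k%:R : R) (expR _) ((Num.truncn _)%:R : R) => a b c; nra.
case: leP => D1 /=.
  rewrite -[X in _ --> X]subr0; apply: cvgB; first exact: cvg_cst.
  apply: (@squeeze_cvgr _ _ _ _ (cst 0) (fun k => expR (-1) ^+ k)).
  - apply: nearW => k; have /andP[u0 u1] := uitv k.
    rewrite exprn_ge0 ?subr_ge0//=.
    apply: (@le_trans _ _ (expR (- expR (- D) ^+ k) ^+ mult k)).
      apply: lerXn2r.
      - by rewrite nnegrE subr_ge0.
      - by rewrite nnegrE expR_ge0.
      - exact: expR_ge1Dx.
    rewrite -!expRM_natl ler_expR !mulrN mulr1 lerN2.
    rewrite -mulrN expRM_natl.
    apply: le_trans (ler_wpM2r u0 (Mlo k)).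
    rewrite -mulrA ler_peMr// uE -expRD -expR0 ler_expR.
    by rewrite subr_ge0 ler_piMr.
  - exact: cvg_cst.
  - apply: cvg_expr; rewrite ger0_norm ?expR_ge0// -expR0 ltr_expR; lra.
(* Chosen so that e^(k (D - 1) / 2) is at least c (k + 1); its square then beats the factor k and
   leaves a multiple of 1 / (k + 1). *)
pose c := Num.min 1 ((D - 1) / 2).
have c0 : 0 < c by rewrite lt_min ltr01 divr_gt0// subr_gt0.
apply: (@squeeze_cvgr _ _ _ _ (cst 0) (fun k => 2 / c ^+ 2 * k.+1%:R^-1)).
- apply: nearW => k; have /andP[u0 u1] := uitv k.
  have /andP[-> _] /= : 0 <= gbump (expR (- D)) k <= 1.
    by apply: gbump_itv; have := uitv 1%N; rewrite expr1.
  rewrite /gbump lerBlDr -lerBlDl.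
  apply: le_trans (bernoulli_ineq _ (uitv k)); rewrite lerD2l lerN2.
  apply: (le_trans (ler_wpM2r u0 (Mhi k))).
  rewrite uE -!mulrA -expRD ler_pM2l//.
  have -> : k%:R - k%:R * D = - (k%:R * ((D - 1) / 2) *+ 2) by rewrite mulr2n; field.
  rewrite expRN ler_pdivrMr ?expR_gt0//.
  rewrite [expR (_ *+ 2)](_ : _ = expR (k%:R * ((D - 1) / 2)) ^+ 2); last first.
    by rewrite mulr2n expRD expr2.
  have e1 : c * k.+1%:R <= expR (k%:R * ((D - 1) / 2)).
    apply: le_trans (expR_ge1Dx _); rewrite -natr1 mulrDr mulr1 addrC lerD//.
      by rewrite ge_min lexx.
    by rewrite mulrC ler_wpM2l// ge_min lexx orbT.
  have e2 : (c * k.+1%:R) ^+ 2 <= expR (k%:R * ((D - 1) / 2)) ^+ 2.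
    by rewrite lerXn2r// ?nnegrE ?expR_ge0// mulr_ge0// ltW.
  have e3 : c ^+ 2 * (k%:R * k.+1%:R) <= (c * k.+1%:R) ^+ 2.
    rewrite exprMn; apply: ler_wpM2l; first exact: sqr_ge0.
    by rewrite [X in _ <= X]expr2; apply: ler_wpM2r => //; rewrite ler_nat.
  have kE : k%:R = (c ^+ 2)^-1 * k.+1%:R^-1 * (c ^+ 2 * (k%:R * k.+1%:R)).
    have : k.+1%:R != 0 :> R by rewrite pnatr_eq0.
    move: (k.+1%:R : R) (k%:R : R) => k1 k' k10; field.
    by rewrite k10 gt_eqF.
  rewrite [X in X <= _]kE; apply: ler_wpM2l; last exact: le_trans e3 e2.
  by rewrite mulr_ge0// invr_ge0 ?sqr_ge0.
- exact: cvg_cst.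
- by rewrite -[X in _ --> X](mulr0 (2 / c ^+ 2)); apply: cvgMr; exact: cvg_harmonic.
Unshelve. all: by end_near.
Qed.

End ball_indicator.

Section rational_balls.
Context {R : realType} {n : nat}.
Local Notation T := (borel R n).
Local Notation X := 'rV[R]_n.

(** Closed balls of radius 1 / (p.2 + 1) with rational centres; their countability turns arbitrary
    unions of open sets into countable unions. *)
Definition qball (p : 'rV[rat]_n * nat) : set X :=
  [set x | d2 x (map_mx ratr p.1) <= (p.2.+1%:R ^+ 2)^-1].

Lemma open_qball (G : set X) (x : X) : open G -> G x ->
  exists2 p, qball p x & qball p `<=` G.
Proof.
move=> oG Gx; have /nbhs_ballP[e /= e0 eG] := open_nbhs_nbhs (conj oG Gx).
pose m := Num.truncn (2 / e); have me : 2 / m.+1%:R < e.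
  by rewrite ltr_pdivrMr// mulrC -ltr_pdivrMr//; exact: truncnS_gt.
(* Coordinatewise precision of the rational centre: the factor [n.+1] absorbs the sum over the [n]
   coordinates, so that [x] lies within 1 / (m + 1) of the centre. *)
pose dl : R := (m.+1 * n.+1)%:R^-1.
have dl0 : 0 < dl by rewrite invr_gt0 ltr0n muln_gt0.
have dlm : dl <= m.+1%:R^-1.
  by rewrite lef_pV2 ?posrE ?ltr0n ?muln_gt0// ler_nat leq_pmulr.
have /choice[q qx] (i : 'I_n) : exists q : rat, `|x ord0 i - ratr q| <= dl.
  have [|q] := @rat_in_itvoo R (x ord0 i - dl) (x ord0 i + dl); first lra.
  by rewrite in_itv/= => /andP[q1 q2]; exists q; rewrite ler_norml; lra.
have le_coord i (y z : X) c : 0 <= c -> d2 y z <= c ^+ 2 -> `|y ord0 i - z ord0 i| <= c.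
  move=> c0 dc; rewrite -(@ler_pXn2r _ 2)// ?nnegrE//.
  rewrite real_normK ?num_real//; apply: le_trans dc.
  by rewrite /d2 (bigD1 i)//= lerDl sumr_ge0// => j _; exact: sqr_ge0.
exists (\row_i q i, m) => [|y].
  rewrite /qball /= /d2.
  apply: (@le_trans _ _ (\sum_(i < n) dl ^+ 2)).
    apply: ler_sum => i _; rewrite !mxE -real_normK ?num_real//.
    by rewrite lerXn2r ?nnegrE// ltW.
  rewrite sumr_const card_ord -[X in X <= _]mulr_natl.
  apply: (@le_trans _ _ (n.+1%:R ^+ 2 * dl ^+ 2)).
    apply: ler_wpM2r; first exact: sqr_ge0.
    by rewrite -natrX ler_nat (leq_trans (leqnSn n))// leq_pmulr.
  have m0 : m.+1%:R != 0 :> R by rewrite pnatr_eq0.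
  have n0 : n.+1%:R != 0 :> R by rewrite pnatr_eq0.
  rewrite /dl natrM; move: (m.+1%:R : R) (n.+1%:R : R) m0 n0 => a b a0 b0.
  rewrite le_eqVlt; apply/orP; left; apply/eqP; field.
  by rewrite a0 b0.
rewrite /qball /= -exprVn => dy; apply: eG; split => // i j.
rewrite (ord1 i) /ball/=.
have := @le_coord j _ _ _ _ dy; rewrite invr_ge0 ler0n => /(_ isT).
rewrite !mxE => h1; have h2 := qx j.
rewrite -[x _ _ - _](subrKA (ratr (q j))).
apply: le_lt_trans (ler_normD _ _) _; rewrite [X in _ + X]distrC.
apply: le_lt_trans me; rewrite mulr_natl mulr2n.
by apply: lerD; [exact: le_trans h2 dlm|exact: h1].
Qed.

Lemma open_bigcup_qball (G : set X) : open G ->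
  G = \bigcup_(p in [set p | qball p `<=` G]) qball p.
Proof.
move=> oG; apply/seteqP; split=> [x Gx|x [p pG] /pG//].
by have [p px pG] := open_qball oG Gx; exists p.
Qed.

Lemma measurable_qball p : measurable (qball p : set T).
Proof.
apply: closed_borel.
rewrite (_ : qball p = (fun x : X => d2 x (map_mx ratr p.1)) @^-1`
  [set r | r <= (p.2.+1%:R ^+ 2)^-1])//.
by apply: closed_comp => [x _|]; [exact: continuous_d2|exact: closed_le].
Qed.

(** Lindelöf's argument: the union is already covered by the countably many rational balls lying in
    one of the sets. It shows that the complement of [msupport] is a null set. *)
Lemma negligible_bigcup_open (mu : posmeasure R n) (P : set (set X)) :
  (forall V, P V -> open V /\ mu V = 0%E) -> mu (\bigcup_(V in P) V) = 0%E.
Proof.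
move=> PV; pose Q := [set p | exists2 V, P V & qball p `<=` V].
have -> : \bigcup_(V in P) V = \bigcup_(p in Q) qball p.
  apply/seteqP; split => [x [V PVV Vx]|x [p [V PVV pV] px]].
    have [p px pV] := open_qball (PV V PVV).1 Vx.
    by exists p => //; exists V.
  by exists V => //; exact: pV.
have mQ p : Q p -> mu (qball p) = 0%E.
  move=> [V PVV pV]; have [oV V0] := PV V PVV.
  by apply: (subset_measure0 (measurable_qball p) (open_borel oV) pV).
have mball : measurable (\bigcup_(p in Q) qball p : set T).
  by rewrite bigcup_mkcond; apply: countable_bigcupT_measurable => // p;
    case: ifP => _; [exact: measurable_qball|exact: measurable0].
apply: (negligibleP _ mball).1.
pose F k : set T := if unpickle k is Some p then if `[< Q p >] then qball p else set0 else set0.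
have F0 k : mu.-negligible (F k).
  rewrite /F; case: (unpickle k) => [p|]; last exact: negligible_set0.
  case: asboolP => Qp; last exact: negligible_set0.
  by apply/negligibleP; [exact: measurable_qball|exact: mQ].
apply: negligibleS (negligible_bigcup F0).
move=> x [p Qp px]; exists (pickle p) => //=; rewrite /F pickleK.
by case: asboolP.
Qed.

End rational_balls.

Section gauss_span.
Context {R : realType} {n : nat}.
Local Notation T := (borel R n).
Local Notation X := 'rV[R]_n.
Local Notation pmeasure := (posmeasure R n).

(** The linear span of the Gaussians is an algebra; [t = 0] is allowed in order to include the
    constants. *)
Inductive gspan : (X -> R) -> Prop :=
| gspan_gauss c t y : 0 <= t -> gspan (fun x => c * gauss t x y)
| gspan_add f g : gspan f -> gspan g -> gspan (fun x => f x + g x).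

Lemma gspan_cst c : gspan (fun=> c).
Proof.
rewrite (_ : (fun=> c) = (fun x : X => c * gauss 0 x 0)); first exact: gspan_gauss.
by apply/funext => x; rewrite /gauss mul0r oppr0 expR0 mulr1.
Qed.

(** Completing the square: the new centre is the weighted mean of the two, and the constant carries
    t t' / (t + t') times their squared distance. The mean is undefined only when both exponents
    vanish. *)
Lemma gaussM t t' (y y' : X) : 0 <= t -> 0 <= t' -> exists c t'' y'', 0 <= t'' /\
  forall x, gauss t x y * gauss t' x y' = c * gauss t'' x y''.
Proof.
move=> t0 t'0; have [tt|tt] := eqVneq (t + t') 0.
  have tz : t = 0 by lra.
  have tz' : t' = 0 by lra.
  by exists 1, 0, 0; split => // x; rewrite /gauss tz tz' !mul0r oppr0 expR0.
exists (expR (- (t * t' / (t + t') * d2 y y'))), (t + t'),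
  ((t + t')^-1 *: (t *: y + t' *: y')); split; first by rewrite addr_ge0.
move=> x; rewrite /gauss -!expRD; congr expR; rewrite -!opprD; congr (- _).
rewrite /d2 !mulr_sumr -!big_split/=; apply: eq_bigr => i _; rewrite !mxE.
by field.
Qed.

Lemma gspan_mul f g : gspan f -> gspan g -> gspan (fun x => f x * g x).
Proof.
elim=> [c t y t0|f1 f2 _ IH1 _ IH2] gg; last first.
  rewrite (_ : (fun _ => _) = (fun x => f1 x * g x + f2 x * g x)).
    by apply: gspan_add; [exact: IH1|exact: IH2].
  by apply/funext => x; rewrite mulrDl.
elim: gg => [c' t' y' t'0|g1 g2 _ IH1 _ IH2]; last first.
  rewrite (_ : (fun _ => _) = (fun x => c * gauss t x y * g1 x + c * gauss t x y * g2 x)).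
    by apply: gspan_add; [exact: IH1|exact: IH2].
  by apply/funext => x; rewrite mulrDr.
have [c2 [t2 [y2 [t20 E]]]] := gaussM y y' t0 t'0.
rewrite (_ : (fun _ => _) = (fun x => (c * c' * c2) * gauss t2 x y2)).
  exact: gspan_gauss.
by apply/funext => x; rewrite mulrACA E mulrA.
Qed.

Lemma gspan_exp f k : gspan f -> gspan (fun x => f x ^+ k).
Proof.
move=> gf; elim: k => [|k IH].
  rewrite (_ : (fun _ => _) = (fun=> 1)); first exact: gspan_cst.
  by apply/funext => x; rewrite expr0.
rewrite (_ : (fun _ => _) = (fun x => f x * f x ^+ k)); first exact: gspan_mul.
by apply/funext => x; rewrite exprS.
Qed.

Lemma gspan_1sub f : gspan f -> gspan (fun x => 1 - f x).
Proof.
move=> gf; rewrite (_ : (fun _ => _) = (fun x => 1 + (-1) * f x)).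
  by apply: gspan_add; [exact: gspan_cst|apply: gspan_mul => //; exact: gspan_cst].
by apply/funext => x; rewrite mulN1r.
Qed.

Lemma gspan_gbump f k : gspan f -> gspan (fun x => gbump (f x) k).
Proof.
by move=> gf; apply: gspan_1sub; apply: gspan_exp; apply: gspan_1sub; exact: gspan_exp.
Qed.

Lemma gspan_prod (I : Type) (s : seq I) (f : I -> X -> R) :
  (forall i, gspan (f i)) -> gspan (fun x => \prod_(i <- s) f i x).
Proof.
move=> gf; elim: s => [|i s IH].
  rewrite (_ : (fun _ => _) = (fun=> 1)); first exact: gspan_cst.
  by apply/funext => x; rewrite big_nil.
rewrite (_ : (fun _ => _) = (fun x => f i x * \prod_(i <- s) f i x)); first exact: gspan_mul.
by apply/funext => x; rewrite big_cons.
Qed.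

Section equal_integrals.
Variables mu nu : pmeasure.
Hypothesis mu1 : mu setT = 1%E.
Hypothesis nu1 : nu setT = 1%E.
Hypothesis gauss_eq : forall v (y : X),
  (\int[mu]_x (gauss (expR v) x y)%:E = \int[nu]_x (gauss (expR v) x y)%:E)%E.

Let integrable_gauss (m : pmeasure) c t (y : X) : m setT = 1%E -> 0 <= t ->
  m.-integrable setT (fun x : T => (c * gauss t x y)%:E).
Proof.
move=> m1 t0; apply: (measurable_bounded_integrable measurableT).
- by rewrite m1 ltry.
- apply: measurable_funM => //; apply: continuous_borel; exact: continuous_gauss.
- exists `|c|; split => // M cM x _; rewrite /= normrM (ger0_norm (expR_ge0 _)).
  by rewrite (le_trans _ (ltW cM))// ler_piMr// gauss_le1.
Qed.

Lemma gspan_integral f : gspan f ->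
  [/\ mu.-integrable setT (fun x : T => (f x)%:E), nu.-integrable setT (fun x : T => (f x)%:E)
    & (\int[mu]_x (f x)%:E = \int[nu]_x (f x)%:E)%E].
Proof.
elim=> [c t y t0|f1 f2 _ [i1 j1 e1] _ [i2 j2 e2]]; last first.
  split.
  - by under eq_fun do rewrite EFinD; exact: integrableD.
  - by under eq_fun do rewrite EFinD; exact: integrableD.
  - under eq_integral do rewrite EFinD.
    under [RHS]eq_integral do rewrite EFinD.
    by rewrite !integralD_EFin// e1 e2.
split; [exact: integrable_gauss|exact: integrable_gauss|].
have zE (m : pmeasure) : m setT = 1%E ->
    (\int[m]_x (c * gauss t x y)%:E = c%:E * \int[m]_x (gauss t x y)%:E)%E.
  move=> m1; rewrite -integralZl//.
  have := @integrable_gauss m 1 t y m1 t0.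
  by under eq_fun do rewrite mul1r.
rewrite !zE//; congr (_ * _)%E; move: t0; rewrite le_eqVlt => /predU1P[<-|t0].
  have g0 (m : pmeasure) : m setT = 1%E -> (\int[m]_x (gauss 0 x y)%:E = 1)%E.
    move=> m1; under eq_integral do rewrite /gauss mul0r oppr0 expR0.
    by rewrite (integral_cst m measurableT) m1 mule1.
  by rewrite !g0.
by rewrite -(lnK (x := t)) ?posrE.
Qed.

Let bint (s : seq ('rV[rat]_n * nat)) : set T := [set x | forall p, p \in s -> @qball R n p x].

Let bintE s (x : X) :
  (\1_(bint s) x : R) = \prod_(p <- s) (p.2.+1%:R ^+ 2 * d2 x (map_mx ratr p.1) <= 1)%R%:R.
Proof.
have qE p : (p.2.+1%:R ^+ 2 * d2 x (map_mx ratr p.1) <= 1)%R = `[< @qball R n p x >].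
  have e : @qball R n p x = (p.2.+1%:R ^+ 2 * d2 x (map_mx ratr p.1) <= 1)%R :> Prop.
    by rewrite /qball/= -[X in _ <= X]mulr1 ler_pdivlMl// exprn_gt0.
  by rewrite e asboolb.
rewrite indicE; case: (boolP (x \in bint s)) => [|].
  rewrite inE => sx; rewrite big_seq big1// => p ps; rewrite qE.
  by have /asboolT -> := sx p ps.
move=> /negP xs; apply/esym/eqP; rewrite prodf_seq_eq0; apply/hasPn => H.
apply: xs; rewrite inE => p /H; rewrite qE pnatr_eq0 eqb0 negbK => /asboolP //.
Qed.

Let measurable_bint s : measurable (bint s).
Proof.
elim: s => [|p s IH].
  by rewrite (_ : bint [::] = setT)//; apply/seteqP; split.
rewrite (_ : bint (p :: s) = (@qball R n p : set T) `&` bint s).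
  by apply: measurableI => //; exact: measurable_qball.
apply/seteqP; split => x /=.
  move=> H; split; first by apply: H; rewrite mem_head.
  by move=> q qs; apply: H; rewrite in_cons qs orbT.
by move=> [px sx] q; rewrite in_cons => /predU1P[->//|/sx].
Qed.

Let bint_eq s : mu (bint s) = nu (bint s).
Proof.
have mb : measurable (bint s) by exact: measurable_bint.
(* The exponent is the inverse squared radius, so that each ball is where the Gaussian is at least 1
   / e, the threshold of [gbump]. *)
pose f k (x : X) : R := \prod_(p <- s) gbump (gauss (p.2.+1%:R ^+ 2) x (map_mx ratr p.1)) k.
have gf k : gspan (f k).
  apply: gspan_prod => p; apply: gspan_gbump.
  rewrite (_ : (fun _ => _) = (fun x => 1 * gauss (p.2.+1%:R ^+ 2) x (map_mx ratr p.1))).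
    by apply: gspan_gauss; exact: sqr_ge0.
  by apply/funext => x; rewrite mul1r.
have f01 k x : 0 <= f k x <= 1.
  rewrite /f; elim/big_rec: _ => [|p y _ /andP[y0 y1]]; first by rewrite ler01 lexx.
  have /andP[b0 b1] : 0 <= gbump (gauss (p.2.+1%:R ^+ 2) x (map_mx ratr p.1)) k <= 1.
    by apply: gbump_itv; rewrite expR_ge0 gauss_le1// sqr_ge0.
  by rewrite mulr_ge0//= mulr_ile1.
have fc x : f k x @[k --> \oo] --> (\1_(bint s) x : R).
  rewrite bintE; apply: cvg_big => [|p _]; first exact: mul_continuous.
  by apply: gbump_cvg; rewrite mulr_ge0 ?sqr_ge0 ?d2_ge0.
have lim (m : pmeasure) : m setT = 1%E ->
    (forall k, m.-integrable setT (fun x : T => (f k x)%:E)) ->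
    (\int[m]_x (f k x)%:E @[k --> \oo] --> m (bint s))%E.
  move=> m1 fi.
  have := @dominated_cvg _ T R m setT measurableT (fun k x => (f k x)%:E)
    (fun x => (\1_(bint s) x)%:E) (cst 1%E).
  rewrite integral_indic//= setIT; apply.
  - by move=> k; exact: measurable_int (fi k).
  - by move=> x _; apply: cvg_EFin; [exact: nearW|exact: fc].
  - by [].
  - apply/integrableP; split => //; under eq_integral do rewrite abse1.
    by rewrite (integral_cst m measurableT) m1 mule1 ltry.
  - by move=> k x _; have /andP[f0 f1] := f01 k x; rewrite lee_fin ger0_norm.
have i1 k := (gspan_integral (gf k)).
have l1 := lim mu mu1 (fun k => let: And3 a _ _ := i1 k in a).
have l2 := lim nu nu1 (fun k => let: And3 _ a _ := i1 k in a).
have E : (fun k => \int[mu]_x (f k x)%:E)%E = (fun k => \int[nu]_x (f k x)%:E)%E.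
  by apply/funext => k; case: (i1 k).
move: l1; rewrite E => l1; have h2 := cvg_lim (@ereal_hausdorff R) l2.
have h1 := cvg_lim (@ereal_hausdorff R) l1.
by rewrite -h1 -h2.
Qed.

(** Finite intersections of rational balls form a pi-system, which contains the whole space as the
    empty intersection and generates the open sets by countable unions. *)
Lemma gauss_measure_eq (A : set T) : measurable A -> mu A = nu A.
Proof.
move=> mA; apply: (g_sigma_algebra_measure_unique (range bint) _ (fun=> bint [::])).
- move=> _ [s _ <-]; exact: measurable_bint.
- by move=> _; exists [::].
- by apply/seteqP; split => // x _; exists 0%N.
- move=> _ _ [s _ <-] [s' _ <-]; exists (s ++ s') => //.
  apply/seteqP; split => [x H|x [H H'] p].
    by split=> p ps; apply: H; rewrite mem_cat ps ?orbT.
  by rewrite mem_cat => /orP[/H|/H'].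
- by move=> _ [s _ <-]; exact: bint_eq.
- move=> _; rewrite (_ : bint [::] = setT); first by rewrite mu1 ltry.
  by apply/seteqP; split.
- move: A mA; apply: smallest_sub; first exact: smallest_sigma_algebra.
  move=> G oG; rewrite (open_bigcup_qball oG) bigcup_mkcond.
  apply: (@countable_bigcupT_measurable _ (g_sigma_algebraType (range bint))) => // p.
  case: ifP => _; last exact: measurable0.
  apply: sub_sigma_algebra; exists [:: p] => //.
  apply/seteqP; split => [x H|x px q]; first by apply: H; rewrite mem_head.
  by rewrite inE => /eqP ->.
Qed.

End equal_integrals.
End gauss_span.

(** * Minimizing sequences *)

Section variational_problem.
Context {R : realType} {n : nat} (alpha : R).
Hypothesis alphan : alpha < n%:R.
Local Notation T := (borel R n).
Local Notation X := 'rV[R]_n.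
Local Notation pmeasure := (posmeasure R n).
Local Notation rho := (riesz_weight ((n%:R - alpha) / 2)).
Local Notation k := (@gker R n rho).
Local Notation fk := (fine_energy (@cball R n) k).

Let kk := kk (n := n) alphan.
Let kp := kp (n := n) alphan.
Let kC := @kC R n alpha.

Definition riesz_fine (mu : pmeasure) : Prop := fk mu.
Definition riesz_form (mu nu : pmeasure) : R := eform k mu nu.
Definition riesz_q (mu nu : pmeasure) : R :=
  riesz_form mu mu + riesz_form nu nu - 2 * riesz_form mu nu.

Local Notation fineE := riesz_fine.
Local Notation e := riesz_form.
Local Notation q := riesz_q.
Implicit Types mu nu m : pmeasure.

Lemma riesz_formC mu nu : fineE mu -> fineE nu -> e mu nu = e nu mu.
Proof. exact: (eformC measurable_cball bigcup_cball kk kC). Qed.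

Lemma riesz_formDl mu nu m : fineE mu -> fineE nu -> fineE m ->
  e (measure_add mu nu) m = e mu m + e nu m.
Proof. exact: (eformDl measurable_cball bigcup_cball kk kC kp). Qed.

Lemma riesz_formZl (c : {nonneg R}) mu m : fineE mu -> fineE m ->
  e (mscale c mu) m = c%:num * e mu m.
Proof. exact: (eformZl measurable_cball bigcup_cball kk kC kp). Qed.

Lemma riesz_fineD mu nu : fineE mu -> fineE nu -> fineE (measure_add mu nu).
Proof. exact: (fine_energyD measurable_cball bigcup_cball kk kC kp). Qed.

Lemma riesz_fineZ (c : {nonneg R}) mu : fineE mu -> fineE (mscale c mu).
Proof. exact: (fine_energyZ measurable_cball bigcup_cball kk kC kp). Qed.

Lemma riesz_q_ge0 mu nu : fineE mu -> fineE nu -> 0 <= q mu nu.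
Proof. exact: (qform_ge0 measurable_cball bigcup_cball kk kC kp). Qed.

Lemma riesz_qC mu nu : fineE mu -> fineE nu -> q mu nu = q nu mu.
Proof. exact: (qformC measurable_cball bigcup_cball kk kC). Qed.

Lemma riesz_form_ge0 mu nu : 0 <= e mu nu.
Proof. exact: (eform_ge0 kk). Qed.

Lemma riesz_form_sub_le mu nu m s : fineE mu -> fineE nu -> fineE m -> 0 <= s ->
  2 * s * `|e mu m - e nu m| <= q mu nu + s ^+ 2 * e m m.
Proof. exact: (eform_sub_le measurable_cball bigcup_cball kk kC kp). Qed.

Let hf : {nonneg R} := (2^-1)%:nng.

Definition midpoint (mu nu : pmeasure) : pmeasure :=
  measure_add (mscale hf mu) (mscale hf nu).

Lemma midpointE mu nu A :
  midpoint mu nu A = ((2^-1)%:E * mu A + (2^-1)%:E * nu A)%E.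
Proof. exact: measure_addE. Qed.

Lemma fineE_midpoint mu nu : fineE mu -> fineE nu -> fineE (midpoint mu nu).
Proof. by move=> f1 f2; apply: riesz_fineD; exact: riesz_fineZ. Qed.

Lemma eform_midpointl mu nu m : fineE mu -> fineE nu -> fineE m ->
  e (midpoint mu nu) m = (e mu m + e nu m) / 2.
Proof.
move=> f1 f2 fm; rewrite /midpoint riesz_formDl; [|exact: riesz_fineZ|exact: riesz_fineZ|exact: fm].
rewrite (riesz_formZl hf f1 fm) (riesz_formZl hf f2 fm) /=.
generalize (e mu m) (e nu m); intros; lra.
Qed.

Lemma eform_midpoint mu nu : fineE mu -> fineE nu ->
  e (midpoint mu nu) (midpoint mu nu) = (e mu mu + e nu nu) / 2 - q mu nu / 4.
Proof.
move=> f1 f2; have fm := fineE_midpoint f1 f2.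
rewrite (eform_midpointl f1 f2 fm) (riesz_formC f1 fm) (riesz_formC f2 fm).
rewrite (eform_midpointl f1 f2 f1) (eform_midpointl f1 f2 f2) (riesz_formC f2 f1) /riesz_q.
generalize (e mu mu) (e nu nu) (e mu nu); intros; lra.
Qed.

(** Cauchy-Schwarz again: mutual energy with a fixed measure is continuous for the energy distance.
    This is what lets both parts of theta pass to the limit. *)
Lemma eform_near lam theta eta : fineE lam -> fineE theta -> 0 < eta ->
  exists2 delta, 0 < delta & forall mu, fineE mu -> q lam mu <= delta ->
    `|e mu theta - e lam theta| <= eta.
Proof.
move=> fl ft eta0; pose E := e theta theta.
have E0 : 0 <= E by exact: riesz_form_ge0.
pose s := eta / (E + 1); have s0 : 0 < s by rewrite divr_gt0// ltr_wpDl.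
exists (s * eta); first by rewrite mulr_gt0.
move=> mu fm qle; have sE : s * (E + 1) = eta by rewrite /s mulfVK// gt_eqF// ltr_wpDl.
have key (Q x E' s' : R) : 0 < s' -> s' * (E' + 1) = eta -> 0 <= E' -> Q <= s' * eta ->
    2 * s' * x <= Q + s' ^+ 2 * E' -> x <= eta.
  move=> s'0 s'E E'0 QE H.
  have h1 : s' ^+ 2 * E' <= s' * eta.
    by rewrite expr2 -mulrA ler_pM2l// -s'E ler_pM2l// lerDl.
  have h2 : s' * (2 * x) <= s' * (2 * eta).
    move: H QE h1; rewrite mulrCA -mulrA mulrCA [s' * (2 * eta)]mulrCA.
    by move: (s' * eta) (s' ^+ 2 * E') (s' * x); intros; lra.
  by move: h2; rewrite ler_pM2l// ler_pM2l.
rewrite distrC; apply: (key _ _ _ _ s0 sE E0 qle).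
exact: (riesz_form_sub_le fl fm ft (ltW s0)).
Qed.

Variables (h : T -> \bar R) (tp tn : pmeasure) (cst0 : R).
Hypothesis h0 : forall x, (0 <= h x)%E.
Hypothesis hlsc : forall c : R, open [set x : X | (c%:E < h x)%E].
Hypothesis ftp : fineE tp.
Hypothesis ftn : fineE tn.

Definition admissible (Q : set X) : set pmeasure :=
  [set mu : pmeasure | [/\ mu setT = 1%E, fineE mu, concentrated mu Q & (\int[mu]_x h x < +oo)%E]].

Let P (mu : pmeasure) := fine (\int[mu]_x h x)%E.

(** The weighted energy for the field h + U^tp - U^tn - cst0, as a real number; the mass one of the
    competitors turns [cst0] into an additive constant. *)
Definition Jfun (mu : pmeasure) : R := e mu mu + 2 * (P mu + e mu tp - e mu tn - cst0).

Let P0 (mu : pmeasure) : 0 <= P mu.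
Proof. by rewrite /P fine_ge0// integral_ge0. Qed.

Let PE (mu : pmeasure) : (\int[mu]_x h x < +oo)%E -> (\int[mu]_x h x = (P mu)%:E)%E.
Proof. by move=> hoo; rewrite fineK// ge0_fin_numE// integral_ge0. Qed.

(* Minus a lower bound of [Jfun], see [Jfun_ge]. *)
Let B := 2 * e tn tn + 2 * cst0.

(** I(mu / 2 - tn) >= 0 lets half of the energy absorb the only negative term that depends on [mu].
    A bound on [Jfun] therefore bounds the energy. *)
Lemma Jfun_ge mu : fineE mu -> e mu mu / 2 - B <= Jfun mu.
Proof.
move=> fm; have := riesz_q_ge0 (riesz_fineZ hf fm) ftn.
rewrite /riesz_q (riesz_formZl hf fm ftn) (riesz_formZl hf fm (riesz_fineZ hf fm)).
rewrite (riesz_formC fm (riesz_fineZ hf fm)) (riesz_formZl hf fm fm) /=.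
rewrite /Jfun /B; have := P0 mu; have := riesz_form_ge0 mu tp.
generalize (e mu mu) (e tn tn) (e mu tn) (e mu tp) (P mu); intros; lra.
Qed.

Lemma admissible_midpoint Q mu nu : admissible Q mu -> admissible Q nu ->
  admissible Q (midpoint mu nu).
Proof.
move=> [m1 fm cm hm] [n1 fn cn hn]; split.
- rewrite midpointE m1 n1 !mule1 -EFinD.
  by congr EFin; lra.
- exact: fineE_midpoint.
- have [N [mN N0 QN]] := cm; have [N' [mN' N'0 QN']] := cn.
  exists (N `&` N'); split; first exact: measurableI.
    apply/eqP; rewrite eq_le measure_ge0 andbT midpointE.
    have -> : mu (N `&` N') = 0%E.
      by apply/eqP; rewrite eq_le measure_ge0 andbT -N0 le_measure ?inE//; exact: measurableI.
    have -> : nu (N `&` N') = 0%E.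
      by apply/eqP; rewrite eq_le measure_ge0 andbT -N'0 le_measure ?inE//; exact: measurableI.
    by rewrite !mule0 adde0.
  by move=> x Qx; split; [exact: QN|exact: QN'].
- have mh : measurable_fun setT h by exact: lsc_measurable.
  rewrite ge0_integral_measure_add//.
  rewrite !ge0_integral_mscale//.
  by rewrite (PE hm) (PE hn) -!EFinM -EFinD ltry.
Qed.

Lemma Jfun_midpoint Q mu nu : admissible Q mu -> admissible Q nu ->
  Jfun (midpoint mu nu) = (Jfun mu + Jfun nu) / 2 - q mu nu / 4.
Proof.
move=> [m1 fm cm hm] [n1 fn cn hn].
rewrite /Jfun (eform_midpoint fm fn) (eform_midpointl fm fn ftp) (eform_midpointl fm fn ftn).
have -> : P (midpoint mu nu) = (P mu + P nu) / 2.
  have mh : measurable_fun setT h by exact: lsc_measurable.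
  rewrite {1}/P ge0_integral_measure_add//.
  rewrite !ge0_integral_mscale//.
  by rewrite (PE hm) (PE hn) -!EFinM -EFinD /=; lra.
generalize (e mu mu) (e nu nu) (q mu nu) (P mu) (P nu) (e mu tp) (e nu tp) (e mu tn) (e nu tn).
intros; lra.
Qed.

(** A real infimum, with a junk value when no measure is admissible; hence the nonemptiness
    hypotheses below. *)
Definition winf (Q : set X) : R := inf [set Jfun mu | mu in admissible Q].

Lemma winf_lbound Q : has_lbound [set Jfun mu | mu in admissible Q].
Proof.
exists (- B) => _ [mu [_ fm _ _] <-]; apply: le_trans (Jfun_ge fm).
by rewrite lerDr divr_ge0// riesz_form_ge0.
Qed.

Lemma winf_le Q mu : admissible Q mu -> winf Q <= Jfun mu.
Proof. by move=> am; apply: ge_inf; [exact: winf_lbound|exists mu]. Qed.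

(** The midpoint is a competitor, and its value is the mean of the two minus a quarter of the
    squared distance. The Cauchy property, uniqueness and strong convergence of minimizers all come
    from this estimate. *)
Lemma qform_le Q mu nu : admissible Q mu -> admissible Q nu ->
  q mu nu <= 2 * Jfun mu + 2 * Jfun nu - 4 * winf Q.
Proof.
move=> am an; have := winf_le (admissible_midpoint am an).
rewrite (Jfun_midpoint am an).
generalize (q mu nu) (Jfun mu) (Jfun nu) (winf Q); intros; lra.
Qed.

Lemma admissibleS Q Q' : Q `<=` Q' -> admissible Q `<=` admissible Q'.
Proof. by move=> QQ mu [m1 fm cm hm]; split => //; exact: concentratedS cm. Qed.

Lemma winfS Q Q' : Q `<=` Q' -> admissible Q !=set0 -> winf Q' <= winf Q.
Proof.
move=> QQ [mu am]; apply: lb_le_inf; first by exists (Jfun mu), mu.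
by move=> _ [nu an <-]; apply: winf_le; exact: admissibleS an.
Qed.

Lemma winf_near Q eps : 0 < eps -> admissible Q !=set0 ->
  exists2 mu, admissible Q mu & Jfun mu <= winf Q + eps.
Proof.
move=> eps0 [mu am]; have [|_ [nu an <-] /ltW Jn] := @inf_adherent R
  [set Jfun mu | mu in admissible Q] eps eps0.
  by split; [exists (Jfun mu), mu|exact: winf_lbound].
by exists nu.
Qed.

Section minimizing_sequence.
Variables (Qs : nat -> set X) (c : R) (mu : nat -> pmeasure) (U : set_system nat).
Hypothesis Qdecr : forall i j, (i <= j)%N -> Qs j `<=` Qs i.
Hypothesis Qqc : forall i, quasiclosed alpha (Qs i).
Hypothesis c0 : 0 < c.
Hypothesis Qc : (c%:E <= min_energy alpha (Qs 0%N))%E.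
Let Qinf := \bigcap_i Qs i.
Hypothesis Qne : admissible Qinf !=set0.
Hypothesis amu : forall i, admissible (Qs i) (mu i).
(** The slack admits both almost minimizers, from which existence is derived, and true minimizers,
    whose vague limits are to be identified. *)
Hypothesis Jmu : forall i, Jfun (mu i) <= winf (Qs i) + i.+1%:R^-1.
Hypothesis mu1 : forall i, mu i setT = 1%E.
Context {UU : UltraFilter U}.
Hypothesis Uoo : \oo `<=` U.

Let W i := winf (Qs i).
Let Qne' i : admissible (Qs i) !=set0.
Proof. by have [m am] := Qne; exists m; apply: admissibleS am => x; exact. Qed.

Let Wmono : nondecreasing_seq W.
Proof. by move=> i j ij; apply: winfS; [exact: Qdecr|exact: Qne']. Qed.

Let Wub i : W i <= winf Qinf.
Proof. by apply: winfS => // x; exact. Qed.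

Let Wcvg : cvgn W.
Proof.
apply: nondecreasing_is_cvgn => //.
by exists (winf Qinf) => _ [i _ <-]; exact: Wub.
Qed.

Let w := limn W.
(* The parallelogram law bounds the squared distance of [mu i] and [mu j] by
   [dl i + dl j]. *)
Let dl i := 2 * i.+1%:R^-1 + 2 * (w - W i).

Let Ww i : W i <= w.
Proof. exact: nondecreasing_cvgn_le. Qed.

Let dl_cvg : dl i @[i --> \oo] --> 0.
Proof.
rewrite -[X in _ --> X]addr0; apply: cvgD.
  by rewrite -[X in _ --> X](mulr0 2); apply: cvgMr; exact: cvg_harmonic.
rewrite -[X in _ --> X](mulr0 2); apply: cvgMr.
by rewrite -[X in _ --> X](subrr w); apply: cvgB; [exact: cvg_cst|exact: Wcvg].
Qed.

Let dl_near eta : 0 < eta -> \forall i \near \oo, dl i <= eta.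
Proof.
move=> eta0; have /cvgrPdist_le/(_ _ eta0) := dl_cvg; apply: filterS => i.
by rewrite sub0r normrN => /(le_trans (ler_norm _)).
Qed.

Let fmu i : fineE (mu i). Proof. by have [] := amu i. Qed.

Let q_le i j : q (mu i) (mu j) <= dl i + dl j.
Proof.
wlog ij : i j / (i <= j)%N.
  move=> H; have [/H//|/ltnW/H] := leqP i j.
  by rewrite (riesz_qC (fmu j) (fmu i)) [dl j + _]addrC.
(* The later measure also competes on the earlier, larger set, so the two can be compared there. *)
have am : admissible (Qs i) (mu j) by exact: admissibleS (Qdecr ij) _ (amu j).
apply: (le_trans (qform_le (amu i) am)); rewrite /dl.
have := Jmu i; have := Jmu j; have := Ww i; have := Ww j; rewrite -/(W i) -/(W j).
move: (i.+1%:R^-1) (j.+1%:R^-1) => a b; generalize (Jfun (mu i)) (Jfun (mu j)) (W i) (W j) w.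
intros; lra.
Qed.

Let Jw i : Jfun (mu i) <= w + i.+1%:R^-1.
Proof. by apply: (le_trans (Jmu i)); rewrite lerD2r; exact: Ww. Qed.

Let Emax := 2 * (w + 1 + B).
Let emu i : e (mu i) (mu i) <= Emax.
Proof.
have := Jw i; have : i.+1%:R^-1 <= 1 :> R by rewrite invf_le1// ler1n.
have := Jfun_ge (fmu i); rewrite /Emax.
move: (i.+1%:R^-1) => a; generalize (e (mu i) (mu i)) (Jfun (mu i)) B w; intros; lra.
Qed.

Let wr := wrho (n := n) alphan.
Let tw_int := riesz_tw_int (n := n) alphan.
Local Notation lam := (@vague_limit R n U mu UU mu1).

Let flam : fineE lam.
Proof. exact: (vague_limit_energy wr tw_int mu1 fmu emu). Qed.

Let q_lam j : q lam (mu j) <= dl j.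
Proof.
apply/ler_addgt0Pr => eta eta0.
apply: (vague_limit_strong wr tw_int fmu flam (Uoo (dl_near eta0))) => i /= di.
by apply: (le_trans (q_le i j)); rewrite addrC lerD2l.
Qed.

Let near_e theta eta : fineE theta -> 0 < eta ->
  \forall i \near \oo, `|e (mu i) theta - e lam theta| <= eta.
Proof.
move=> ft eta0; have [delta d0 H] := eform_near flam ft eta0.
by apply: filterS (dl_near d0) => i di; apply: H => //; exact: le_trans (q_lam i) di.
Qed.

Let near_ee eta : 0 < eta ->
  \forall i \near \oo, `|e (mu i) (mu i) - e lam lam| <= eta.
Proof.
move=> eta0; have eta4 : 0 < eta / 4 by rewrite divr_gt0.
apply: filterS2 (near_e flam eta4) (dl_near eta4) => i.
have := q_lam i; have := riesz_q_ge0 flam (fmu i).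
rewrite /riesz_q (riesz_formC flam (fmu i)) !ler_norml.
generalize (e (mu i) lam) (e lam lam) (e (mu i) (mu i)) (dl i); intros; lra.
Qed.

Let conc i : concentrated lam (Qs i).
Proof.
have Ui : U [set j | (i <= j)%N] by apply: Uoo; exact: nbhs_infty_ge.
apply: (@vague_limit_concentrated R n alpha alphan U mu UU mu1 Emax fmu emu
  (Qs i) _ (Qqc i) Ui) => j ij.
by have [_ _ + _] := amu j; apply: concentratedS; exact: Qdecr.
Qed.

Let lam1 : lam setT = 1%E.
Proof.
apply: (vague_limit_mass alphan fmu flam c0 Qc (V := setT)).
- exact: filterT.
- by move=> i _; have [_ _ + _] := amu i; apply: concentratedS; exact: Qdecr.
- move=> eta eta0; apply: Uoo; apply: filterS (near_ee eta0) => i H.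
  suff : e (mu i) (mu i) <= e lam lam + eta by exact.
  move: H; rewrite ler_norml; generalize (e (mu i) (mu i)) (e lam lam). intros; lra.
Qed.

(** The inequality [Jfun (mu i) <= w + 1 / (i + 1)] solved for the integral of [h]: all other terms
    converge, and the integral of [h] can only drop in the limit. Finiteness of that integral is
    part of the conclusion. *)
Let Plam : (\int[lam]_x h x <=
  ((w - e lam lam) / 2 - e lam tp + e lam tn + cst0)%:E)%E.
Proof.
set C := (X in (_ <= X%:E)%E); rewrite leNgt; apply/negP => /lte_between[b /andP[]].
rewrite lte_fin => Cb bh.
(* The errors of the energy, of the two mutual energies and of the slack sum to at most
   [3 * eta]. *)
pose eta := (b - C) / 8; have eta0 : 0 < eta by rewrite divr_gt0// subr_gt0.
have H0 : U [set i | (b%:E < \int[mu i]_x h x)%E] :=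
  @vague_limit_lsc R n U mu UU mu1 h b h0 hlsc bh.
have H1 := Uoo (filterI (near_ee eta0) (filterI (near_e ftp eta0) (near_e ftn eta0))).
have H2 : U [set i | (i.+1%:R^-1 <= eta :> R)%R].
  apply: Uoo; have /cvgrPdist_le/(_ _ eta0) := @cvg_harmonic R; apply: filterS => i.
  by rewrite sub0r normrN; exact: (le_trans (ler_norm _)).
have Foo : Filter (nbhs (\oo : set_system nat)) by exact: filter_filter.
have {}H1 := H1 Foo Foo.
have UF : Filter U by exact: filter_filter.
have H3 : U _ := @filterI _ U UF _ _ H0 (@filterI _ U UF _ _ H1 H2).
have : U [set i | False].
  move: H3; apply: filterS => i [bi [[h1 [h2 h3]] h4]].
  have [_ _ _ hoo] := amu i; move: bi => /=; rewrite (PE hoo) lte_fin => bP.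
  clear bh hoo H0 H1 H2; move: (Jw i) h1 h2 h3 h4 bP Cb => /=; rewrite /Jfun /C /eta /C !ler_norml.
  move: (i.+1%:R^-1) => a.
  generalize (e (mu i) (mu i)) (e (mu i) tp) (e (mu i) tn) (P (mu i))
    (e lam lam) (e lam tp) (e lam tn) w.
  intros; lra.
by move/filter_ex => [].
Qed.

Let alam : admissible Qinf lam.
Proof.
split=> [||| ]; [exact: lam1|exact: flam| |exact: le_lt_trans Plam (ltry _)].
rewrite /concentrated /Qinf setC_bigcap; apply: negligible_bigcup => i; exact: conc.
Qed.

(** The chain J(lam) <= w <= winf Qinf <= J(lam) closes up. *)
Lemma minimizing_limit : [/\ admissible Qinf lam, Jfun lam = winf Qinf &
  W i @[i --> \oo] --> winf Qinf].
Proof.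
have Jle : Jfun lam <= w.
  have [_ _ _ hoo] := alam; move: Plam; rewrite (PE hoo) lee_fin /Jfun; clear hoo.
  generalize (P lam) (e lam lam) (e lam tp) (e lam tn) w; intros; lra.
have wle : w <= winf Qinf by apply: limr_le => //; apply: nearW; exact: Wub.
have winfE : winf Qinf = w.
  by apply/eqP; rewrite eq_le wle andbT; exact: le_trans (winf_le alam) Jle.
split; [exact: alam| |by rewrite winfE; exact: Wcvg].
by apply/eqP; rewrite eq_le (winf_le alam) andbT winfE.
Qed.

End minimizing_sequence.

End variational_problem.

(** * From limits along ultrafilters to convergence of sequences *)

Section vague_convergence.
Context {R : realType} {n : nat}.
Local Notation T := (borel R n).
Local Notation X := 'rV[R]_n.
Local Notation pmeasure := (posmeasure R n).

(** If the sequence is not eventually in a neighbourhood [A], the indices where it lies outside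
    carry a proper trace of the filter at infinity; an ultrafilter extending that trace contradicts
    the hypothesis. *)
Lemma cvg_ultrafilters (V : topologicalType) (u : nat -> V) (l : V) :
  (forall U : set_system nat, UltraFilter U -> \oo `<=` U -> u @ U --> l) ->
  u @ \oo --> l.
Proof.
move=> H A lA; apply: contrapT => nA.
pose F : set_system nat := within (~` (u @^-1` A)) \oo.
have PF : ProperFilter F.
  apply: Build_ProperFilter_ex => P FP.
  apply: contrapT => /forallNP nP; apply: nA.
  have {}FP : \oo [set i | (~` (u @^-1` A)) i -> P i] := FP.
  suff : \oo (u @^-1` A) by [].
  apply: filterS FP => i /= Pi.
  by apply: contrapT => nui; apply: (nP i); exact: Pi.
have [U [UU FU]] := ultraFilterLemma PF.
have oU : \oo `<=` U.
  by move=> B oB; apply: FU; rewrite /F /within /=; apply: filterS oB => i Bi _.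
have UA : U (u @^-1` A) := H U UU oU A lA.
have UnA : U (~` (u @^-1` A)) by apply: FU; rewrite /F /within /=; exact: filterE.
by have [i [? ?]] := filter_ex (filterI UA UnA).
Qed.

Variables (mu : nat -> pmeasure) (nu : pmeasure).
Hypothesis mu1 : forall i, mu i setT = 1%E.
Hypothesis limE : forall (U : set_system nat) (UU : UltraFilter U), \oo `<=` U ->
  forall A, measurable A -> @vague_limit R n U mu UU mu1 A = nu A.

Section bounded_nonnegative.
Variables (phi : X -> R) (M : R).
Hypothesis phic : continuous phi.
Hypothesis phi0 : forall x, 0 <= phi x.
Hypothesis phiM : forall x, phi x <= M.
Hypothesis phik : forall c, 0 < c -> compact [set x | c <= phi x].

Lemma integral_cvg_nonnegative :
  (\int[nu]_x (phi x)%:E < +oo)%E /\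
  fine (\int[mu i]_x (phi x)%:E)%E @[i --> \oo] --> fine (\int[nu]_x (phi x)%:E)%E.
Proof.
have M0 : 0 <= M by exact: le_trans (phi0 0) (phiM 0).
have mphi : measurable_fun setT (fun x : T => (phi x)%:E).
  by apply/measurable_EFinP; exact: continuous_borel.
have bound (m : pmeasure) : (m setT <= 1)%E -> (\int[m]_x (phi x)%:E <= M%:E)%E.
  move=> m1; apply: (@le_trans _ _ (\int[m]_(x in setT) cst M%:E x)%E).
    apply: ge0_le_integral => //.
    - by move=> x _; rewrite lee_fin.
    - by move=> x _; rewrite lee_fin.
  rewrite (integral_cst m measurableT) -[leRHS]mule1.
  by apply: lee_wpmul2l; rewrite ?lee_fin.
have [U0 [UU0 U0oo]] := ultraFilterLemma (@eventually_filter).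
have nu1 : (nu setT <= 1)%E.
  by rewrite -(limE UU0 U0oo measurableT); exact: vague_limit_le1.
have nuoo : (\int[nu]_x (phi x)%:E < +oo)%E by apply: le_lt_trans (bound _ nu1) (ltry _).
have nuE : (\int[nu]_x (phi x)%:E = (fine (\int[nu]_x (phi x)%:E))%:E)%E.
  by rewrite fineK// ge0_fin_numE// integral_ge0// => x _; rewrite lee_fin.
have muE i : (\int[mu i]_x (phi x)%:E = (fine (\int[mu i]_x (phi x)%:E))%:E)%E.
  rewrite fineK// ge0_fin_numE; last by apply: integral_ge0 => x _; rewrite lee_fin.
  by apply: le_lt_trans (bound _ _) (ltry _); rewrite mu1.
split => //; apply: cvg_ultrafilters => U UU Uoo.
have limI : (\int[@vague_limit R n U mu UU mu1]_x (phi x)%:E = \int[nu]_x (phi x)%:E)%E.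
  by apply: eq_measure_integral => A mA _; exact: limE.
set l := fine (\int[nu]_x (phi x)%:E)%E.
have UF : Filter U by exact: filter_filter.
apply/cvgrPdist_lt => eps eps0.
have H1 : U [set i | ((l - eps)%:E < \int[mu i]_x (phi x)%:E)%E].
  apply: (@vague_limit_lsc R n U mu UU mu1 (fun x => (phi x)%:E)).
  - by move=> x; rewrite lee_fin.
  - move=> c; rewrite (_ : [set x | _] = phi @^-1` [set r | c < r]).
      by apply: open_comp => [x _|]; [exact: phic|exact: open_gt].
    by apply/seteqP; split => x; rewrite /= lte_fin.
  - by rewrite limI nuE lte_fin gtrBl.
have H2 : U [set i | (\int[mu i]_x (phi x)%:E < (l + eps)%:E)%E].
  apply: (@vague_limit_usc R n U mu UU mu1 (fun x => (phi x)%:E) _ M).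
  - by move=> x; rewrite !lee_fin phi0 phiM.
  - exact: mphi.
  - move=> c c0; rewrite (_ : [set x | _] = [set x | c <= phi x]); first exact: phik.
    by apply/seteqP; split => x; rewrite /= lee_fin.
  - by rewrite limI nuE lte_fin ltrDl.
apply: filterS (filterI H1 H2) => i [] /=; rewrite muE !lte_fin => h1 h2.
by rewrite ltr_distlC h1 h2.
Qed.

End bounded_nonnegative.

Lemma vague_cvg_ultrafilters : vague_cvg mu nu.
Proof.
move=> phi phic cphi; set K := closure _ in cphi.
have phiK x : phi x != 0 -> K x by move=> ?; exact: subset_closure.
have [M0 phiM] : exists M, forall x, `|phi x| <= M.
  have : compact (phi @` K).
    by apply: continuous_compact => //; exact: continuous_subspaceT.
  move=> /compact_bounded[M [_ HM]]; exists (`|M| + 1) => x.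
  have [->|/phiK Kx] := eqVneq (phi x) 0; first by rewrite normr0 addr_ge0.
  by apply: (HM _ _ (phi x)); [rewrite ltr_pwDr// ler_norm|exists x].
(* The semicontinuity lemmas require nonnegative functions, so [phi] is treated through its positive
   and negative parts; [pp] is applied to [phi] and to its opposite. *)
have part (psi : X -> R) : continuous psi -> (forall x, `|psi x| <= M0) ->
    (forall x, psi x != 0 -> K x) ->
    let pp := fun x => Num.max (psi x) 0 in
    (\int[nu]_x (pp x)%:E < +oo)%E /\
    fine (\int[mu i]_x (pp x)%:E)%E @[i --> \oo] --> fine (\int[nu]_x (pp x)%:E)%E.
  move=> psic psiM psiK pp; apply: (@integral_cvg_nonnegative pp M0).
  - by move=> x; apply: continuous_max; [exact: psic|exact: cst_continuous].
  - by move=> x; rewrite le_max lexx orbT.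
  - move=> x; rewrite ge_max (le_trans (ler_norm _) (psiM x))/=.
    exact: le_trans (psiM x).
  - move=> c c0; apply: (subclosed_compact _ cphi).
      rewrite (_ : [set x | _] = psi @^-1` [set r | c <= r]).
        by apply: closed_comp => [x _|]; [exact: psic|exact: closed_ge].
      by apply/seteqP; split => x; rewrite /= /pp le_max;
          [move=> /orP[//|]; rewrite leNgt c0|move=> ->].
    move=> x /= cx; apply: psiK; apply: contraTneq cx => p0.
    by rewrite /pp p0 maxxx -ltNge.
have nphic : continuous (fun x => - phi x) by move=> x; apply: continuousN; exact: phic.
have nphiM x : `|- phi x| <= M0 by rewrite normrN.
have nphiK x : - phi x != 0 -> K x by rewrite oppr_eq0; exact: phiK.
have [n1 c1] := part phi phic phiM phiK.
have [n2 c2] := part (fun x => - phi x) nphic nphiM nphiK.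
set pp := fun x => Num.max (phi x) 0 in n1 c1.
set pn := fun x => Num.max (- phi x) 0 in n2 c2.
have E (m : pmeasure) : (\int[m]_x (phi x)%:E = \int[m]_x (pp x)%:E - \int[m]_x (pn x)%:E)%E.
  rewrite integralE; congr (_ - _)%E; apply: eq_integral => x _.
    by rewrite funeposE /pp -EFin_max.
  by rewrite funenegE /pn -EFin_max.
have fin (m : pmeasure) (f : X -> R) : (forall x, 0 <= f x) -> (\int[m]_x (f x)%:E < +oo)%E ->
    (\int[m]_x (f x)%:E = (fine (\int[m]_x (f x)%:E))%:E)%E.
  move=> f0 foo; rewrite fineK// ge0_fin_numE// integral_ge0// => x _.
  by rewrite lee_fin.
have pp0 x : 0 <= pp x by rewrite /pp le_max lexx orbT.
have pn0 x : 0 <= pn x by rewrite /pn le_max lexx orbT.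
have bound i (f : X -> R) : continuous f -> (forall x, 0 <= f x) -> (forall x, f x <= M0) ->
    (\int[mu i]_x (f x)%:E < +oo)%E.
  move=> fc f0 fM; apply: (@le_lt_trans _ _ (\int[mu i]_(x in setT) cst M0%:E x)%E).
    apply: ge0_le_integral.
    - exact: measurableT.
    - by move=> x _; rewrite lee_fin.
    - by apply/measurable_EFinP; exact: continuous_borel.
    - exact: measurable_cst.
    - by move=> x _; rewrite lee_fin.
  by rewrite (integral_cst (mu i) measurableT) mu1 mule1 ltry.
have maxM (psi : X -> R) x : `|psi x| <= M0 -> Num.max (psi x) 0 <= M0.
  move=> pM; rewrite ge_max (le_trans (ler_norm _) pM)/=; exact: le_trans pM.
have maxc (psi : X -> R) : continuous psi -> continuous (fun x => Num.max (psi x) 0).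
  by move=> psic x; apply: continuous_max; [exact: psic|exact: cst_continuous].
rewrite E (fin nu pp)// (fin nu pn)//.
under eq_cvg => i.
  rewrite E (fin (mu i) pp pp0); last first.
    apply: bound => //; first exact: (maxc phi phic).
    by move=> x; exact: (maxM phi x (phiM x)).
  rewrite (fin (mu i) pn pn0); last first.
    apply: bound => //; first exact: (maxc (fun x => - phi x) nphic).
    by move=> x; exact: (maxM (fun x => - phi x) x (nphiM x)).
  rewrite -EFinB; over.
by rewrite -EFinB; apply: cvg_EFin; [exact: nearW|apply: cvgB].
Qed.

End vague_convergence.

Section decreasing_sets.
Context {R : realType} {n : nat} (alpha : R).
Hypothesis alphan : alpha < n%:R.
Local Notation T := (borel R n).
Local Notation X := 'rV[R]_n.
Local Notation pmeasure := (posmeasure R n).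
Local Notation fineE := (riesz_fine alpha).
Local Notation q := (riesz_q alpha).
Variables (h : T -> \bar R) (tp tn : pmeasure) (cst0 : R).
Hypothesis h0 : forall x, (0 <= h x)%E.
Hypothesis hlsc : forall c : R, open [set x : X | (c%:E < h x)%E].
Hypothesis ftp : fineE tp.
Hypothesis ftn : fineE tn.
Local Notation adm := (admissible alpha h).
Local Notation J := (Jfun alpha h tp tn cst0).
Local Notation w := (winf alpha h tp tn cst0).

Variables (Qs : nat -> set X) (c : R).
Hypothesis Qdecr : forall i j, (i <= j)%N -> Qs j `<=` Qs i.
Hypothesis Qqc : forall i, quasiclosed alpha (Qs i).
Hypothesis c0 : 0 < c.
Hypothesis Qc : (c%:E <= min_energy alpha (Qs 0%N))%E.
Local Notation Qinf := (\bigcap_i Qs i).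
Hypothesis Qne : adm Qinf !=set0.

Lemma admissible_decreasing i : adm (Qs i) !=set0.
Proof. by have [m am] := Qne; exists m; apply: admissibleS am => x; exact. Qed.

Lemma decreasing_limit : (exists2 lam, adm Qinf lam & J lam = w Qinf) /\
  w (Qs i) @[i --> \oo] --> w Qinf.
Proof.
have /choice[mu Hmu] i : exists mu, adm (Qs i) mu /\ J mu <= w (Qs i) + i.+1%:R^-1.
  have i0 : 0 < i.+1%:R^-1 :> R by rewrite invr_gt0.
  have [mu am Jm] := winf_near alphan tp cst0 h0 ftn i0 (admissible_decreasing i).
  by exists mu.
have mu1 i : mu i setT = 1%E by have [[]] := Hmu i.
have [U [UU Uoo]] := ultraFilterLemma (@eventually_filter).
have [a Jl W] := minimizing_limit alphan h0 hlsc ftp ftn Qdecr Qqc c0 Qc Qne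
  (fun i => (Hmu i).1) (fun i => (Hmu i).2) mu1 Uoo.
by split => //; exists (@vague_limit R n U mu UU mu1).
Qed.

(** [qform_le] makes the distance of two minimizers zero; the conclusion is equality on Borel
    sets. *)
Lemma minimizer_unique lam lam' : adm Qinf lam -> adm Qinf lam' ->
  J lam = w Qinf -> J lam' = w Qinf -> forall A, measurable A -> lam A = lam' A.
Proof.
move=> al al' Jl Jl'; have [l1 fl _ _] := al; have [l1' fl' _ _] := al'.
apply: gauss_measure_eq => // v y; apply: (integral_gauss_eq alphan) => //.
suff : q lam lam' <= 0 by [].
apply: (le_trans (qform_le alphan cst0 h0 hlsc ftp ftn al al')).
by rewrite Jl Jl'; generalize (w Qinf); intros; lra.
Qed.

Section minimizers.
Variables (lam : nat -> pmeasure) (lamA : pmeasure).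
Hypothesis alam : forall i, adm (Qs i) (lam i).
Hypothesis Jlam : forall i, J (lam i) = w (Qs i).
Hypothesis alamA : adm Qinf lamA.
Hypothesis JlamA : J lamA = w Qinf.

(** [lamA] competes on every [Qs i], so by [qform_le] its squared distance to [lam i] is at most
    twice the gap between the two infima. *)
Lemma minimizers_strong_cvg : q (lam i) lamA @[i --> \oo] --> 0.
Proof.
have [_ W] := decreasing_limit.
apply: (@squeeze_cvgr _ _ _ _ (cst 0) (fun i => 2 * (w Qinf - w (Qs i)))).
- apply: nearW => i; apply/andP; split.
    by apply: riesz_q_ge0 => //; [have [] := alam i|have [] := alamA].
  have aA : adm (Qs i) lamA by apply: admissibleS alamA => x; exact.
  apply: (le_trans (qform_le alphan cst0 h0 hlsc ftp ftn (alam i) aA)).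
  by rewrite Jlam JlamA; generalize (w Qinf) (w (Qs i)); intros; lra.
- exact: cvg_cst.
- rewrite -[X in _ --> X](mulr0 2); apply: cvgMr.
  by rewrite -[X in _ --> X](subrr (w Qinf)); apply: cvgB; [exact: cvg_cst|exact: W].
Qed.

Lemma minimizers_vague_cvg : vague_cvg lam lamA.
Proof.
have lam1 i : lam i setT = 1%E by have [] := alam i.
apply: (@vague_cvg_ultrafilters R n lam lamA lam1) => U UU Uoo A mA.
have Jl i : J (lam i) <= w (Qs i) + i.+1%:R^-1 by rewrite Jlam lerDl invr_ge0.
have [a Jlim _] := minimizing_limit alphan h0 hlsc ftp ftn Qdecr Qqc c0 Qc Qne
  alam Jl lam1 Uoo.
exact: (minimizer_unique a alamA Jlim JlamA).
Qed.

End minimizers.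
End decreasing_sets.

(** * External fields *)

Section lower_semicontinuity.
Context {R : realType} {n : nat}.
Local Notation T := (borel R n).
Local Notation X := 'rV[R]_n.
Local Open Scope ereal_scope.

Lemma lsc_add (f g : X -> \bar R) : (forall x, 0 <= f x) -> (forall x, 0 <= g x) ->
  (forall c : R, open [set x | c%:E < f x]) ->
  (forall c : R, open [set x | c%:E < g x]) ->
  forall c : R, open [set x | c%:E < f x + g x].
Proof.
move=> f0 g0 fl gl c.
rewrite (_ : [set x | _] = \bigcup_(a : R)
  ([set x | a%:E < f x] `&` [set x | (c - a)%:E < g x])).
  by apply: bigcup_open => a _; apply: openI.
apply/seteqP; split => x /=; last first.
  by move=> [a _ [/= af cg]]; rewrite -(subrKC a c) EFinD lteD.
have := f0 x; have := g0 x.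
case fE : (f x) => [r| |] //; case gE : (g x) => [s| |] //= s0 r0.
- rewrite -EFinD lte_fin => crs.
  by exists (r - (r + s - c) / 2)%R => //; split; rewrite /mkset ?fE ?gE lte_fin; lra.
- by exists (r - 1)%R => //; split; rewrite /mkset ?fE ?gE ?ltry// lte_fin gtrBl.
- exists (c + 1)%R => //; split; rewrite /mkset ?fE ?gE ?ltry//.
  by apply: lt_le_trans s0; rewrite lte_fin; lra.
- by exists 0%R => //; split; rewrite /mkset ?fE ?gE ltry.
Qed.

Variables (D : set X) (psi : X -> \bar R).
Hypothesis cD : closed D.
Hypothesis Ppsi : Phi D psi.

Let rel_open (c : R) : exists2 W : set X, open W & forall x, D x -> W x <-> c%:E < psi x.
Proof.
have [lpsi _ _] := Ppsi.
have /lower_semicontinuousP/(_ c) := lpsi.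
move=> /open_subspaceP [W oO OD]; exists W => // x Dx; split => [Ox|cx].
  have : (W `&` D) x by split.
  by rewrite OD => -[].
have : ([set x | c%:E < psi x] `&` D) x by split.
by rewrite -OD => -[].
Qed.

(** In the compact case the relatively open sets where [psi] exceeds [- i] cover [D], and finitely
    many suffice; otherwise [psi] is nonnegative by the definition of [Phi]. *)
Lemma Phi_bounded_below : exists2 M : R, (0 <= M)%R & forall x, D x -> (- M)%:E <= psi x.
Proof.
have [_ psiN [cpt|psi0]] := Ppsi; last by exists 0%R => // x Dx; rewrite oppr0 psi0.
have /choice[W HW] i : exists W : set X, open W /\
    forall x, D x -> W x <-> (- i%:R)%:E < psi x.
  by have [W oO H] := rel_open (- i%:R); exists W.
have [N HN] : exists N, D `<=` \bigcup_(i < N) W i.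
  apply: compact_bigcup => // [i|x Dx]; first by have [] := HW i.
  have := psiN x Dx; case E : (psi x) => [r| |] // _.
    exists (Num.truncn `|r|).+1 => //; apply/(HW _).2 => //.
    rewrite E lte_fin ltrNl; apply: le_lt_trans (truncnS_gt _).
    by rewrite -normrN ler_norm.
  by exists 0%N => //; apply/(HW _).2 => //; rewrite E ltry.
exists N%:R => // x Dx; have [i /= iN /(HW _).2] := HN x Dx.
move=> /(_ Dx)/ltW; apply: le_trans; rewrite lee_fin lerN2 ler_nat; exact: ltnW.
Qed.

Variable M : R.
Hypothesis psiM : forall x, D x -> (- M)%:E <= psi x.

(** Since [D] is closed, the value [+oo] outside it keeps the function lower semicontinuous on the
    whole space. *)
Definition shifted (x : T) : \bar R := if `[< D x >] then psi x + M%:E else +oo.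

Lemma shiftedE x : D x -> shifted x = psi x + M%:E.
Proof. by move=> Dx; rewrite /shifted asboolT. Qed.

Lemma shifted_ge0 x : 0 <= shifted x.
Proof.
rewrite /shifted; case: asboolP => Dx; last by rewrite leey.
by have := psiM Dx; case: (psi x) => [r| |] //=; rewrite ?leey// -EFinD !lee_fin; lra.
Qed.

Lemma shifted_lsc (c : R) : open [set x : X | c%:E < shifted x].
Proof.
have [W oO HW] := rel_open (c - M).
rewrite (_ : [set x | _] = W `|` ~` D); first by apply: openU => //; exact: closed_openC.
apply/seteqP; split => x /=; rewrite /shifted; case: asboolP => Dx; [|by right| |by rewrite ltry].
  move=> cx; left; apply/(HW _ Dx); move: cx.
  by case: (psi x) => [r| |] //=; rewrite ?ltry// -EFinD !lte_fin; lra.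
case=> // /(HW _ Dx); case: (psi x) => [r| |] //=; rewrite ?ltry// -EFinD !lte_fin; lra.
Qed.

End lower_semicontinuity.

Section separated_charge.
Context {R : realType} {n : nat} (alpha : R).
Hypothesis alphan : alpha < n%:R.
Local Notation T := (borel R n).
Local Notation X := 'rV[R]_n.
Local Notation pmeasure := (posmeasure R n).
Local Notation a := ((n%:R - alpha) / 2).

Variables (omega : signed_measure R n) (A0 : set X).
Hypothesis omega_fin : bounded_measure omega.
Hypothesis omega_dist : (0 < dist_support omega A0)%E.
Local Notation D := (closure A0).
Local Notation S := (msupport omega).

(** The hypothesis separates the support from [A0] only; for fixed y the points at distance at least
    d form a closed set, so the bound extends to the closure. It is a bound on [d2], the squared
    distance. *)
Lemma support_dist : exists2 d : R, 0 < d & forall x y, D x -> S y -> d <= d2 x y.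
Proof.
have [d /andP[]] := lte_between omega_dist; rewrite lte_fin => d0 /ltW dle.
exists (d ^+ 2); first by rewrite exprn_gt0.
move=> x y Dx Sy.
have : closed [set x : X | d ^+ 2 <= d2 x y].
  rewrite (_ : [set x | _] = (fun x : X => d2 x y) @^-1` [set r | d ^+ 2 <= r])//.
  by apply: closed_comp => [z _|]; [exact: continuous_d2|exact: closed_ge].
move=> /closure_id cl.
have : closure [set x : X | d ^+ 2 <= d2 x y] x; last by rewrite -cl.
move: x Dx; apply: closureS => x Ax /=.
have : d <= Num.sqrt (d2 y x).
  rewrite -lee_fin; apply: (le_trans dle).
  by rewrite -enorm_sqrt; apply: ereal_inf_lbound; exists y => //; exists x.
move=> dx; rewrite d2C -[leRHS]sqr_sqrtr ?d2_ge0// lerXn2r ?nnegrE ?sqrtr_ge0//.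
exact: ltW.
Qed.

Lemma measurable_msupport : measurable (S : set T).
Proof.
apply: measurableC; apply: open_borel; apply: bigcup_open => V [oV _]; exact: oV.
Qed.

Lemma parts_msupport : pos_part omega (~` S) = 0%E /\ neg_part omega (~` S) = 0%E.
Proof.
have H : abs_measure omega (~` S) = 0%E.
  by rewrite /msupport setCK; apply: negligible_bigcup_open => V [].
have E : abs_measure omega (~` S) = (pos_part omega (~` S) + neg_part omega (~` S))%E.
  exact: measure_addE.
move: H; rewrite E => /eqP; rewrite padde_eq0 ?measure_ge0//.
by move=> /andP[/eqP -> /eqP ->].
Qed.

Lemma parts_finite : (pos_part omega setT < +oo)%E /\ (neg_part omega setT < +oo)%E.
Proof.
have E : abs_measure omega setT = (pos_part omega setT + neg_part omega setT)%E.
  exact: measure_addE.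
have := omega_fin; rewrite /bounded_measure E => H; split.
  by apply: le_lt_trans H; rewrite leeDl.
by apply: le_lt_trans H; rewrite leeDr.
Qed.

Variables (d : R).
Hypothesis d0 : 0 < d.
Hypothesis dist : forall x y, D x -> S y -> d <= d2 x y.

(* On [D], at positive distance from the support of [omega], the Riesz kernel
   can be replaced by a bounded continuous one; then both the potential and
   its complement to a constant are lower semicontinuous. *)
Definition cut_kernel (x y : X) : R := expR (- (a * ln (Num.max (d2 x y) d))).
Definition cut_bound : R := expR (- (a * ln d)).
Definition cut_pot (m : pmeasure) (x : T) : \bar R := (\int[m]_y (cut_kernel x y)%:E)%E.
Definition cut_copot (m : pmeasure) (x : T) : \bar R :=
  (\int[m]_y (cut_bound - cut_kernel x y)%:E)%E.

Let a0 := riesz_exp_gt0 alphan.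

Lemma cut_kernel_ge0 x y : 0 <= cut_kernel x y. Proof. exact: expR_ge0. Qed.

Lemma cut_kernel_le x y : cut_kernel x y <= cut_bound.
Proof.
rewrite ler_expR lerN2 ler_pM2l// ler_ln ?posrE//.
  by rewrite le_max lexx orbT.
by rewrite lt_max d0 orbT.
Qed.

Lemma cut_kernelC x y : cut_kernel x y = cut_kernel y x.
Proof. by rewrite /cut_kernel d2C. Qed.

Lemma continuous_cut_kernel y : continuous (cut_kernel ^~ y).
Proof.
move=> x; have mc : {for x, continuous (fun x : X => Num.max (d2 x y) d)}.
  by apply: continuous_max; [exact: continuous_d2|exact: cst_continuous].
have lc : {for x, continuous (fun x : X => ln (Num.max (d2 x y) d))}.
  apply: (continuous_comp mc); apply: continuous_ln.
  by rewrite lt_max d0 orbT.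
have nc : {for x, continuous (fun x : X => - (a * ln (Num.max (d2 x y) d)))}.
  apply: continuousN; apply: continuousM; [exact: cst_continuous|exact: lc].
exact: (continuous_comp nc (@continuous_expR R _)).
Qed.

Lemma measurable_cut_kernel (x : X) : measurable_fun setT (cut_kernel x : T -> R).
Proof.
rewrite (_ : cut_kernel x = cut_kernel ^~ x).
  by apply: continuous_borel; exact: continuous_cut_kernel.
by apply/funext => y; rewrite cut_kernelC.
Qed.

(** [m] charges only the support of [omega], and there the maximum in [cut_kernel] is the squared
    distance itself. *)
Lemma potential_cut (m : pmeasure) x : m (~` S) = 0%E -> D x ->
  potential alpha m x = cut_pot m x.
Proof.
move=> mS Dx.
have mr : measurable_fun setT (fun y : T => riesz_kernel alpha x y).
  rewrite (_ : (fun _ => _) = gker (riesz_weight a) x).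
    exact: (nnkernel_measurable (x : T) (kk alphan)).
  by apply/funext => y; rewrite riesz_kernelE.
rewrite /potential /cut_pot.
rewrite (@ge0_negligible_integral _ _ _ m setT (~` S))//; last 2 first.
- by apply: measurableC; exact: measurable_msupport.
- by move=> y _; rewrite riesz_kernelE//; exact: (kk alphan).2.
rewrite [RHS](@ge0_negligible_integral _ _ _ m setT (~` S))//; last 3 first.
- by apply: measurableC; exact: measurable_msupport.
- by apply/measurable_EFinP; exact: measurable_cut_kernel.
- by move=> y _; rewrite lee_fin cut_kernel_ge0.
rewrite setTD setCK; apply: eq_integral => y; rewrite inE => Sy.
have dxy := dist Dx Sy.
have xy : x != y.
  by apply: contraTneq dxy => ->; rewrite d2xx -ltNge.
by rewrite riesz_kernel_neq// /cut_kernel (max_idPl dxy).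
Qed.

Lemma cut_pot_lsc m (c : R) : open [set x : X | (c%:E < cut_pot m x)%E].
Proof.
apply: (@lsc_integral _ _ _ _ m (fun x y => (cut_kernel x y)%:E)).
- by move=> x y; rewrite lee_fin cut_kernel_ge0.
- by move=> x; apply/measurable_EFinP; exact: measurable_cut_kernel.
- move=> b y; rewrite (_ : [set x | _] = cut_kernel^~ y @^-1` [set r | b < r]).
    by apply: open_comp => [z _|]; [exact: continuous_cut_kernel|exact: open_gt].
  by apply/seteqP; split => x; rewrite /= lte_fin.
Qed.

Lemma cut_copot_lsc m (c : R) : open [set x : X | (c%:E < cut_copot m x)%E].
Proof.
apply: (@lsc_integral _ _ _ _ m (fun x y => (cut_bound - cut_kernel x y)%:E)).
- by move=> x y; rewrite lee_fin subr_ge0 cut_kernel_le.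
- move=> x; apply/measurable_EFinP; apply: measurable_funB => //.
  exact: measurable_cut_kernel.
- move=> b y; rewrite (_ : [set x | _] = cut_kernel^~ y @^-1` [set r | r < cut_bound - b]).
    by apply: open_comp => [z _|]; [exact: continuous_cut_kernel|exact: open_lt].
  by apply/seteqP; split => x; rewrite /= lte_fin ltrBrDr addrC -ltrBrDr.
Qed.

Lemma cut_pot_ge0 m x : (0 <= cut_pot m x)%E.
Proof. by apply: integral_ge0 => y _; rewrite lee_fin cut_kernel_ge0. Qed.

Lemma cut_copot_ge0 m x : (0 <= cut_copot m x)%E.
Proof. by apply: integral_ge0 => y _; rewrite lee_fin subr_ge0 cut_kernel_le. Qed.

Lemma cut_pot_add m x : (cut_copot m x + cut_pot m x = cut_bound%:E * m setT)%E.
Proof.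
rewrite /cut_pot /cut_copot -ge0_integralD//.
- under eq_integral do rewrite -EFinD subrK.
  by rewrite (integral_cst m measurableT).
- by move=> y _; rewrite lee_fin subr_ge0 cut_kernel_le.
- apply/measurable_EFinP; apply: measurable_funB => //.
  exact: measurable_cut_kernel.
- by move=> y _; rewrite lee_fin cut_kernel_ge0.
- by apply/measurable_EFinP; exact: measurable_cut_kernel.
Qed.

End separated_charge.

(** The field on [D], with names for its pieces: [p] is psi + M, [vp] and [vn] are the potentials of
    the parts of theta, [up] and [un] those of omega, [gp] and [gn] the bounded functions replacing
    them, and [gc] is [C - gn]. On [D] this makes f equal to [h + (vp - vn) - (M + C)]. *)
Section integrable_shift.
Context d (T : measurableType d) (R : realType).
Variables (mu : {measure set T -> \bar R}) (D : set T).
Hypothesis mD : measurable D.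
Hypothesis mu1 : mu setT = 1%E.
Hypothesis muD : mu (~` D) = 0%E.
Variables (psi p vp vn gp gc gn up un f : T -> \bar R) (M C B : R).
Local Open Scope ereal_scope.
Hypothesis p0 : forall x, 0 <= p x.
Hypothesis vp0 : forall x, 0 <= vp x.
Hypothesis vn0 : forall x, 0 <= vn x.
Hypothesis gp0 : forall x, 0 <= gp x.
Hypothesis gc0 : forall x, 0 <= gc x.
Hypothesis gn0 : forall x, 0 <= gn x.
Hypothesis mp : measurable_fun setT p.
Hypothesis mvp : measurable_fun setT vp.
Hypothesis mvn : measurable_fun setT vn.
Hypothesis mgp : measurable_fun setT gp.
Hypothesis mgc : measurable_fun setT gc.
Hypothesis mgn : measurable_fun setT gn.
Hypothesis psiN : forall x, D x -> -oo < psi x.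
Hypothesis psip : forall x, D x -> p x = psi x + M%:E.
Hypothesis ivp : \int[mu]_x vp x < +oo.
Hypothesis ivn : \int[mu]_x vn x < +oo.
Hypothesis gpB : forall x, gp x <= B%:E.
Hypothesis gcn : forall x, gc x + gn x = C%:E.
Hypothesis upE : forall x, D x -> up x = gp x.
Hypothesis unE : forall x, D x -> un x = gn x.
Hypothesis fE : forall x, D x -> f x = psi x + (vp x - vn x) + (up x - un x).

Let h x := p x + gp x + gc x.

Let intD g : measurable_fun setT g -> (forall x, 0 <= g x) ->
  \int[mu]_(x in D) g x = \int[mu]_x g x.
Proof.
move=> mg g0; rewrite [RHS](@ge0_negligible_integral _ _ _ mu setT (~` D))//.
- by rewrite setTD setCK.
- exact: measurableC.
Qed.

Let intg g : measurable_fun setT g -> (forall x, 0 <= g x) ->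
  \int[mu]_x g x < +oo -> mu.-integrable D g.
Proof.
move=> mg g0 goo; apply/integrableP; split; first exact: measurable_funTS.
by under eq_integral do rewrite gee0_abs//; rewrite intD.
Qed.

Let bounded_lty (g : T -> \bar R) b : measurable_fun setT g -> (forall x, 0 <= g x) ->
  (forall x, g x <= b%:E) -> \int[mu]_x g x < +oo.
Proof.
move=> mg g0 gb; apply: (@le_lt_trans _ _ (\int[mu]_(x in setT) cst b%:E x)).
  exact: ge0_le_integral.
by rewrite (integral_cst mu measurableT) mu1 mule1 ltry.
Qed.

Let gnC x : gn x <= C%:E. Proof. by rewrite -(gcn x) leeDr. Qed.
Let gcC x : gc x <= C%:E. Proof. by rewrite -(gcn x) leeDl. Qed.
Let igp : \int[mu]_x gp x < +oo. Proof. exact: bounded_lty gpB. Qed.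
Let ign : \int[mu]_x gn x < +oo. Proof. exact: bounded_lty gnC. Qed.
Let igc : \int[mu]_x gc x < +oo. Proof. exact: bounded_lty gcC. Qed.

Let mu_D : mu D = 1.
Proof.
have : mu (D `|` ~` D) = mu D + mu (~` D).
  by apply: measureU => //; [exact: measurableC|exact: setICr].
by rewrite setUv mu1 muD adde0.
Qed.

Let int_h : \int[mu]_x h x = \int[mu]_x p x + \int[mu]_x gp x + \int[mu]_x gc x.
Proof.
rewrite /h ge0_integralD//; last 2 first.
- by move=> x _; rewrite adde_ge0.
- exact: emeasurable_funD.
by rewrite ge0_integralD.
Qed.

Let psiE x : D x -> psi x = p x - M%:E.
Proof. by move=> Dx; rewrite psip// addeK. Qed.

Let mpsi : measurable_fun D psi.
Proof.
apply: (eq_measurable_fun (fun x => p x - M%:E)).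
  by move=> x; rewrite inE => Dx; rewrite psiE.
by apply: emeasurable_funB => //; exact: measurable_funTS.
Qed.

Let iup : mu.-integrable D up.
Proof.
by apply: (@eq_integrable _ _ _ mu D mD gp); [move=> x; rewrite inE => /upE|exact: intg].
Qed.

Let iun : mu.-integrable D un.
Proof.
by apply: (@eq_integrable _ _ _ mu D mD gn); [move=> x; rewrite inE => /unE|exact: intg].
Qed.

Let icM : mu.-integrable D (fun=> M%:E).
Proof.
apply/integrableP; split=> //.
rewrite (_ : (fun x => _) = cst `|M%:E|)//.
by rewrite (integral_cst mu mD) mu_D mule1 ltry.
Qed.

Let norm_perturb (r a b c e : R) :
  (`|r| <= `|r + (a - b) + (c - e)| + `|a| + `|b| + `|c| + `|e|)%R.
Proof.
rewrite -[X in (`|X| <= _)%R](_ : (r + (a - b) + (c - e)) - a + b - c + e = r)%R; last by ring.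
move: (r + (a - b) + (c - e))%R => s.
do 2![apply: (le_trans (ler_normD _ _)); rewrite lerD2r;
      apply: (le_trans (ler_normB _ _)); rewrite lerD2r].
by [].
Qed.

Lemma integrable_shift : mu.-integrable D f <-> \int[mu]_x h x < +oo.
Proof.
split=> [fi|hoo].
  have ipsi : mu.-integrable D psi.
    (* Where [vp] or [vn] is infinite, and the sum defining [f] possibly junk, the majorant is
       [+oo]; for finite values it is the triangle inequality. *)
    apply: (@le_integrable _ _ _ mu D mD psi
      (fun x => `|f x| + `|vp x| + `|vn x| + `|up x| + `|un x|)) => //; last first.
      by do ![apply: integrableD => //]; apply: integrable_abse => //; exact: intg.
    move=> x Dx; rewrite [leRHS]gee0_abs ?adde_ge0// fE// upE// unE//.
    move: (psiN Dx) (vp0 x) (vn0 x) (gp0 x) (gn0 x) (gpB x) (gnC x).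
    case: (psi x) => [r| |]; case: (vp x) => [a| |]; case: (vn x) => [b| |];
      case: (gp x) => [c| |]; case: (gn x) => [e| |] //= _ _ _ _ _ _ _.
    - by rewrite -!EFinD !lee_fin; exact: norm_perturb.
    - by do ?[rewrite addye//]; rewrite leey.
    - by do ?[rewrite addye//]; rewrite leey.
    - by do ?[rewrite addye//]; rewrite leey.
  rewrite int_h; do 2![apply: lte_add_pinfty => //]; rewrite -intD//.
  rewrite (eq_integral (fun x => psi x + M%:E)); last by move=> x; rewrite inE => /psip.
  rewrite integralD//; apply: lte_add_pinfty; exact: integrable_lty.
have poo : \int[mu]_x p x < +oo.
  by apply: le_lt_trans hoo; rewrite int_h -addeA leeDl// adde_ge0// integral_ge0.
have ip := intg mp p0 poo.
have ipsi : mu.-integrable D psi.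
  apply: (@eq_integrable _ _ _ mu D mD (p \- cst M%:E)); last exact: integrableB.
  by move=> x; rewrite inE => Dx; rewrite psiE.
apply: (@eq_integrable _ _ _ mu D mD ((psi \+ (vp \- vn)) \+ (up \- un))).
  by move=> x; rewrite inE => Dx /=; rewrite fE.
apply: integrableD => //; last exact: integrableB.
by apply: integrableD => //; apply: integrableB => //; exact: intg.
Qed.

Lemma integral_shift : \int[mu]_x h x < +oo ->
  \int[mu]_(x in D) f x = (fine (\int[mu]_x h x) +
    (fine (\int[mu]_x vp x) - fine (\int[mu]_x vn x)) - (M + C))%:E.
Proof.
move=> hoo.
have poo : \int[mu]_x p x < +oo.
  by apply: le_lt_trans hoo; rewrite int_h -addeA leeDl// adde_ge0// integral_ge0.
have ip := intg mp p0 poo.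
have ipsi : mu.-integrable D psi.
  apply: (@eq_integrable _ _ _ mu D mD (p \- cst M%:E)); last exact: integrableB.
  by move=> x; rewrite inE => Dx; rewrite psiE.
have fin g : (forall x, 0 <= g x) -> \int[mu]_x g x < +oo ->
    \int[mu]_x g x = (fine (\int[mu]_x g x))%:E.
  by move=> g0 goo; rewrite fineK// ge0_fin_numE// integral_ge0.
have E1 : \int[mu]_(x in D) f x = \int[mu]_(x in D) psi x +
    (\int[mu]_(x in D) vp x - \int[mu]_(x in D) vn x) +
    (\int[mu]_(x in D) up x - \int[mu]_(x in D) un x).
  rewrite (eq_integral ((psi \+ (vp \- vn)) \+ (up \- un))); last first.
    by move=> x; rewrite inE => Dx; rewrite fE.
  rewrite integralD//; last 2 first.
  - by apply: integrableD => //; apply: integrableB => //; exact: intg.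
  - exact: integrableB.
  rewrite integralD//; last by apply: integrableB => //; exact: intg.
  by rewrite !integralB//; exact: intg.
have E2 : \int[mu]_(x in D) psi x = \int[mu]_x p x - M%:E.
  rewrite (eq_integral (p \- cst M%:E)); last by move=> x; rewrite inE => Dx; rewrite psiE.
  by rewrite integralB// intD// (integral_cst mu mD) mu_D mule1.
have E3 : \int[mu]_(x in D) up x = \int[mu]_x gp x.
  by rewrite -intD//; apply: eq_integral => x; rewrite inE => /upE.
have E4 : \int[mu]_(x in D) un x = \int[mu]_x gn x.
  by rewrite -intD//; apply: eq_integral => x; rewrite inE => /unE.
have E5 : \int[mu]_x gc x + \int[mu]_x gn x = C%:E.
  rewrite -ge0_integralD//; under eq_integral do rewrite gcn.
  by rewrite (integral_cst mu measurableT) mu1 mule1.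
rewrite E1 E2 E3 E4 !intD// int_h; move: E5.
rewrite (fin p)// (fin gp)// (fin gc)// (fin gn)// (fin vp)// (fin vn)//.
move: (fine _) (fine _) (fine _) (fine _) (fine _) (fine _) => a b c e g k.
rewrite -!EFinB -!EFinD /= => -[E]; congr EFin; lra.
Qed.

End integrable_shift.

Section field_reduction.
Context {R : realType} {n : nat} (alpha : R).
Hypothesis alphan : alpha < n%:R.
Local Notation T := (borel R n).
Local Notation X := 'rV[R]_n.
Local Notation pmeasure := (posmeasure R n).
Variables (A0 : set X) (psi : X -> \bar R) (theta omega : signed_measure R n).
Local Notation D := (closure A0).
Hypothesis Ppsi : Phi D psi.
Hypothesis Etheta : signed_E alpha theta.
Hypothesis omega_fin : bounded_measure omega.
Variables (d M : R).
Hypothesis d0 : 0 < d.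
Hypothesis dist : forall x y, D x -> msupport omega y -> d <= d2 x y.
Hypothesis psiM : forall x, D x -> ((- M)%:E <= psi x)%E.
Local Notation f := (external_field alpha psi theta omega).
Local Notation tp := (pos_part theta).
Local Notation tn := (neg_part theta).
Local Notation omp := (pos_part omega).
Local Notation omn := (neg_part omega).

(* Lower semicontinuous part of the field, up to a constant; the value [+oo]
   of [shifted] off [D] is harmless since all competitors live on [D]. *)
Definition field_density (x : T) : \bar R :=
  (shifted D psi M x + cut_pot alpha d omp x + cut_copot alpha d omn x)%E.

Definition field_constant : R := M + cut_bound (n:=n) alpha d * fine (omn [set: T]).

Lemma field_density_ge0 x : (0 <= field_density x)%E.
Proof.
apply: adde_ge0; last exact: cut_copot_ge0.
by apply: adde_ge0; [exact: shifted_ge0|exact: cut_pot_ge0].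
Qed.

Lemma field_density_lsc (c : R) : open [set x : X | (c%:E < field_density x)%E].
Proof.
have cD : closed D by exact: closed_closure.
apply: (lsc_add (f := fun x => (shifted D psi M x + cut_pot alpha d omp x)%E)).
- by move=> x; apply: adde_ge0; [exact: shifted_ge0|exact: cut_pot_ge0].
- by move=> x; exact: cut_copot_ge0.
- move=> b; apply: lsc_add => [x|x|b'|b'].
  + exact: shifted_ge0.
  + exact: cut_pot_ge0.
  + exact: shifted_lsc.
  + exact: cut_pot_lsc.
- by move=> b; exact: cut_copot_lsc.
Qed.

Lemma theta_fine : riesz_fine alpha tp /\ riesz_fine alpha tn.
Proof.
have [[Mfin _] fin] := Etheta.
have sum_fin (a b c : \bar R) : (a + b - c)%E \is a fin_num ->
    a \is a fin_num /\ b \is a fin_num.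
  by rewrite fin_numB fin_numD => /andP[/andP[]].
have [ep en] := sum_fin _ _ _ fin.
have le_abs A : (tp A <= abs_measure theta A)%E /\ (tn A <= abs_measure theta A)%E.
  rewrite (_ : abs_measure theta A = (tp A + tn A)%E); last exact: measure_addE.
  by split; [exact: leeDl|exact: leeDr].
by split; split; try (by rewrite -(energyE alphan) ltey_eq ?ep ?en);
  move=> i; apply: le_lt_trans (Mfin _ (@compact_cball R n i)); have [] := le_abs (cball i).
Qed.

Section admissible_measures.
Variables (Q : set X).
Hypothesis QA : Q `<=` A0.

Let mD : measurable (D : set T).
Proof. by apply: closed_borel; exact: closed_closure. Qed.

Let nullD (mu : pmeasure) : concentrated mu Q -> mu (~` D) = 0%E.
Proof.
move=> cmu; apply/negligibleP; first exact: measurableC.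
apply: negligibleS cmu; apply: subsetC; apply: subset_trans QA _.
exact: subset_closure.
Qed.

Let potentials (m mu : pmeasure) : riesz_fine alpha m -> riesz_fine alpha mu ->
  [/\ forall x, (0 <= potential alpha m x)%E,
      measurable_fun setT (potential alpha m : T -> \bar R) &
      (\int[mu]_x potential alpha m x = (riesz_form alpha mu m)%:E)%E].
Proof.
move=> fm fmu; split.
- move=> x; rewrite (potentialE alphan); apply: integral_ge0 => y _.
  exact: (kk alphan).2.
- apply: lsc_measurable => c.
  rewrite (_ : [set x | _] = [set x |
    (c%:E < \int[m]_y gker (riesz_weight ((n%:R - alpha) / 2)) x y)%E]).
    by apply: gker_pot_lsc; exact: wrho.
  by apply/seteqP; split => x /=; rewrite (potentialE alphan).
- rewrite /riesz_form -(eformE measurable_cball bigcup_cball (kk alphan)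
    (@kC R n alpha) (kp alphan) fmu fm).
  exact: mutual_energyE.
Qed.

Let facts (mu : pmeasure) : mu setT = 1%E -> riesz_fine alpha mu -> concentrated mu Q ->
  (mu.-integrable D f <-> (\int[mu]_x field_density x < +oo)%E) /\
  ((\int[mu]_x field_density x < +oo)%E -> (\int[mu]_(x in D) f x =
   (fine (\int[mu]_x field_density x)%E + (riesz_form alpha mu tp - riesz_form alpha mu tn)
     - field_constant)%:E)%E).
Proof.
move=> m1 fmu cmu; have muD := nullD cmu.
have [ftp ftn] := theta_fine.
have [vp0 mvp ivp] := potentials ftp fmu.
have [vn0 mvn ivn] := potentials ftn fmu.
have cD : closed D by exact: closed_closure.
have [_ psiN _] := Ppsi.
have p0 : forall x : T, (0 <= shifted D psi M x)%E by exact: shifted_ge0.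
have mp : measurable_fun setT (shifted D psi M : T -> \bar R).
  by apply: lsc_measurable => c; exact: shifted_lsc.
have mcut m : measurable_fun setT (cut_pot alpha d m : T -> \bar R).
  by apply: lsc_measurable => c; exact: cut_pot_lsc.
have mcocut m : measurable_fun setT (cut_copot alpha d m : T -> \bar R).
  by apply: lsc_measurable => c; exact: cut_copot_lsc.
have [opoo onoo] := parts_finite omega_fin.
have [opS onS] := parts_msupport omega.
have finE (m : pmeasure) : (m setT < +oo)%E -> (m setT = (fine (m setT))%:E)%E.
  by move=> moo; rewrite fineK// ge0_fin_numE.
have gcn (m : pmeasure) x : (m setT < +oo)%E -> (cut_copot alpha d m x + cut_pot alpha d m x =
    (cut_bound (n:=n) alpha d * fine (m setT))%:E)%E.
  by move=> moo; rewrite (cut_pot_add alphan d0) EFinM -finE.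
have gpB x : (cut_pot alpha d omp x <= (cut_bound (n:=n) alpha d * fine (omp [set: T]))%:E)%E.
  by rewrite -(gcn omp x opoo) leeDr// cut_copot_ge0.
have psip x : D x -> (shifted D psi M x = psi x + M%:E)%E by exact: shiftedE.
have upE x : D x -> potential alpha omp x = cut_pot alpha d omp x.
  by move=> Dx; exact: (potential_cut alphan d0 dist).
have unE x : D x -> potential alpha omn x = cut_pot alpha d omn x.
  by move=> Dx; exact: (potential_cut alphan d0 dist).
have ivpoo : (\int[mu]_x potential alpha tp x < +oo)%E by rewrite ivp ltry.
have ivnoo : (\int[mu]_x potential alpha tn x < +oo)%E by rewrite ivn ltry.
have fE x : D x -> (f x = psi x + (potential alpha tp x - potential alpha tn x) +
  (potential alpha omp x - potential alpha omn x))%E by [].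
split.
  exact: (@integrable_shift _ T R mu D mD m1 muD psi (shifted D psi M)
    (potential alpha tp) (potential alpha tn) (cut_pot alpha d omp) (cut_copot alpha d omn)
    (cut_pot alpha d omn) (potential alpha omp) (potential alpha omn) f M
    _ _ p0 vp0 vn0 (cut_pot_ge0 alpha d omp) (cut_copot_ge0 alphan d0 omn) (cut_pot_ge0 alpha d omn)
    mp mvp mvn (mcut omp) (mcocut omn) (mcut omn) psiN psip ivpoo ivnoo gpB
    (fun x => gcn omn x onoo) upE unE fE).
move=> hoo; have H := (@integral_shift _ T R mu D mD m1 muD psi (shifted D psi M)
    (potential alpha tp) (potential alpha tn) (cut_pot alpha d omp) (cut_copot alpha d omn)
    (cut_pot alpha d omn) (potential alpha omp) (potential alpha omn) f M
    _ _ p0 vp0 vn0 (cut_pot_ge0 alpha d omp) (cut_copot_ge0 alphan d0 omn) (cut_pot_ge0 alpha d omn)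
    mp mvp mvn (mcut omp) (mcocut omn) (mcut omn) psip ivpoo ivnoo gpB
    (fun x => gcn omn x onoo) upE unE fE hoo).
by move: H; rewrite ivp ivn.
Qed.

Local Notation adm := (admissible alpha field_density).
Local Notation J := (Jfun alpha field_density tp tn field_constant).
Local Notation w := (winf alpha field_density tp tn field_constant).

Lemma Eplus1_fE (mu : pmeasure) : Eplus1_f alpha D f Q mu <-> adm Q mu.
Proof.
split=> [[[[Emu cmu] m1] fi]|[m1 fmu cmu hoo]].
  have fmu : riesz_fine alpha mu by exact: Eplus_fineE.
  by split => //; have [/(_ fi)] := (facts m1 fmu cmu).1.
split; last by have [_] := (facts m1 fmu cmu).1; exact.
split => //; split => //; apply: (fineE_Eplus alphan) => //.
by rewrite m1 ltry.
Qed.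

Lemma energy_fE (mu : pmeasure) : adm Q mu -> energy_f alpha D f mu = (J mu)%:E.
Proof.
move=> [m1 fmu cmu hoo]; rewrite /energy_f.
have -> : energy alpha mu = (riesz_form alpha mu mu)%:E := energy_eform alphan fmu.
rewrite ((facts m1 fmu cmu).2 hoo) -EFinM -EFinD /Jfun; congr EFin.
move: (fine _) (riesz_form _ _ _) (riesz_form _ _ _) (riesz_form _ _ _) => a b c e.
by ring.
Qed.

Lemma w_fE : adm Q !=set0 -> w_f alpha D f Q = (w Q)%:E.
Proof.
move=> [mu0 a0]; have [_ ftn] := theta_fine.
apply/eqP; rewrite eq_le; apply/andP; split.
  apply/lee_addgt0Pr => eps eps0.
  have [mu am Jm] := winf_near alphan tp field_constant field_density_ge0 ftn eps0
    (ex_intro _ mu0 a0 : adm Q !=set0).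
  apply: (@le_trans _ _ (J mu)%:E); last by rewrite -EFinD lee_fin.
  by apply: ereal_inf_lbound; exists mu; [exact/Eplus1_fE|exact: energy_fE].
apply: le_ereal_inf_tmp => _ [mu /Eplus1_fE am <-]; rewrite (energy_fE am) lee_fin.
exact: (winf_le alphan tp field_constant field_density_ge0 ftn am).
Qed.

Lemma minimizerE (lam : pmeasure) : adm Q !=set0 ->
  minimizer alpha D f Q lam <-> adm Q lam /\ J lam = w Q.
Proof.
move=> ne; split=> [[/Eplus1_fE al]|[al Jl]].
  by rewrite (energy_fE al) (w_fE ne) => -[Jl].
by split; [exact/Eplus1_fE|rewrite (energy_fE al) (w_fE ne) Jl].
Qed.

(** J is the energy plus twice the integral of the field, and the constant is the energy plus that
    integral once. Its convergence thus reduces to that of the energies and of the infima. *)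
Lemma eq_constantE (lam : pmeasure) : adm Q lam ->
  eq_constant alpha D f lam = ((riesz_form alpha lam lam + J lam) / 2)%:E.
Proof.
move=> al; have [m1 fl cl hoo] := al; have [fi fI] := facts m1 fl cl.
have {}fi := fi.2 hoo; have {}fI := fI hoo.
have [v0 mv iv] := potentials fl fl.
have vD : (\int[lam]_(x in D) potential alpha lam x = (riesz_form alpha lam lam)%:E)%E.
  rewrite -iv [RHS](@ge0_negligible_integral _ _ _ lam setT (~` D))//.
  - by rewrite setTD setCK.
  - exact: measurableC.
  - exact: nullD.
have vi : lam.-integrable D (potential alpha lam).
  apply/integrableP; split; first exact: measurable_funTS.
  by under eq_integral do rewrite gee0_abs//; rewrite vD ltry.
rewrite /eq_constant (integralD mD vi fi) vD fI -EFinD; congr EFin.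
rewrite /Jfun; move: (fine _) (riesz_form _ _ _) (riesz_form _ _ _) (riesz_form _ _ _) => a b c e.
by move: field_constant => g; lra.
Qed.

(** Positive capacity gives a probability measure of finite energy on the set where psi is finite.
    Some sublevel set of the shifted psi has positive mass; the normalized restriction to it is
    admissible, because the density is bounded there. *)
Lemma admissible_nonempty :
  (0 < inner_capacity alpha (Q `&` [set x | (psi x < +oo)%E]))%E -> adm Q !=set0.
Proof.
move=> hcap; have [[mu [[Emu cmu] m1]]|H] := pselect (exists mu,
  Eplus1_on alpha (Q `&` [set x | (psi x < +oo)%E]) mu); last first.
  move: hcap; rewrite /inner_capacity (_ : [set energy alpha mu | mu in _] = set0).
    by rewrite ereal_inf0 invey ltxx.
  by apply/seteqP; split => [y [mu Em _]|y []]; apply: H; exists mu.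
have fmu : riesz_fine alpha mu by exact: Eplus_fineE.
have mp : measurable_fun setT (shifted D psi M : T -> \bar R).
  by apply: lsc_measurable => c; apply: shifted_lsc => //; exact: closed_closure.
pose S N : set T := [set x | (shifted D psi M x <= N%:R%:E)%E].
have mS N : measurable (S N).
  by rewrite -[S N]setTI; exact: emeasurable_fun_infty_c.
(* Otherwise countably many null sets, together with the null set off which the measure is
   concentrated, would cover the space. *)
have [N SN] : exists N, mu (S N) != 0%E.
  apply: contrapT => /forallNP H.
  have S0 N : mu.-negligible (S N).
    by apply/negligibleP => //; apply/eqP; apply: contrapT => /negP; exact: H.
  have neg : mu.-negligible (setT : set T).
    apply: negligibleS (negligibleU (negligible_bigcup S0) cmu) => x _.
    have [[Qx px]|] := pselect ((Q `&` [set x | (psi x < +oo)%E]) x); last by right.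
    left; have Dx : D x by apply: subset_closure; exact: QA.
    have := psiM Dx; move: px; rewrite /mkset; case E : (psi x) => [r| |] // _ _.
    exists (Num.truncn `|r + M|).+1 => //; rewrite /S /= shiftedE// E -EFinD lee_fin.
    by apply: le_trans (ler_norm _) _; exact/ltW/truncnS_gt.
  have m0 : mu [set: T] = 0%E := (negligibleP mu measurableT).1 neg.
  move: m0; rewrite m1 => /eqP.
  by rewrite onee_eq0.
pose nu := restr mu (mS N).
have nuT : nu setT = mu (S N) by rewrite restrE setTI.
have nule : (nu setT <= 1)%E by rewrite nuT -m1 le_measure ?inE.
have nuE : nu setT = (fine (nu setT))%:E.
  by rewrite fineK// ge0_fin_numE//; exact: le_lt_trans nule (ltry _).
set t := fine (nu setT) in nuE.
have t0 : 0 < t.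
  by rewrite -lte_fin -nuE nuT lt0e SN measure_ge0.
have ti0 : 0 <= t^-1 by rewrite invr_ge0 ltW.
pose lam : pmeasure := mscale (NngNum ti0) nu.
have fnu : riesz_fine alpha nu by have [] := fineE_restr alphan (mS N) fmu.
have lamE A : lam A = (t^-1%:E * nu A)%E by [].
have l1 : lam setT = 1%E by rewrite lamE nuE -EFinM mulVf// gt_eqF.
have cl : concentrated lam Q.
  apply: concentrated_scale; apply: concentrated_restr.
  by apply: concentratedS cmu => x [].
have fl : riesz_fine alpha lam by exact: riesz_fineZ.
exists lam; split => //.
have [opoo onoo] := parts_finite omega_fin.
have finE (m : pmeasure) : (m setT < +oo)%E -> (m setT = (fine (m setT))%:E)%E.
  by move=> moo; rewrite fineK// ge0_fin_numE.
(* Bounds the three terms of the density on [S N]: the shifted psi, then each potential or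
   copotential of omega by the kernel bound times the total mass. *)
pose B := N%:R + cut_bound (n:=n) alpha d * fine (omp [set: T]) +
  cut_bound (n:=n) alpha d * fine (omn [set: T]).
have mh : measurable_fun setT field_density by apply: lsc_measurable; exact: field_density_lsc.
have lS : lam (~` S N) = 0%E by rewrite lamE restrE setICl measure0 mule0.
have E := ge0_negligible_integral (measurableC (mS N)) measurableT mh
  (fun x _ => field_density_ge0 x) lS.
rewrite E; clear E.
rewrite setTD setCK.
apply: (@le_lt_trans _ _ (\int[lam]_(x in S N) cst B%:E x)%E).
  apply: ge0_le_integral => //.
  - by move=> x _; exact: field_density_ge0.
  - exact: measurable_funTS.
  - move=> x Sx; rewrite /cst /B !EFinD; apply: leeD; first apply: leeD.
    + exact: Sx.
    + rewrite EFinM -finE// -(cut_pot_add alphan d0 omp x) leeDr// cut_copot_ge0//.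
    + rewrite EFinM -finE// -(cut_pot_add alphan d0 omn x) leeDl// cut_pot_ge0//.
rewrite (integral_cst lam (mS N)).
have : (lam (S N) <= 1)%E by rewrite -l1 le_measure ?inE.
move=> lS1; apply: lte_mul_pinfty => //; last exact: le_lt_trans lS1 (ltry _).
by rewrite lee_fin /B !addr_ge0// mulr_ge0 ?fine_ge0// expR_ge0.
Qed.

End admissible_measures.
End field_reduction.

(** * Convergence of the energies and conclusion *)

Lemma cvg_shift_addl (V : topologicalType) (u : nat -> V) (l : V) N :
  u (N + i)%N @[i --> \oo] --> l -> u i @[i --> \oo] --> l.
Proof.
move=> H A lA; have [m _ mA] := H A lA; exists (N + m)%N => // i /= Ni.
rewrite -(subnKC (leq_trans (leq_addr m N) Ni)); apply: mA.
by rewrite /= leq_subRL// (leq_trans (leq_addr m N)).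
Qed.

Section energy_convergence.
Context {R : realType} {n : nat} (alpha : R).
Hypothesis alphan : alpha < n%:R.
Local Notation pmeasure := (posmeasure R n).
Local Notation e := (riesz_form alpha).
Local Notation q := (riesz_q alpha).

Lemma energy_subE (mu nu : pmeasure) : riesz_fine alpha mu -> riesz_fine alpha nu ->
  energy_sub alpha mu nu = (q mu nu)%:E.
Proof.
move=> fm fn.
have mE (m1 m2 : pmeasure) : riesz_fine alpha m1 -> riesz_fine alpha m2 ->
    mutual_energy alpha m1 m2 = (e m1 m2)%:E.
  move=> f1 f2; rewrite (mutual_energyE alphan).
  exact: (eformE measurable_cball bigcup_cball (kk alphan) (@kC R n alpha) (kp alphan) f1 f2).
rewrite /energy_sub /energy (mE mu mu)// (mE nu nu)// (mE mu nu)// (mE nu mu)//.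
transitivity ((e mu mu + e nu nu - (e mu nu + e nu mu))%:E); first by [].
congr EFin.
rewrite /riesz_q (riesz_formC alphan fn fm).
by move: (e mu mu) (e nu nu) (e mu nu) => a b c; ring.
Qed.

Variables (mu : nat -> pmeasure) (nu : pmeasure).
Hypothesis fmu : forall i, riesz_fine alpha (mu i).
Hypothesis fnu : riesz_fine alpha nu.
Hypothesis qc : q (mu i) nu @[i --> \oo] --> 0.

Lemma riesz_q_strong_cvg : strong_cvg alpha mu nu.
Proof.
rewrite /strong_cvg /strong_dist.
rewrite (_ : (fun j => _) = (fun j => (Num.sqrt (q (mu j) nu))%:E)); last first.
  by apply/funext => j; rewrite energy_subE.
apply: cvg_EFin; first exact: nearW.
by rewrite -(sqrtr0 R); apply: continuous_cvg; [exact: sqrt_continuous|exact: qc].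
Qed.

(** The energy of [mu i] is the squared distance plus twice the mutual energy with [nu] minus the
    energy of [nu], and the mutual energy is continuous by [eform_near]. *)
Lemma riesz_form_cvg : e (mu i) (mu i) @[i --> \oo] --> e nu nu.
Proof.
have c1 : e (mu i) nu @[i --> \oo] --> e nu nu.
  apply/cvgrPdist_le => eps eps0.
  have [delta delta0 H] := eform_near alphan fnu fnu eps0.
  have /cvgrPdist_le/(_ _ delta0) := qc; apply: filterS => i.
  rewrite sub0r normrN => qi; rewrite distrC; apply: H => //.
  by rewrite (riesz_qC alphan fnu (fmu i)); exact: le_trans (ler_norm _) qi.
rewrite (_ : (fun i => _) = (fun i => q (mu i) nu + 2 * e (mu i) nu - e nu nu)); last first.
  apply/funext => i; rewrite /riesz_q.
  by move: (e (mu i) (mu i)) (e nu nu) (e (mu i) nu) => a b c; ring.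
rewrite [X in _ --> X](_ : _ = 0 + 2 * e nu nu - e nu nu); last first.
  by move: (e nu nu) => a; ring.
apply: cvgB; last exact: cvg_cst.
by apply: cvgD; [exact: qc|apply: cvgMr; exact: c1].
Qed.

End energy_convergence.

Theorem theorem2p5 (R : realType) (n : nat) (alpha : R)
  (hn : (2 <= n)%N) (halpha0 : 0 < alpha) (halphan : alpha < n%:R)
  (A : nat -> set 'rV[R]_n) (Alim : set 'rV[R]_n)
  (hAdecr : forall i j : nat, (i <= j)%N -> A j `<=` A i)
  (hAqc : forall j : nat, quasiclosed alpha (A j))
  (hAlim : Alim = \bigcap_j A j)
  (j0 : nat) (hj0 : (inner_capacity alpha (A j0) < +oo)%E)
  (psi : 'rV[R]_n -> \bar R) (theta omega : signed_measure R n)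
  (hpsi : Phi (closure (A 0%N)) psi)
  (htheta : signed_E alpha theta)
  (homega : signed_M alpha omega)
  (homega_bounded : bounded_measure omega)
  (homega_dist : (0 < dist_support omega (A 0%N))%E)
  (hcap : (0 < inner_capacity alpha
                 (Alim `&` [set x | (psi x < +oo)%E]))%E) :
  let D := closure (A 0%N) in
  let f := external_field alpha psi theta omega in
  [/\ forall j : nat, (j0 <= j)%N ->
        exists lam : posmeasure R n, minimizer alpha D f (A j) lam,
      exists lam : posmeasure R n, minimizer alpha D f Alim lam,
      (forall i j : nat, (i <= j)%N ->
         (w_f alpha D f (A i) <= w_f alpha D f (A j))%E) /\
      w_f alpha D f (A j) @[j --> \oo] --> w_f alpha D f Alim
    & forall (lam : nat -> posmeasure R n) (lamA : posmeasure R n),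
        (forall j : nat, (j0 <= j)%N -> minimizer alpha D f (A j) (lam j)) ->
        minimizer alpha D f Alim lamA ->
        [/\ strong_cvg alpha lam lamA,
            vague_cvg lam lamA
          & eq_constant alpha D f (lam j) @[j --> \oo] -->
              eq_constant alpha D f lamA]].
Proof.
move=> D f.
have [M M0 psiM] := Phi_bounded_below hpsi.
have [d d0 dist] := support_dist homega_dist.
have [ftp ftn] := theta_fine halphan htheta.
pose h := field_density alpha (A 0%N) psi omega d M.
pose cst0 := field_constant alpha omega d M.
have h0 : forall x, (0 <= h x)%E by exact: field_density_ge0.
have hlsc : forall c : R, open [set x : 'rV[R]_n | (c%:E < h x)%E].
  by move=> c; exact: field_density_lsc.
pose w Q := winf alpha h (pos_part theta) (neg_part theta) cst0 Q.
have [c c0 Qc] : exists2 c : R, 0 < c & (c%:E <= min_energy alpha (A j0))%E.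
  have [z /andP[capz _]] := lte_between hj0.
  (* [z] lies above the capacity; the maximum makes an upper bound that is certainly positive, so
     that its inverse is a positive lower bound on the energies. *)
  have z0 : 0 < Num.max z 1 by rewrite lt_max ltr01 orbT.
  exists (Num.max z 1)^-1; first by rewrite invr_gt0.
  apply: (capacity_lt_min_energy halphan z0).
  by apply: lt_le_trans capz _; rewrite lee_fin le_max lexx.
have A0 j : A j `<=` A 0%N by exact: hAdecr.
have AlimA j : Alim `<=` A j by rewrite hAlim => x; exact.
have Alim0 : Alim `<=` A 0%N by exact: AlimA.
have ne : admissible alpha h Alim !=set0.
  exact: (admissible_nonempty halphan hpsi homega_bounded d0 psiM Alim0 hcap).
have neA j : admissible alpha h (A j) !=set0.
  by have [m am] := ne; exists m; apply: admissibleS am.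
have minE Q lam (QA : Q `<=` A 0%N) : admissible alpha h Q !=set0 ->
    minimizer alpha D f Q lam <-> admissible alpha h Q lam /\
    Jfun alpha h (pos_part theta) (neg_part theta) cst0 lam = w Q.
  by move=> nQ; exact: (minimizerE halphan hpsi htheta homega_bounded d0 dist psiM QA).
have wE Q (QA : Q `<=` A 0%N) : admissible alpha h Q !=set0 ->
    w_f alpha D f Q = (w Q)%:E.
  by move=> nQ; exact: (w_fE halphan hpsi htheta homega_bounded d0 dist psiM QA).
(* The sequence starts at [j0], where the capacity is finite; as the sets decrease, the intersection
   is unchanged. *)
pose Qs i := A (j0 + i)%N.
have Qdecr i j : (i <= j)%N -> Qs j `<=` Qs i.
  by move=> ij; apply: hAdecr; rewrite leq_add2l.
have QsAlim : \bigcap_i Qs i = Alim.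
  rewrite hAlim; apply/seteqP; split => [x Qx j _|x Ax i _]; last exact: Ax.
  by apply: (hAdecr j (j0 + j)%N) (Qx j I); rewrite leq_addl.
have Qc' : (c%:E <= min_energy alpha (Qs 0%N))%E by rewrite /Qs addn0.
have neQ : admissible alpha h (\bigcap_i Qs i) !=set0 by rewrite QsAlim.
have [[lam0 alam0 Jlam0] W] := decreasing_limit halphan cst0 h0 hlsc ftp ftn Qdecr
  (fun i => hAqc _) c0 Qc' neQ.
rewrite QsAlim in alam0 Jlam0 W.
split.
- move=> j j0j.
  have cap : \bigcap_(i in [set: nat]) A j = A j by rewrite bigcap_const//; exists 0%N.
  have Qcj : (c%:E <= min_energy alpha (A j))%E.
    apply: (le_trans Qc); apply: le_ereal_inf_tmp => _ [mu [[Emu cmu] m1] <-].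
    apply: ereal_inf_lbound; exists mu => //; split => //; split => //.
    by apply: concentratedS cmu; exact: hAdecr.
  (* Existence on a single set is the case of a constant sequence. *)
  have [[lam al Jl] _] := @decreasing_limit R n alpha halphan h _ _ cst0 h0 hlsc ftp ftn
    (fun=> A j) c
    (fun i k _ => @subset_refl _ (A j)) (fun i => hAqc j) c0 Qcj ltac:(by rewrite cap).
  by exists lam; apply/minE => //; rewrite -cap.
- by exists lam0; apply/minE.
- split.
    (* Every index is allowed, also below [j0]: a measure admissible for the intersection is
       admissible for each [A j], so [wE] applies. Only the limit is taken along the tail. *)
    move=> i j ij; rewrite !wE// lee_fin.
    exact: (winfS halphan _ _ h0 ftn (hAdecr _ _ ij)).
  rewrite wE//; apply: (@cvg_shift_addl _ _ _ j0).
  under eq_fun do rewrite wE//.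
  by apply: cvg_EFin; [exact: nearW|exact: W].
- move=> lam lamA mlam /(minE _ _ Alim0 ne)[alA JlA].
  pose lam' i := lam (j0 + i)%N.
  have mlam' i : admissible alpha h (Qs i) (lam' i) /\
      Jfun alpha h (pos_part theta) (neg_part theta) cst0 (lam' i) = w (Qs i).
    by apply/minE => //; [exact: A0|exact: neA|apply: mlam; exact: leq_addr].
  have alam' i := (mlam' i).1.
  have Jlam' i := (mlam' i).2.
  have fl' i : riesz_fine alpha (lam' i) by have [] := alam' i.
  have flA : riesz_fine alpha lamA by have [] := alA.
  have alA' := alA; have JlA' := JlA; rewrite -QsAlim in alA' JlA'.
  have qc := minimizers_strong_cvg halphan h0 hlsc ftp ftn Qdecr (fun i => hAqc _) c0 Qc'
    neQ alam' Jlam' alA' JlA'.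
  split.
  + apply: (@cvg_shift_addl _ (fun j => strong_dist alpha (lam j) lamA) _ j0).
    exact: (riesz_q_strong_cvg halphan fl' flA qc).
  + move=> phi phic phik.
    apply: (@cvg_shift_addl _ (fun j => (\int[lam j]_x (phi x)%:E)%E) _ j0).
    exact: (minimizers_vague_cvg halphan h0 hlsc ftp ftn Qdecr (fun i => hAqc _) c0 Qc'
      neQ alam' Jlam' alA' JlA' phic phik).
  + have cE Q m (QA : Q `<=` A 0%N) : admissible alpha h Q m ->
        eq_constant alpha D f m = ((riesz_form alpha m m +
          Jfun alpha h (pos_part theta) (neg_part theta) cst0 m) / 2)%:E.
      exact: (eq_constantE halphan hpsi htheta homega_bounded d0 dist psiM QA).
    rewrite (cE _ _ Alim0 alA); apply: (@cvg_shift_addl _ _ _ j0).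
    under eq_fun do rewrite (cE _ _ (A0 _) (alam' _)).
    apply: cvg_EFin; first exact: nearW.
    apply: cvgMl; apply: cvgD; first exact: riesz_form_cvg.
    by rewrite JlA; under eq_fun do rewrite Jlam'; exact: W.
Qed.
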